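(* Let $(\mathfrak g,\mathfrak k)$ be a symmetric pair. For each $w\in W^1$ the corresponding Harish-Chandra projection $\mathrm{hc}_w$ restricts to a surjective algebra homomorphism $$\mathrm{hc}_w:\mathrm{Cl}(\mathfrak p)^{\mathfrak k}\to\mathrm{Cl}(\mathfrak a).$$
   Context: Setting: $\mathfrak g$ is the complexified Lie algebra of a compact connected simple Lie group with involution $\Theta$, $\theta=d\Theta$, $\mathfrak k=\mathfrak g^\theta$, $\mathfrak p$ the $(-1)$-eigenspace of $\theta$; $B$ is a nondegenerate $\mathfrak g$- and $\theta$-invariant symmetric bilinear form on $\mathfrak g$. $\mathfrak t\subset\mathfrak k$ is a Cartan subalgebra, $\mathfrak h=\mathfrak t\oplus\mathfrak a$ with $\mathfrak a\subset\mathfrak p$ the Cartan subalgebra of $\mathfrak g$ containing $\mathfrak t$. $\mathrm{Cl}(V)=T(V)/\langle u\otimes v+v\otimes u-2B(u,v)\rangle$ for $V=\mathfrak p,\mathfrak a$. Harish-Chandra projections: $\Delta(\mathfrak g,\mathfrak t)$ is the set of nonzero $\mathfrak t$-weights of $\mathfrak g$, $W_{\mathfrak g}$ the Weyl group of this root system; fix positive systems $\Delta^+(\mathfrak k,\mathfrak t)\subset\Delta^+(\mathfrak g,\mathfrak t)$; $\rho_{\mathfrak g}\in\mathfrak t^*$ is the half sum of $\Delta^+(\mathfrak g,\mathfrak t)$ with multiplicity; $W^1=\{w\in W_{\mathfrak g}:w\rho_{\mathfrak g}\text{ is }\mathfrak k\text{-dominant}\}$. For $w\in W^1$, $w\Delta^+(\mathfrak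 g,\mathfrak t)$ gives $\mathfrak g=\mathfrak n_w^+\oplus\mathfrak h\oplus\mathfrak n_w^-$; with $\mathfrak p_w^\pm=\mathfrak p\cap\mathfrak n_w^\pm$ one has $\mathfrak p=\mathfrak p_w^+\oplus\mathfrak a\oplus\mathfrak p_w^-$ and $\mathrm{Cl}(\mathfrak p)=\mathrm{Cl}(\mathfrak a)\oplus(\mathfrak p_w^-\mathrm{Cl}(\mathfrak p)+\mathrm{Cl}(\mathfrak p)\mathfrak p_w^+)$; $\mathrm{hc}_w:\mathrm{Cl}(\mathfrak p)\to\mathrm{Cl}(\mathfrak a)$ is the corresponding projection. *)

(* Defs.v *)
From HB Require Import structures.
From mathcomp Require Import all_boot all_order all_algebra.
From mathcomp Require Import finmap.
From mathcomp Require Import boolp classical_sets reals complex.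
From mathcomp.multinomials Require Import monalg.

Set Implicit Arguments.
Unset Strict Implicit.
Unset Printing Implicit Defensive.

Import Order.TTheory GRing.Theory Num.Theory VectorInternalTheory.
Local Open Scope ring_scope.
Local Open Scope quotient_scope.

Definition leibniz (A : pzRingType) (d : A -> A) : Prop :=
  forall x y, d (x * y) = d x * y + x * d y.

(* The operations on quotients are locked to keep unification from computing
   with representatives *)
Fact quot_key : unit. Proof. exact: tt. Qed.

Section IdealQuotient.
Variables (K : fieldType) (A : algType K) (S : A -> Prop).

Inductive ideal_gen : A -> Prop :=
| ideal_gen_in x of S x : ideal_gen x
| ideal_gen0 : ideal_gen 0
| ideal_genD x y of ideal_gen x & ideal_gen y : ideal_gen (x + y)
| ideal_genMl a x of ideal_gen x : ideal_gen (a * x)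
| ideal_genMr a x of ideal_gen x : ideal_gen (x * a).

Definition in_ideal_gen : {pred A} := fun x => `[< ideal_gen x >].

Lemma in_ideal_genP x : reflect (ideal_gen x) (x \in in_ideal_gen).
Proof. exact: asboolP. Qed.

Fact in_ideal_gen_zmod : zmod_closed in_ideal_gen.
Proof.
split=> [|x y]; first by apply/in_ideal_genP/ideal_gen0.
move=> /in_ideal_genP xI /in_ideal_genP yI; apply/in_ideal_genP.
by apply: ideal_genD => //; rewrite -mulN1r; apply: ideal_genMl.
Qed.

HB.instance Definition _ := GRing.isZmodClosed.Build A in_ideal_gen
  in_ideal_gen_zmod.


Definition alg_quot := Quotient.quot in_ideal_gen.

HB.instance Definition _ := GRing.Zmodule.on alg_quot.

Definition quot_pi : A -> alg_quot :=
  locked_with quot_key (fun x => \pi_alg_quot x).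

Lemma quot_piE x : quot_pi x = \pi_alg_quot x.
Proof. by rewrite /quot_pi unlock. Qed.

Lemma quot_piP x y : quot_pi x = quot_pi y <-> ideal_gen (x - y).
Proof.
split=> [/eqP|xy].
  by rewrite !quot_piE -Quotient.idealrBE => /in_ideal_genP.
by apply/eqP; rewrite !quot_piE -Quotient.idealrBE; apply/in_ideal_genP.
Qed.

Lemma quot_reprK (x : alg_quot) : quot_pi (repr x) = x.
Proof. by rewrite quot_piE reprK. Qed.

Lemma ideal_gen_repr (x : A) : ideal_gen (repr (quot_pi x) - x).
Proof. by apply/quot_piP; rewrite quot_reprK. Qed.

Lemma ideal_genZ c x : ideal_gen x -> ideal_gen (c *: x).
Proof. by rewrite -mulr_algl; apply: ideal_genMl. Qed.

Lemma ideal_genN x : ideal_gen x -> ideal_gen (- x).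
Proof. by rewrite -scaleN1r; apply: ideal_genZ. Qed.

Fact quot_pi_is_zmod_morphism : zmod_morphism quot_pi.
Proof.
by move=> x y; rewrite !quot_piE; exact: (pi_is_zmod_morphism alg_quot).
Qed.
HB.instance Definition _ := GRing.isZmodMorphism.Build A alg_quot quot_pi
  quot_pi_is_zmod_morphism.

Definition quot_one : alg_quot := quot_pi 1.
Definition quot_mul : alg_quot -> alg_quot -> alg_quot :=
  locked_with quot_key (fun x y => quot_pi (repr x * repr y)).
Definition quot_scale : K -> alg_quot -> alg_quot :=
  locked_with quot_key (fun c x => quot_pi (c *: repr x)).

Fact quot_mul_pi x y : quot_mul (quot_pi x) (quot_pi y) = quot_pi (x * y).
Proof.
rewrite /quot_mul unlock; apply/quot_piP.
have -> : repr (quot_pi x) * repr (quot_pi y) - x * y =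
  repr (quot_pi x) * (repr (quot_pi y) - y) + (repr (quot_pi x) - x) * y.
  by rewrite mulrBr mulrBl addrA subrK.
by apply: ideal_genD; [apply: ideal_genMl|apply: ideal_genMr];
   apply: ideal_gen_repr.
Qed.

Fact quot_scale_pi c x : quot_scale c (quot_pi x) = quot_pi (c *: x).
Proof.
rewrite /quot_scale unlock; apply/quot_piP.
by rewrite -scalerBr; apply/ideal_genZ/ideal_gen_repr.
Qed.

Let quotW (P : alg_quot -> Prop) : (forall x, P (quot_pi x)) -> forall x, P x.
Proof. by move=> Ppi x; rewrite -[x]quot_reprK. Qed.

Fact quot_mulA : associative quot_mul.
Proof.
by elim/quotW=> x; elim/quotW=> y; elim/quotW=> z; rewrite !quot_mul_pi mulrA.
Qed.
Fact quot_mul1r : left_id quot_one quot_mul.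
Proof. by elim/quotW=> x; rewrite quot_mul_pi mul1r. Qed.
Fact quot_mulr1 : right_id quot_one quot_mul.
Proof. by elim/quotW=> x; rewrite quot_mul_pi mulr1. Qed.
Fact quot_mulDl : left_distributive quot_mul +%R.
Proof.
elim/quotW=> x; elim/quotW=> y; elim/quotW=> z.
by rewrite -raddfD !quot_mul_pi -raddfD mulrDl.
Qed.
Fact quot_mulDr : right_distributive quot_mul +%R.
Proof.
elim/quotW=> x; elim/quotW=> y; elim/quotW=> z.
by rewrite -raddfD !quot_mul_pi -raddfD mulrDr.
Qed.
HB.instance Definition _ := GRing.Zmodule_isPzRing.Build alg_quot
  quot_mulA quot_mul1r quot_mulr1 quot_mulDl quot_mulDr.

Fact quot_scaleA c d x : quot_scale c (quot_scale d x) = quot_scale (c * d) x.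
Proof. by elim/quotW: x => x; rewrite !quot_scale_pi scalerA. Qed.
Fact quot_scale1r : left_id 1 quot_scale.
Proof. by elim/quotW=> x; rewrite quot_scale_pi scale1r. Qed.
Fact quot_scaleDr : right_distributive quot_scale +%R.
Proof.
move=> c; elim/quotW=> x; elim/quotW=> y.
by rewrite -raddfD !quot_scale_pi -raddfD scalerDr.
Qed.
Fact quot_scaleDl x : {morph quot_scale^~ x : c d / c + d}.
Proof.
by elim/quotW: x => x c d; rewrite !quot_scale_pi -raddfD scalerDl.
Qed.
HB.instance Definition _ := GRing.Zmodule_isLmodule.Build K alg_quot
  quot_scaleA quot_scale1r quot_scaleDr quot_scaleDl.

Fact quot_pi_is_monoid_morphism : monoid_morphism quot_pi.
Proof. by split=> // x y; rewrite -quot_mul_pi. Qed.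
HB.instance Definition _ := GRing.isMonoidMorphism.Build A alg_quot quot_pi
  quot_pi_is_monoid_morphism.

Fact quot_pi_is_scalable : scalable quot_pi.
Proof. by move=> c x; rewrite -quot_scale_pi. Qed.
HB.instance Definition _ := GRing.isScalable.Build K A alg_quot *:%R quot_pi
  quot_pi_is_scalable.

Lemma quot_piD : {morph quot_pi : x y / x + y}.
Proof. exact: raddfD. Qed.
Lemma quot_pi1 : quot_pi 1 = 1.
Proof. by []. Qed.
Lemma quot_piM : {morph quot_pi : x y / x * y}.
Proof. exact: rmorphM. Qed.
Lemma quot_piZ c : {morph quot_pi : x / c *: x}.
Proof. exact: quot_pi_is_scalable. Qed.

Lemma quot_scaleAl (c : K) (x y : alg_quot) : c *: (x * y) = c *: x * y.
Proof.
elim/quotW: x => x; elim/quotW: y => y.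
by rewrite -(quot_piM x) -(quot_piZ c x) -(quot_piZ c (x * y)) -quot_piM scalerAl.
Qed.
Lemma quot_scaleAr (c : K) (x y : alg_quot) : c *: (x * y) = x * (c *: y).
Proof.
elim/quotW: x => x; elim/quotW: y => y.
by rewrite -(quot_piM x) -(quot_piZ c y) -(quot_piZ c (x * y)) -quot_piM scalerAr.
Qed.

End IdealQuotient.

Section QuotientLift.
Variables (K : fieldType) (A B : algType K).
Variables (S : A -> Prop) (S' : B -> Prop).

(* The map induced on quotients; it is meaningful when F sends the ideal
   generated by S into the one generated by S', see quot_lift_pi *)
Definition quot_lift (F : A -> B) (x : alg_quot S) : alg_quot S' :=
  quot_pi S' (F (repr x)).

Lemma quot_lift_pi (F : A -> B) :
  linear F ->
  (forall x, ideal_gen S x -> ideal_gen S' (F x)) ->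
  forall x, quot_lift F (quot_pi S x) = quot_pi S' (F x).
Proof.
move=> linF FS x; apply/quot_piP.
have -> : F (repr (quot_pi S x)) - F x = F (repr (quot_pi S x) - x).
  by rewrite -scaleN1r addrC -linF scaleN1r addrC.
exact/FS/ideal_gen_repr.
Qed.

Lemma quot_lift_linear (F : A -> B) :
  linear F ->
  (forall x, ideal_gen S x -> ideal_gen S' (F x)) ->
  linear (quot_lift F).
Proof.
move=> linF FS c x y; have FE := quot_lift_pi linF FS.
rewrite -[x]quot_reprK -[y]quot_reprK -quot_piZ -quot_piD !FE linF.
by rewrite quot_piD quot_piZ.
Qed.

Lemma quot_lift_hom (F : A -> B) :
    linear F -> monoid_morphism F -> (forall x, S x -> ideal_gen S' (F x)) ->
  [/\ linear (quot_lift F), monoid_morphism (quot_lift F) &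
      forall x, quot_lift F (quot_pi S x) = quot_pi S' (F x)].
Proof.
move=> linF [F1 FM] FS.
have FD x y : F (x + y) = F x + F y by rewrite -[x]scale1r linF !scale1r.
have F0 : F 0 = 0 by apply: (addrI (F 0)); rewrite -FD !addr0.
have FI x : ideal_gen S x -> ideal_gen S' (F x).
  elim=> {x} [x /FS //||x y _ Fx _ Fy|a x _ Fx|a x _ Fx].
  - by rewrite F0; apply: ideal_gen0.
  - by rewrite FD; apply: ideal_genD.
  - by rewrite FM; apply: ideal_genMl.
  - by rewrite FM; apply: ideal_genMr.
have FE := quot_lift_pi linF FI; split=> //; first exact: quot_lift_linear.
split.
- by have := FE 1; rewrite F1.
- move=> x y; rewrite -[x]quot_reprK -[y]quot_reprK -quot_piM !FE FM.
  by rewrite quot_piM.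
Qed.

End QuotientLift.
Arguments quot_lift {K A B} S S' F x.

Lemma quot_lift_der (K : fieldType) (A : algType K) (S : A -> Prop)
    (d : A -> A) :
    linear d -> leibniz d -> (forall x, S x -> ideal_gen S (d x)) ->
  [/\ linear (quot_lift S S d), leibniz (quot_lift S S d) &
      forall x, quot_lift S S d (quot_pi S x) = quot_pi S (d x)].
Proof.
move=> lind dM dS.
have dD x y : d (x + y) = d x + d y by rewrite -[x]scale1r lind !scale1r.
have d0 : d 0 = 0 by apply: (addrI (d 0)); rewrite -dD !addr0.
have dI x : ideal_gen S x -> ideal_gen S (d x).
  elim=> {x} [x /dS //||x y _ dx _ dy|a x Ix dx|a x Ix dx].
  - by rewrite d0; apply: ideal_gen0.
  - by rewrite dD; apply: ideal_genD.
  - by rewrite dM; apply: ideal_genD; apply: ideal_genMl.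
  - by rewrite dM; apply: ideal_genD; apply: ideal_genMr.
have dE := quot_lift_pi lind dI; split=> //; first exact: quot_lift_linear.
by move=> x y; rewrite -[x]quot_reprK -[y]quot_reprK -quot_piM !dE dM;
  rewrite quot_piD !quot_piM.
Qed.

Fact malg_scalerAr (R : comNzRingType) (M : monomType) (c : R)
  (x y : {malg R[M]}) : c *: (x * y) = x * (c *: y).
Proof.
rewrite -(mul_malgC c (x * y)) -(mul_malgC c y) !mulrA; congr (_ * y).
rewrite [x]monalgE mulr_sumr mulr_suml; apply: eq_bigr => m _.
by rewrite !malgM_def !fgmulUU mul1m mulm1 mulrC.
Qed.

Section TensorAlgebra.
Variables (K : fieldType) (V : lmodType K).

(* The free algebra on the set V; T(V) is its quotient by the relations making
   the inclusion of V linear *)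
Definition free_alg := {malg K[{fmonom V}]}.

HB.instance Definition _ := GRing.Lalgebra.on free_alg.

HB.instance Definition _ := GRing.Lalgebra_isAlgebra.Build K free_alg
  (@malg_scalerAr K {fmonom V}).

Definition free_gen (v : V) : free_alg := << fmu v >>.

Definition linear_rel (x : free_alg) : Prop :=
  exists (c : K) (u v : V),
    x = free_gen (c *: u + v) - (c *: free_gen u + free_gen v).

Definition tensor_alg := alg_quot linear_rel.

HB.instance Definition _ := GRing.PzRing.on tensor_alg.
HB.instance Definition _ := GRing.Lmodule.on tensor_alg.

Fact tensor_alg_oner_neq0 : (1 : tensor_alg) != 0.
Proof.
apply/eqP; rewrite -(rmorph1 (quot_pi linear_rel)).
rewrite -(raddf0 (quot_pi linear_rel)) => /quot_piP; rewrite subr0 => I1.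
suff I0 (x : free_alg) : ideal_gen linear_rel x -> mcoeff (@mone {fmonom V}) x = 0.
  by have /eqP := I0 _ I1; rewrite mcoeff1 eqxx oner_eq0.
have g0 v : mcoeff (@mone {fmonom V}) (free_gen v) = 0 :> K.
  by rewrite mcoeffU1 -fdeg_eq0 fdegU.
elim=> {x I1} [_ [c [u [v ->]]]||x y _ x0 _ y0|a x _ x0|a x _ x0].
- by rewrite mcoeffB mcoeffD mcoeffZ !g0 mulr0 addr0 subr0.
- exact: mcoeff0.
- by rewrite mcoeffD x0 y0 addr0.
- by rewrite rmorphM /= x0 mulr0.
- by rewrite rmorphM /= x0 mul0r.
Qed.
HB.instance Definition _ := GRing.PzSemiRing_isNonZero.Build tensor_alg
  tensor_alg_oner_neq0.
HB.instance Definition _ := GRing.Lmodule_isLalgebra.Build K tensor_alg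
  (@quot_scaleAl K free_alg linear_rel).
HB.instance Definition _ := GRing.Lalgebra_isAlgebra.Build K tensor_alg
  (@quot_scaleAr K free_alg linear_rel).

Definition tensor_gen (v : V) : tensor_alg := quot_pi linear_rel (free_gen v).

Lemma tensor_gen_linear : linear tensor_gen.
Proof.
move=> c u v; rewrite /tensor_gen -quot_piZ -quot_piD; apply/quot_piP.
by apply: ideal_gen_in; exists c, u, v.
Qed.

Variable b : V -> V -> K.

Definition clifford_rel (x : tensor_alg) : Prop :=
  exists u v : V, x = tensor_gen u * tensor_gen v + tensor_gen v * tensor_gen u
                      - (2 * b u v)%:A.

Definition clifford := alg_quot clifford_rel.

HB.instance Definition _ := GRing.PzRing.on clifford.
HB.instance Definition _ := GRing.Lmodule.on clifford.

Definition clifford_gen (v : V) : clifford := quot_pi clifford_rel (tensor_gen v).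

Lemma clifford_gen_linear : linear clifford_gen.
Proof.
by move=> c u v; rewrite /clifford_gen tensor_gen_linear quot_piD quot_piZ.
Qed.

Lemma clifford_genM u v :
  clifford_gen u * clifford_gen v + clifford_gen v * clifford_gen u =
  (2 * b u v) *: (1 : clifford).
Proof.
have : quot_pi clifford_rel (tensor_gen u * tensor_gen v +
    tensor_gen v * tensor_gen u) = quot_pi clifford_rel ((2 * b u v)%:A).
  by apply/quot_piP; apply: ideal_gen_in; exists u, v.
rewrite quot_piD.
rewrite (quot_piM _ (tensor_gen u)).
rewrite (quot_piM _ (tensor_gen v)).
move=> ->.
exact: quot_piZ.
Qed.

End TensorAlgebra.

Section FreeExtension.
Variables (K : fieldType) (V : lmodType K).

(* The linear map on the free algebra with prescribed values on words *)
Definition free_ext (B : lmodType K) (h : seq V -> B) (x : free_alg V) : B :=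
  \sum_(m <- msupp x) mcoeff m x *: h m.

Lemma free_ext_linear (B : lmodType K) (h : seq V -> B) : linear (free_ext h).
Proof.
have extE (d : {fset {fmonom V}}) x : (msupp x `<=` d)%fset ->
    free_ext h x = \sum_(m <- d) mcoeff m x *: h m.
  move=> xd; rewrite /free_ext (big_fset_incl _ xd) //= => m _.
  by move/mcoeff_outdom ->; rewrite scale0r.
move=> c x y; pose d := (msupp x `|` msupp y)%fset.
rewrite (extE d x) ?fsubsetUl // (extE d y) ?fsubsetUr // (extE d); last first.
  rewrite (fsubset_trans (msuppD_le _ _)) // fsetSU //; exact: msuppZ_le.
rewrite scaler_sumr -big_split /=; apply: eq_bigr => m _.
by rewrite mcoeffD mcoeffZ scalerDl scalerA.
Qed.

Lemma free_extU (B : lmodType K) (h : seq V -> B) (m : {fmonom V}) :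
  free_ext h << m >> = h m.
Proof. by rewrite /free_ext msuppU1 big_seq_fset1 mcoeffUU scale1r. Qed.

Lemma free_alg_ind (P : free_alg V -> Prop) : P 0 ->
  (forall (c : K) (m : {fmonom V}) x, P x -> P (c *: << m >> + x)) ->
  forall x, P x.
Proof.
move=> P0 PD x; rewrite [x]monalgE; elim: (enum_fset _) => [|m s IHs].
  by rewrite big_nil.
rewrite big_cons.
have -> : << x@_m *g m >> = x@_m *: << m >> :> free_alg V.
  by apply/malgP => k; rewrite mcoeffZ !mcoeffU mulrnAr mulr1.
exact: PD.
Qed.

End FreeExtension.

Section PlainLinear.
Variables (K : fieldType) (U W : lmodType K) (f : U -> W).
Hypothesis linf : linear f.

Lemma lin0 : f 0 = 0.
Proof. by have := linf (-1) 0 0; rewrite scaler0 addr0 scaleN1r addNr. Qed.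

Lemma linZ c x : f (c *: x) = c *: f x.
Proof. by rewrite -[c *: x]addr0 linf lin0 addr0. Qed.

Lemma linD x y : f (x + y) = f x + f y.
Proof. by rewrite -[x]scale1r linf !scale1r. Qed.

Lemma linB x y : f (x - y) = f x - f y.
Proof. by rewrite -!scaleN1r linD linZ. Qed.
End PlainLinear.

Section Spanning.
Variables (K : fieldType) (A : algType K) (I : Type) (w : I -> A).
Hypothesis span_ind : forall P : A -> Prop, P 0 ->
  (forall (c : K) i x, P x -> P (c *: w i + x)) -> forall x, P x.

Lemma span_monoid (B : algType K) (f : A -> B) : linear f ->
    (forall i j, f (w i * w j) = f (w i) * f (w j)) ->
  forall x y, f (x * y) = f x * f y.
Proof.
move=> lin fM x y.
elim/span_ind: x => [|c i x IHx]; first by rewrite mul0r lin0 // mul0r.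
rewrite !mulrDl -!scalerAl !lin IHx mulrDl -scalerAl; congr (_ *: _ + _).
elim/span_ind: y {IHx} => [|d j y IHy]; first by rewrite mulr0 lin0 // mulr0.
by rewrite !mulrDr -!scalerAr !lin IHy mulrDr -scalerAr fM.
Qed.

Lemma span_leibniz (d : A -> A) : linear d ->
    (forall i j, d (w i * w j) = d (w i) * w j + w i * d (w j)) ->
  leibniz d.
Proof.
move=> lin dM x y.
elim/span_ind: x => [|c i x IHx]; first by rewrite !mul0r lin0 // mul0r addr0.
rewrite !mulrDl -!scalerAl !lin IHx !mulrDl -!scalerAl addrACA -scalerDr.
congr (_ *: _ + _).
elim/span_ind: y {IHx} => [|b j y IHy].
  by rewrite !mulr0 lin0 // mulr0 addr0.
by rewrite !mulrDr -!scalerAr !lin IHy !mulrDr -!scalerAr addrACA -scalerDr dM.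
Qed.
End Spanning.

(* The sum of the products g v_1 * .. * dg v_i * .. * g v_n over i <= n *)
Fixpoint word_der (V : Type) (A : pzRingType) (g dg : V -> A) (s : seq V) : A :=
  if s is v :: s' then
    dg v * (\prod_(u <- s') g u) + g v * word_der g dg s'
  else 0.

Lemma word_der_cat (V : Type) (A : pzRingType) (g dg : V -> A) (s t : seq V) :
  word_der g dg (s ++ t) =
  word_der g dg s * (\prod_(u <- t) g u) + (\prod_(u <- s) g u) * word_der g dg t.
Proof.
elim: s => [|v s IHs]; first by rewrite /= big_nil mul0r mul1r add0r.
rewrite cat_cons /= IHs big_cons big_cat /=.
by rewrite mulrDl mulrDr !mulrA addrA.
Qed.

Section FreeMaps.
Variable K : fieldType.

Fact malgUM (V : lmodType K) (m n : {fmonom V}) :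
  << m >> * << n >> = << mmul m n >> :> free_alg V.
Proof. by rewrite malgM_def fgmulUU mulr1. Qed.

Definition free_map (V W : lmodType K) (f : V -> W) : free_alg V -> free_alg W :=
  free_ext (fun s => \prod_(v <- s) free_gen (f v)).

Lemma free_map_linear (V W : lmodType K) (f : V -> W) : linear (free_map f).
Proof. exact: free_ext_linear. Qed.

Lemma free_map_gen (V W : lmodType K) (f : V -> W) v :
  free_map f (free_gen v) = free_gen (f v).
Proof. by rewrite /free_map free_extU fmU big_seq1. Qed.

Lemma free_map_monoid (V W : lmodType K) (f : V -> W) :
  monoid_morphism (free_map f).
Proof.
split=> [|x y]; first by rewrite /free_map free_extU fm1 big_nil.
apply: (span_monoid (@free_alg_ind K V)) (free_map_linear f) _ x y => m n.
by rewrite malgUM /free_map !free_extU fmM big_cat.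
Qed.

Definition free_der (V : lmodType K) (D : V -> V) : free_alg V -> free_alg V :=
  free_ext (word_der (@free_gen K V) (fun v => free_gen (D v))).

Lemma free_der_linear (V : lmodType K) (D : V -> V) : linear (free_der D).
Proof. exact: free_ext_linear. Qed.

Lemma free_der_gen (V : lmodType K) (D : V -> V) v :
  free_der D (free_gen v) = free_gen (D v).
Proof. by rewrite /free_der free_extU fmU /= big_nil mulr1 mulr0 addr0. Qed.

Fact free_wordE (V : lmodType K) (m : {fmonom V}) :
  << m >> = \prod_(v <- m) free_gen v :> free_alg V.
Proof.
case: m => s; elim: s => [|v s IHs].
  by rewrite big_nil; congr (<< _ >>); apply: val_inj; rewrite /= fm1.
rewrite big_cons; transitivity (free_gen v * << FMonom s >>); last by rewrite IHs.
rewrite malgUM; congr (<< _ >>); apply: val_inj.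
by rewrite /= fmM fmU.
Qed.

Lemma free_der_leibniz (V : lmodType K) (D : V -> V) : leibniz (free_der D).
Proof.
apply: (span_leibniz (@free_alg_ind K V)) (free_der_linear D) _ => m n.
rewrite malgUM /free_der !free_extU fmM !free_wordE.
exact: word_der_cat.
Qed.

End FreeMaps.

Section CliffordMaps.
Variable K : fieldType.

Definition tensor_map (V W : lmodType K) (f : V -> W) :
    tensor_alg V -> tensor_alg W :=
  quot_lift (@linear_rel K V) (@linear_rel K W) (free_map f).

Lemma tensor_map_hom (V W : lmodType K) (f : V -> W) : linear f ->
  [/\ linear (tensor_map f), monoid_morphism (tensor_map f) &
      forall v, tensor_map f (tensor_gen v) = tensor_gen (f v)].
Proof.
move=> linf.
have [] := @quot_lift_hom K _ _ (@linear_rel K V) (@linear_rel K W) _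
  (free_map_linear f) (free_map_monoid f).
  move=> _ [c [u [v ->]]].
  rewrite (linB (free_map_linear f)) (free_map_linear f) !(free_map_gen f) linf.
  by apply: ideal_gen_in; exists c, (f u), (f v).
by move=> Tlin Tmon TE; split=> // v; apply: etrans (TE _) (congr1 _ (free_map_gen f v)).
Qed.

Definition clifford_map (V W : lmodType K) (b : V -> V -> K) (b' : W -> W -> K)
    (f : V -> W) : clifford b -> clifford b' :=
  quot_lift (clifford_rel b) (clifford_rel b') (tensor_map f).
Arguments clifford_map {V W} b b' f x.

Lemma clifford_map_hom (V W : lmodType K) (b : V -> V -> K) (b' : W -> W -> K)
    (f : V -> W) : linear f -> (forall u v, b' (f u) (f v) = b u v) ->
  [/\ linear (clifford_map b b' f), monoid_morphism (clifford_map b b' f) &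
      forall v, clifford_map b b' f (clifford_gen b v) = clifford_gen b' (f v)].
Proof.
move=> linf isof; have [Tlin Tmon Tgen] := tensor_map_hom linf.
have [] := @quot_lift_hom K _ _ (clifford_rel b) (clifford_rel b') _ Tlin Tmon.
  move=> _ [u [v ->]].
  rewrite (linB Tlin) (linZ Tlin) (linD Tlin) Tmon.1 !Tmon.2 !Tgen -isof.
  by apply: ideal_gen_in; exists (f u), (f v).
by move=> Clin Cmon CE; split=> // v; apply: etrans (CE _) (congr1 _ (Tgen v)).
Qed.

Definition tensor_der (V : lmodType K) (D : V -> V) : tensor_alg V -> tensor_alg V :=
  quot_lift (@linear_rel K V) (@linear_rel K V) (free_der D).

Lemma tensor_der_der (V : lmodType K) (D : V -> V) : linear D ->
  [/\ linear (tensor_der D), leibniz (tensor_der D) &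
      forall v, tensor_der D (tensor_gen v) = tensor_gen (D v)].
Proof.
move=> linD'.
have [] := @quot_lift_der K _ (@linear_rel K V) _
  (free_der_linear D) (free_der_leibniz D).
  move=> _ [c [u [v ->]]].
  rewrite (linB (free_der_linear D)) (free_der_linear D) !(free_der_gen D) linD'.
  by apply: ideal_gen_in; exists c, (D u), (D v).
by move=> Tlin Tlei TE; split=> // v; apply: etrans (TE _) (congr1 _ (free_der_gen D v)).
Qed.

Definition clifford_der (V : lmodType K) (b : V -> V -> K) (D : V -> V) :
    clifford b -> clifford b :=
  quot_lift (clifford_rel b) (clifford_rel b) (tensor_der D).
Arguments clifford_der {V} b D x.

Fact leibniz_anticomm (A : algType K) (d : A -> A) (x y : A) (b b1 b2 : K) :
    linear d -> leibniz d -> b1 + b2 = 0 ->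
  d (x * y + y * x - (2 * b)%:A) =
  (d x * y + y * d x - (2 * b1)%:A) + (x * d y + d y * x - (2 * b2)%:A).
Proof.
move=> lind dM b12; have d1 : d 1 = 0.
  by apply: (addrI (d 1)); rewrite addr0 -{3}[1]mulr1 dM mul1r mulr1.
rewrite (linB lind) (linZ lind) d1 scaler0 subr0 (linD lind) !dM.
rewrite [RHS]addrACA -opprD -scalerDl -mulrDr b12 mulr0 scale0r subr0.
by rewrite [d y * x + _]addrC addrACA.
Qed.

Lemma clifford_der_der (V : lmodType K) (b : V -> V -> K) (D : V -> V) :
    linear D -> (forall u v, b (D u) v + b u (D v) = 0) ->
  [/\ linear (clifford_der b D), leibniz (clifford_der b D) &
      forall v, clifford_der b D (clifford_gen b v) = clifford_gen b (D v)].
Proof.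
move=> linD' skewD; have [Tlin Tlei Tgen] := tensor_der_der linD'.
have [] := @quot_lift_der K _ (clifford_rel b) _ Tlin Tlei.
  move=> _ [u [v ->]]; rewrite (leibniz_anticomm _ _ _ Tlin Tlei (skewD u v)).
  rewrite !Tgen.
  by apply: ideal_genD; apply: ideal_gen_in; [exists (D u), v|exists u, (D v)].
by move=> Clin Clei CE; split=> // v; apply: etrans (CE _) (congr1 _ (Tgen v)).
Qed.

End CliffordMaps.
Arguments clifford_map {K V W} b b' f x.
Arguments clifford_der {K V} b D x.

Lemma linfun_linE (K : fieldType) (U W : vectType K) (f : U -> W) :
  linear f -> linfun f =1 f.
Proof.
move=> linf; pose F := GRing.isLinear.Build K U W *:%R f linf.
pose fL : {linear U -> W} := HB.pack f F.
exact: (lfunE fL).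
Qed.

HB.mixin Record Vector_isLieAlgebra (K : fieldType) L of Vector K L := {
  lie : L -> L -> L;
  lie_linearl : forall (c : K) x y z, lie (c *: x + y) z = c *: lie x z + lie y z;
  lie_linearr : forall (c : K) x y z, lie z (c *: x + y) = c *: lie z x + lie z y;
  liexx : forall x, lie x x = 0;
  lie_jacobi : forall x y z,
    lie x (lie y z) + lie y (lie z x) + lie z (lie x y) = 0
}.

#[short(type="lieAlgType")]
HB.structure Definition LieAlgebra (K : fieldType) :=
  { L of Vector_isLieAlgebra K L & Vector K L }.

Section LieAlgebraTheory.
Variables (K : fieldType) (L : lieAlgType K).
Implicit Types (U H : {vspace L}).

Lemma lieDl x y z : lie (x + y) z = lie x z + lie y z :> L.
Proof. by rewrite -[x in LHS]scale1r lie_linearl scale1r. Qed.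
Lemma lieDr x y z : lie z (x + y) = lie z x + lie z y :> L.
Proof. by rewrite -[x in LHS]scale1r lie_linearr scale1r. Qed.
Lemma lie0l z : lie 0 z = 0 :> L.
Proof. by apply: (addrI (lie 0 z)); rewrite -lieDl !addr0. Qed.
Lemma lie0r z : lie z 0 = 0 :> L.
Proof. by apply: (addrI (lie z 0)); rewrite -lieDr !addr0. Qed.
Lemma lieZl (c : K) x z : lie (c *: x) z = c *: lie x z :> L.
Proof. by rewrite -[c *: x]addr0 lie_linearl lie0l addr0. Qed.
Lemma lieZr (c : K) x z : lie z (c *: x) = c *: lie z x :> L.
Proof. by rewrite -[c *: x]addr0 lie_linearr lie0r addr0. Qed.
Lemma lieNl x z : lie (- x) z = - lie x z :> L.
Proof. by rewrite -scaleN1r lieZl scaleN1r. Qed.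
Lemma lieNr x z : lie z (- x) = - lie z x :> L.
Proof. by rewrite -scaleN1r lieZr scaleN1r. Qed.
Lemma lieBl x y z : lie (x - y) z = lie x z - lie y z :> L.
Proof. by rewrite lieDl lieNl. Qed.
Lemma lieBr x y z : lie z (x - y) = lie z x - lie z y :> L.
Proof. by rewrite lieDr lieNr. Qed.
Lemma lieC x y : lie x y = - lie y x :> L.
Proof.
apply/eqP; rewrite -addr_eq0; have := liexx (x + y).
by rewrite lieDl !lieDr !liexx add0r addr0 => ->.
Qed.

Definition ad (x : L) : 'End(L) := linfun (lie x).

Lemma adE x y : ad x y = lie x y.
Proof.
apply: (linfun_linE (f := lie x)) => c u v; exact: lie_linearr.
Qed.

Definition lfun_trace (f : 'End(L)) : K :=
  \sum_(i < \dim {:L}) coord (vbasis {:L}) i (f (vbasis {:L})`_i).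

Definition killing (x y : L) : K := lfun_trace (ad x \o ad y)%VF.

Definition lie_ideal U : Prop := forall x u, u \in U -> lie x u \in U.

Definition lie_simple : Prop :=
  (exists x y : L, lie x y != 0) /\
  (forall U, lie_ideal U -> U = 0%VS \/ U = fullv).

Definition lie_prod U H : {vspace L} :=
  <<[seq lie u v | u <- vbasis U, v <- vbasis H]>>%VS.

Definition lie_nilpotent H : Prop := exists n, iter n (lie_prod H) H = 0%VS.

Definition cartan_subalg (G H : {vspace L}) : Prop :=
  [/\ (H <= G)%VS,
      forall x y, x \in H -> y \in H -> lie x y \in H,
      lie_nilpotent H &
      forall x, x \in G -> (forall h, h \in H -> lie x h \in H) -> x \in H].

Definition lie_morphism (f : 'End(L)) : Prop :=
  forall x y, f (lie x y) = lie (f x) (f y).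

End LieAlgebraTheory.

Local Open Scope complex_scope.

Section Complexification.
Variable R : rcfType.

(* (x, y) stands for x + iy *)
Definition cplx (V : Type) := (V * V)%type.

Section CplxVector.
Variable V : vectType R.

HB.instance Definition _ := GRing.Zmodule.copy (cplx V) (V * V)%type.

Definition cplx_scale (c : R[i]) (z : cplx V) : cplx V :=
  let: a +i* b := c in (a *: z.1 - b *: z.2, a *: z.2 + b *: z.1).

Fact cplx_scalerA c d z :
  cplx_scale c (cplx_scale d z) = cplx_scale (c * d) z.
Proof.
case: c d => [a b] [a' b']; rewrite /cplx_scale /=; congr (_, _).
  rewrite scalerBr scalerDr !scalerA !scalerBl scalerDl.
  by rewrite !opprD; rewrite [LHS](AC (2*2) ((1*4)*(2*3))).
rewrite scalerBr scalerDr !scalerA !scalerBl scalerDl.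
by rewrite [LHS](AC (2*2) ((1*4)*(2*3))).
Qed.
Fact cplx_scale1r : left_id 1 cplx_scale.
Proof. by case=> x y; rewrite /cplx_scale /= !scale1r !scale0r subr0 addr0. Qed.
Fact cplx_scalerDr : right_distributive cplx_scale +%R.
Proof.
move=> [a b] [x y] [x' y']; rewrite /cplx_scale /=; congr (_, _).
  by rewrite !scalerDr opprD addrACA.
by rewrite !scalerDr addrACA.
Qed.
Fact cplx_scalerDl z : {morph cplx_scale^~ z : c d / c + d}.
Proof.
move=> [a b] [a' b']; rewrite /cplx_scale /=; congr (_, _).
  by rewrite !scalerDl opprD addrACA.
by rewrite !scalerDl addrACA.
Qed.
HB.instance Definition _ := GRing.Zmodule_isLmodule.Build R[i] (cplx V)
  cplx_scalerA cplx_scale1r cplx_scalerDr cplx_scalerDl.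

Lemma cplx_scaleE (a b : R) (z : cplx V) :
  (a +i* b) *: z = (a *: z.1 - b *: z.2, a *: z.2 + b *: z.1).
Proof. by []. Qed.

Lemma cplx_addE (z w : cplx V) : z + w = (z.1 + w.1, z.2 + w.2).
Proof. by []. Qed.

Fact cplx_vector_axiom : Vector.axiom (dim V) (cplx V).
Proof.
pose f (z : cplx V) : 'rV[R[i]]_(dim V) :=
  \row_j (v2r z.1 0 j +i* v2r z.2 0 j).
pose g (w : 'rV[R[i]]_(dim V)) : cplx V :=
  (r2v (\row_j complex.Re (w 0 j)), r2v (\row_j complex.Im (w 0 j))).
exists f.
  move=> [a b] z w; apply/rowP => j; rewrite !mxE /=.
  by rewrite !(linearD, linearN, linearZ) /= !mxE mulrN.
exists g.
  move=> [x y]; congr (_, _); apply: (can_inj v2rK); rewrite r2vK;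
  by apply/rowP => j; rewrite !mxE.
by move=> w; apply/rowP => j; rewrite !mxE !r2vK !mxE; case: (w 0 j).
Qed.
HB.instance Definition _ := Lmodule_hasFinDim.Build R[i] (cplx V)
  cplx_vector_axiom.

Definition cplx_lfun (f : 'End(V)) : 'End(cplx V) :=
  linfun (fun z : cplx V => (f z.1, f z.2) : cplx V).

Lemma cplx_lfunE f z : cplx_lfun f z = (f z.1, f z.2).
Proof.
apply: (linfun_linE (f := fun z : cplx V => (f z.1, f z.2) : cplx V)) => -[a b] x y.
by congr (_, _); rewrite /= !(linearD, linearN, linearZ).
Qed.

End CplxVector.

Section CplxLie.
Variable L : lieAlgType R.

Definition cplx_lie (z w : cplx L) : cplx L :=
  (lie z.1 w.1 - lie z.2 w.2, lie z.1 w.2 + lie z.2 w.1).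

Fact cplx_lie_linearl (c : R[i]) x y z :
  cplx_lie (c *: x + y) z = c *: cplx_lie x z + cplx_lie y z.
Proof.
case: c => a b; rewrite /cplx_lie /=; congr (_, _).
  rewrite cplx_scaleE !(lieDl, lieNl, lieZl) !scalerBr !scalerDr !opprD.
  by rewrite [LHS](AC (3*3) ((1*4)*(5*2)*(3*6))).
rewrite cplx_scaleE !(lieDl, lieNl, lieZl) !scalerBr !scalerDr.
by rewrite [LHS](AC (3*3) ((1*4)*(5*2)*(3*6))).
Qed.
Fact cplx_liexx x : cplx_lie x x = 0.
Proof. by rewrite /cplx_lie !liexx subrr [lie x.2 _]lieC subrr. Qed.
Fact cplx_lieC x y : cplx_lie x y = - cplx_lie y x.
Proof.
rewrite /cplx_lie; congr (_, _); rewrite [lie x.1 _]lieC [lie x.2 _]lieC.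
  by rewrite opprB opprK addrC.
by rewrite -opprD addrC.
Qed.
Fact cplx_lie_linearr (c : R[i]) x y z :
  cplx_lie z (c *: x + y) = c *: cplx_lie z x + cplx_lie z y.
Proof.
by rewrite cplx_lieC cplx_lie_linearl opprD -scalerN -!cplx_lieC.
Qed.
Fact cplx_lie_jacobi x y z : cplx_lie x (cplx_lie y z) +
  cplx_lie y (cplx_lie z x) + cplx_lie z (cplx_lie x y) = 0.
Proof.
case: x y z => [x x'] [y y'] [z z']; rewrite /cplx_lie /= !cplx_addE /=.
congr (_, _).
  transitivity ((lie x (lie y z) + lie y (lie z x) + lie z (lie x y))
    - (lie x (lie y' z') + lie y' (lie z' x) + lie z' (lie x y'))
    - (lie x' (lie y z') + lie y (lie z' x') + lie z' (lie x' y))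
    - (lie x' (lie y' z) + lie y' (lie z x') + lie z (lie x' y')));
    last by rewrite !lie_jacobi !subr0.
  rewrite !lieBr !lieDr !opprD.
  by rewrite [LHS](AC ((2*2)*(2*2)*(2*2)) ((1*5*9)*(2*8*11)*(3*6*12)*(4*7*10))).
transitivity ((lie x (lie y z') + lie y (lie z' x) + lie z' (lie x y))
  + (lie x (lie y' z) + lie y' (lie z x) + lie z (lie x y'))
  + (lie x' (lie y z) + lie y (lie z x') + lie z (lie x' y))
  - (lie x' (lie y' z') + lie y' (lie z' x') + lie z' (lie x' y')));
  last by rewrite !lie_jacobi !addr0 subr0.
rewrite !lieBr !lieDr !opprD.
by rewrite [LHS](AC ((2*2)*(2*2)*(2*2)) ((1*6*11)*(2*7*9)*(3*5*10)*(4*8*12))).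
Qed.
HB.instance Definition _ := Vector_isLieAlgebra.Build R[i] (cplx L)
  cplx_lie_linearl cplx_lie_linearr cplx_liexx cplx_lie_jacobi.

End CplxLie.
End Complexification.

Section Roots.
Variables (K : numFieldType) (L : lieAlgType K).
Variables (B : L -> L -> K) (t : {vspace L}).

Definition tdual := 'Hom(subvs_of t, K^o).
Implicit Types (mu alpha : tdual) (U : {vspace L}) (P : {fset tdual}).

Definition weight_space mu : {vspace L} :=
  lker (linfun (fun x : L =>
    linfun (fun h : subvs_of t => lie (vsval h) x - (mu h : K) *: x))).

Lemma weight_spaceP mu x :
  reflect (forall h : subvs_of t, lie (vsval h) x = (mu h : K) *: x)
          (x \in weight_space mu).
Proof.
pose F (x : L) (h : subvs_of t) : L := lie (vsval h) x - (mu h : K) *: x.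
have Flin y : linear (F y).
  move=> c u v; rewrite /F !linearP /= lie_linearl scalerBr.
  by rewrite scalerDl -scalerA opprD addrACA.
have F2 : linear (fun y => linfun (F y)).
  move=> c u v; apply/lfunP => h; rewrite add_lfunE scale_lfunE.
  rewrite !(linfun_linE (Flin _)) /F lie_linearr scalerBr scalerDr opprD addrACA.
  by rewrite !scalerA [c * _]mulrC.
rewrite memv_ker (linfun_linE F2); apply: (iffP eqP) => [F0 h|xmu].
  apply/eqP; rewrite -subr_eq0; apply/eqP.
  by rewrite -[LHS](linfun_linE (Flin x)) F0 zero_lfunE.
apply/lfunP => h.
by rewrite (linfun_linE (Flin x)) /F xmu subrr zero_lfunE.
Qed.

(* The nonzero t-weights of a t-stable subspace U *)
Definition is_root U alpha : Prop :=
  alpha != 0 /\ (weight_space alpha :&: U)%VS != 0%VS.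

(* The map t -> t^* induced by B, the element of t it sends to alpha, and
   2 B(t_alpha, t_alpha)^-1 t_alpha; the coroot does not change when B is
   multiplied by a nonzero scalar *)
Definition flat : 'Hom(subvs_of t, tdual) :=
  linfun (fun h => linfun (fun h' => B (vsval h) (vsval h') : K^o)).
Definition sharp alpha : subvs_of t := (flat^-1)%VF alpha.
Definition coroot alpha : subvs_of t :=
  (2 / B (vsval (sharp alpha)) (vsval (sharp alpha))) *: sharp alpha.

Definition reflection alpha : 'End(tdual) :=
  linfun (fun mu => mu - (mu (coroot alpha) : K) *: alpha).

Inductive weyl_group : 'End(tdual) -> Prop :=
| weyl1 : weyl_group \1%VF
| weylM alpha w of is_root fullv alpha & weyl_group w :
    weyl_group (reflection alpha \o w)%VF.

(* Multiples are allowed: alpha = beta is not excluded in the last clause,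
   since the roots need not form a reduced system *)
Definition positive_system (Delta : tdual -> Prop) P : Prop :=
  [/\ forall alpha, alpha \in P -> Delta alpha,
      forall alpha, Delta alpha -> (alpha \in P) (+) (- alpha \in P) &
      forall alpha beta, alpha \in P -> beta \in P -> Delta (alpha + beta) ->
        alpha + beta \in P].

Definition half_sum P : tdual :=
  2^-1 *: \sum_(alpha <- P) (alpha *+ \dim (weight_space alpha)).

Definition dominant P mu : Prop :=
  forall alpha, alpha \in P -> 0 <= (mu (coroot alpha) : K).

Definition W1 Pk Pg (w : 'End(tdual)) : Prop :=
  weyl_group w /\ dominant Pk (w (half_sum Pg)).

Definition n_plus (Pg : {fset tdual}) (w : 'End(tdual)) : {vspace L} :=
  (\sum_(alpha <- Pg) weight_space (w alpha))%VS.
Definition n_minus (Pg : {fset tdual}) (w : 'End(tdual)) : {vspace L} :=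
  (\sum_(alpha <- Pg) weight_space (- w alpha))%VS.

End Roots.

Section HarishChandra.
Variables (K : fieldType) (L : lieAlgType K) (B : L -> L -> K).

Definition form_on (U : {vspace L}) (u v : subvs_of U) : K := B (vsval u) (vsval v).

Definition Cl (U : {vspace L}) := clifford (@form_on U).
HB.instance Definition _ (U : {vspace L}) := GRing.PzRing.on (Cl U).
HB.instance Definition _ (U : {vspace L}) := GRing.Lmodule.on (Cl U).

Definition Cl_gen (U : {vspace L}) (u : subvs_of U) : Cl U :=
  clifford_gen (@form_on U) u.

(* For a subspace A of U, the homomorphism Cl(A) -> Cl(U) extending the
   inclusion *)
Definition Cl_incl (A U : {vspace L}) : Cl A -> Cl U :=
  clifford_map (@form_on A) (@form_on U) (fun v => vsproj U (vsval v)).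

(* For U stable under lie y, the derivation of Cl(U) extending lie y; see
   clifford_der_der *)
Definition Cl_ad (U : {vspace L}) (y : L) : Cl U -> Cl U :=
  clifford_der (@form_on U) (fun v => vsproj U (lie y (vsval v))).

Definition Cl_invariant (k U : {vspace L}) (x : Cl U) : Prop :=
  forall y, y \in k -> Cl_ad y x = 0.

(* The subspace p^- Cl(U) + Cl(U) p^+ *)
Inductive hc_kernel (U pm pp : {vspace L}) : Cl U -> Prop :=
| hc_kernel0 : hc_kernel pm pp 0
| hc_kernelD x y of hc_kernel pm pp x & hc_kernel pm pp y : hc_kernel pm pp (x + y)
| hc_kernel_minus (u : subvs_of U) x of vsval u \in pm :
    hc_kernel pm pp (Cl_gen u * x)
| hc_kernel_plus x (u : subvs_of U) of vsval u \in pp :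
    hc_kernel pm pp (x * Cl_gen u).

(* The projection of Cl(U) onto Cl(A) along p^- Cl(U) + Cl(U) p^+: the
   component of x in Cl(A) *)
Definition hc_proj (A U pm pp : {vspace L}) (x : Cl U) : Cl A :=
  xget 0 [set y : Cl A | hc_kernel pm pp (x - @Cl_incl A U y)]%classic.

End HarishChandra.
Arguments Cl_incl {K L B} A U x.
Arguments hc_proj {K L B} A U pm pp x.

Section SymmetricPair.
Variables (R : rcfType) (g0 : lieAlgType R) (theta0 : 'End(g0)).

Definition sym_k : {vspace cplx g0} := fixedSpace (cplx_lfun theta0).
Definition sym_p : {vspace cplx g0} := lker (cplx_lfun theta0 + \1%VF).

End SymmetricPair.

(* Main.v *)
Require Import Defs.
From HB Require Import structures.
From mathcomp Require Import all_boot all_order all_algebra.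
From mathcomp Require Import finmap.
From mathcomp Require Import boolp classical_sets reals complex.
From mathcomp Require Import ring lra zify.
From mathcomp.multinomials Require Import monalg.

(** Let v be the product of a basis of p^- and u the product of the dual basis of
    p^+, in the reverse order.  Both are isotropic, so v p^- = 0 = p^+ u, the map
    x |-> v x u kills p^- Cl(p) + Cl(p) p^+, and u v u = u (dual_products).  Monomials
    in a basis of p are independent (clifford_model), so z |-> v z u is injective
    on Cl(a) (corner_injective).  Together with normal ordering this gives the
    decomposition that defines hc_w, and it shows that hc_w(x) is the element z of
    Cl(a) with v x u = v z u.

    hc_w is multiplicative on invariants.  An invariant x has t-weight 0; in its
    normal form, a monomial with a factor from p^- also has one from p^+, since no
    nonempty sum of positive weights vanishes.  Thus x - hc_w(x) lies in
    p^- Cl(p) p^+ (weight0_split), and then x y - hc_w(x) hc_w(y) lies in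
    p^- Cl(p) + Cl(p) p^+ (hcM).

    hc_w is surjective.  The action of X in k on Cl(p) is the commutator with an
    element spin X.  A sum of x_i (z u v) y_i over bases (x_i), (y_i), dual for the
    trace form, of the algebra G generated by the spin X commutes with G, hence is
    invariant.  Here v and u are a lowest and a highest weight vector for k from the
    left and from the right, of the same weight, and so is z u for z in Cl(a), as t
    commutes with a; therefore v g z u is a multiple c(g) v z u for all g in G
    (extremal_word), and v (sum of x_i z u v y_i) u is the multiple c(q) of
    v z u v u = v z u, where q in G represents c for the trace form.  That the trace
    form is nondegenerate on G and that c(q) is not 0 follows from positivity
    (extremal_average): in a faithful matrix model of Cl(p) where an orthonormal
    basis of the real form of p acts by hermitian matrices, G is stable under
    adjoints, because k is stable under conjugation (spin_adj).

    What remains is structure theory.  Every invariant form on the compact algebra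
    is a multiple of the Killing form, since g is simple (invariant_form); this
    provides the orthonormal basis (real_orthonormal).  The Cartan subalgebra t of k
    is abelian, acts diagonalizably, and has centralizer t + a, by the Jordan
    decomposition in g, Engel's theorem and the nondegeneracy of the Killing form
    (t_abelian, t_diag, centralizer_t).  Each t-root lies in a copy of sl_2
    (root_triple), whose
    representations show that the reflections permute the roots (reflection_root)
    and that positive roots do not sum to 0 (positive_sum); hence w maps the
    positive system to weights with the properties used above. *)

Set Implicit Arguments.
Unset Strict Implicit.
Unset Printing Implicit Defensive.

Import Order.TTheory GRing.Theory Num.Theory.
Local Open Scope ring_scope.

(** * Spans and linear maps *)

(** Spans are given by generation since they are also taken in the Clifford
    algebras, which are not finite-dimensional a priori. *)
Inductive lspan (K : pzRingType) (V : lmodType K) (S : V -> Prop) : V -> Prop :=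
| lspan0 : lspan S 0
| lspanS c s x of S s & lspan S x : lspan S (c *: s + x).

Section Lspan.
Variables (K : pzRingType) (V : lmodType K).
Implicit Types (S : V -> Prop) (x y : V).

Lemma lspan_in S x : S x -> lspan S x.
Proof. by move=> Sx; rewrite -[x]scale1r -[_ *: _]addr0; apply: lspanS => //; exact: lspan0. Qed.

Lemma lspanD S x y : lspan S x -> lspan S y -> lspan S (x + y).
Proof.
move=> + Sy; elim=> [|c s z Ss _ IH]; first by rewrite add0r.
by rewrite -addrA; apply: lspanS.
Qed.

Lemma lspanZ S c x : lspan S x -> lspan S (c *: x).
Proof.
elim=> [|d s z Ss _ IH]; first by rewrite scaler0; exact: lspan0.
by rewrite scalerDr scalerA; apply: lspanS.
Qed.

Lemma lspan_sum S (I : Type) (r : seq I) (P : pred I) (F : I -> V) :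
  (forall i, P i -> lspan S (F i)) -> lspan S (\sum_(i <- r | P i) F i).
Proof. by move=> SF; elim/big_ind: _ => //; [exact: lspan0|exact: lspanD]. Qed.

Lemma lspan_trans S S' x : (forall s, S s -> lspan S' s) -> lspan S x -> lspan S' x.
Proof.
move=> SS'; elim=> [|c s z Ss _ IH]; first exact: lspan0.
by apply: lspanD => //; apply/lspanZ/SS'.
Qed.

Lemma lspan_mono S S' x : (forall s, S s -> S' s) -> lspan S x -> lspan S' x.
Proof. by move=> SS'; apply: lspan_trans => s /SS'; exact: lspan_in. Qed.

End Lspan.

Lemma lspan_map (K : pzRingType) (V W : lmodType K) (f : V -> W)
    (S : V -> Prop) (S' : W -> Prop) x : linear f ->
  (forall s, S s -> lspan S' (f s)) -> lspan S x -> lspan S' (f x).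
Proof.
move=> linf fS; have f0 : f 0 = 0.
  by have := linf (-1) 0 0; rewrite scaler0 addr0 scaleN1r addNr.
elim=> [|c s z Ss _ IH]; first by rewrite f0; exact: lspan0.
by rewrite linf; apply: lspanD => //; apply/lspanZ/fS.
Qed.

Lemma lin_sum (K : fieldType) (V W : lmodType K) (f : V -> W) : linear f ->
  forall (I : Type) (r : seq I) (P : pred I) (F : I -> V),
  f (\sum_(i <- r | P i) F i) = \sum_(i <- r | P i) f (F i).
Proof.
move=> linf I r P F.
by apply: (big_morph f); [exact: (linD linf) | exact: (lin0 linf)].
Qed.

Section Functionals.
Variables (K : fieldType) (V : lmodType K) (f : V -> K).
Hypothesis fs : scalar f.

Lemma scl0 : f 0 = 0.
Proof. by have := fs (-1) 0 0; rewrite scaler0 addr0 mulN1r addNr. Qed.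

Lemma sclZ c x : f (c *: x) = c * f x.
Proof. by rewrite -[c *: x]addr0 fs scl0 addr0. Qed.

Lemma sclD x y : f (x + y) = f x + f y.
Proof. by rewrite -[x]scale1r fs !scale1r mul1r. Qed.

Lemma sclN x : f (- x) = - f x.
Proof. by rewrite -scaleN1r sclZ mulN1r. Qed.

Lemma scl_sum (I : Type) (r : seq I) (P : pred I) (F : I -> V) :
  f (\sum_(i <- r | P i) F i) = \sum_(i <- r | P i) f (F i).
Proof. by apply: (big_morph f); [exact: sclD | exact: scl0]. Qed.

End Functionals.

(** Extraction of an isotypic part: the operators (D h - l h) / (mu h - l h),
    for the wrong weights l, fix x and successively kill the other terms. *)
Lemma lspan_weight (K : fieldType) (V : lmodType K) (T : Type)
    (D : T -> V -> V) (S : V -> Prop) (mu : T -> K) (x : V) :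
  (forall h, linear (D h)) ->
  (forall s, S s -> exists l : T -> K, forall h, D h s = l h *: s) ->
  (forall h, D h x = mu h *: x) -> lspan S x ->
  lspan (fun s => S s /\ forall h, D h s = mu h *: s) x.
Proof.
move=> Dlin wS Dx Sx.
set good := fun s => S s /\ forall h, D h s = mu h *: s.
have [bad [q [qg xE badP]]] : exists bad : seq V, exists q, [/\ lspan good q,
    x = q + \sum_(s <- bad) s &
    forall s, s \in bad ->
      exists2 l : T -> K, (forall h, D h s = l h *: s) & exists h, l h != mu h].
  elim: Sx => [|c s z Ss _ [bad [q [qg -> badP]]]].
    by exists [::], 0; split; [exact: lspan0 | rewrite big_nil addr0|].
  have [l lP] := wS s Ss.
  case: (pselect (exists h, l h != mu h)) => [hl|].
    exists (c *: s :: bad), q; split => //; first by rewrite big_cons addrCA.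
    move=> s'; rewrite inE => /orP [/eqP ->|/badP //].
    by exists l => // h; rewrite (linZ (Dlin h)) lP !scalerA mulrC.
  move=> nl; exists bad, (c *: s + q); split => //; last by rewrite addrA.
  apply: lspanS => //; split => // h; rewrite lP; congr (_ *: _).
  by apply/eqP/negPn/negP => lh; apply: nl; exists h.
have qw : forall h, D h q = mu h *: q.
  move=> h; elim: qg => [|c s z [_ sw] _ IH]; first by rewrite (lin0 (Dlin h)) scaler0.
  by rewrite (Dlin h) sw IH scalerDr !scalerA mulrC.
suff -> : x = q by [].
have [n] := ubnP (size bad).
elim: n bad xE badP => // n IHn [|s bad] xE badP /=; first by rewrite big_nil addr0 in xE.
rewrite ltnS => bn.
have [|l lP [h lh]] := badP s _; first by rewrite inE eqxx.
pose d := (mu h - l h)^-1.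
have dl0 : mu h - l h != 0 by rewrite subr_eq0 eq_sym.
pose P y := d *: (D h y - l h *: y).
have linP : linear P.
  move=> c u v; rewrite /P (Dlin h) !scalerDr !scalerN !scalerDr !scalerA opprD.
  rewrite addrACA; congr (_ + _); rewrite (mulrC c d) -(mulrA d).
  by rewrite -mulrA [c * l h]mulrC.
have PE y : D h y = mu h *: y -> P y = y.
  by move=> Dy; rewrite /P Dy -scalerBl scalerA mulVf ?scale1r.
apply: (IHn [seq P y | y <- bad]); last by rewrite size_map.
  rewrite -[x in LHS]PE // xE big_cons !(linD linP) (PE q) //.
  have -> : P s = 0 by rewrite /P lP subrr scaler0.
  rewrite add0r big_map; congr (_ + _).
  elim: (bad) => [|y b IH]; first by rewrite !big_nil (lin0 linP).
  by rewrite !big_cons (linD linP) IH.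
move=> _ /mapP [y yb ->].
have [|ly lyP lyh] := badP y _; first by rewrite inE yb orbT.
exists ly => // h'.
have -> : P y = (d * (ly h - l h)) *: y by rewrite /P lyP -scalerBl scalerA.
by rewrite (linZ (Dlin h')) lyP !scalerA mulrC.
Qed.

(** Take a free list in S whose span has the largest dimension. *)
Lemma lspan_finite (K : fieldType) (V : vectType K) (S : V -> Prop) :
  exists X : seq V, [/\ free X, forall s, s \in X -> S s & forall s, S s -> s \in <<X>>%VS].
Proof.
have [n] := ubnP (\dim {:V} - \dim <<Nil V>>%VS).
have : forall s, s \in Nil V -> S s by [].
elim: n (Nil V) (nil_free V) => // n IHn X Xf XS Xn.
case: (pselect (forall s, S s -> s \in <<X>>%VS)) => [Xmax|]; first by exists X.
move=> /existsNP [x] /not_implyP [Sx /negP xX].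
apply: (IHn (x :: X)) => [|s|]; first by rewrite free_cons xX Xf.
   by rewrite inE => /orP [/eqP -> //|/XS].
have dX : (\dim <<X>>%VS < \dim <<x :: X>>%VS)%N.
  rewrite span_cons (ltn_leqif (dimv_leqif_sup (addvSr _ _))).
  apply: contra xX => /subvP; apply; apply: subvP (addvSl _ _) _ _; exact: memv_line.
rewrite ltnS in Xn; apply: leq_trans Xn; apply: ltn_sub2l => //.
exact: leq_trans dX (dimvS (subvf _)).
Qed.

Lemma span_lspan (K : fieldType) (V : vectType K) (X : seq V) x :
  x \in <<X>>%VS -> lspan (fun v => v \in X) x.
Proof.
move=> /(@coord_span _ _ _ (in_tuple X)) ->; apply: lspan_sum => i _.
by apply/lspanZ/lspan_in; rewrite mem_nth.
Qed.

Section DualFamily.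
Variables (K : fieldType) (V : vectType K) (n : nat) (X : seq V) (f : 'I_n -> V -> K).
Hypotheses (sX : size X = n) (fs : forall i, scalar (f i)).
Hypothesis fX : forall i j : 'I_n, f i X`_j = (i == j)%:R.

Lemma dual_coord x : x \in <<X>>%VS -> x = \sum_(i < n) f i x *: X`_i.
Proof.
move=> /span_lspan; elim=> [|c _ y /(nthP 0) [j jX <-] _ {1}->].
  by rewrite big1 // => i _; rewrite (scl0 (fs i)) scale0r.
rewrite sX in jX; rewrite -[j]/(nat_of_ord (Ordinal jX)); move: {j jX} (Ordinal jX) => j.
transitivity (\sum_(i < n) (c *: (f i X`_j *: X`_i) + f i y *: X`_i)); last first.
  by apply: eq_bigr => i _; rewrite fs scalerDl scalerA.
rewrite big_split -scaler_sumr; congr (_ *: _ + _).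
rewrite (bigD1 j) //= fX eqxx scale1r big1 ?addr0 // => i /negbTE ij.
by rewrite fX ij scale0r.
Qed.

Lemma dual_free : free X.
Proof.
suff : free (tcast sX (in_tuple X)) by rewrite val_tcast.
apply/freeP => c; rewrite val_tcast => c0 i; have := scl0 (fs i).
rewrite -c0 (scl_sum (fs i)) (bigD1 i) //= (sclZ (fs i)) fX eqxx mulr1 big1 ?addr0 // => j ji.
by rewrite (sclZ (fs i)) fX eq_sym (negbTE ji) mulr0.
Qed.

End DualFamily.

Lemma lspan_vspace (K : fieldType) (V : vectType K) (S : V -> Prop) :
  exists U : {vspace V}, forall x, x \in U <-> lspan S x.
Proof.
have [X [_ XS SX]] := lspan_finite S; exists <<X>>%VS => x; split.
  by move=> /span_lspan; exact: lspan_mono.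
by elim=> [|c s z /SX sX _ zX]; [exact: mem0v | rewrite memvD ?memvZ].
Qed.

Lemma nondeg_embedding (K : fieldType) (V W : vectType K) (b : V -> W -> K) :
  (forall y, scalar (b^~ y)) -> (forall x, scalar (b x)) ->
  (forall x, (forall y, b x y = 0) -> x = 0) ->
  exists2 F : 'Hom(V, 'Hom(W, K^o)), lker F = 0%VS & forall x y, F x y = b x y.
Proof.
move=> linl linr nd.
have lbE x y : linfun (b x : W -> K^o) y = b x y by apply: linfun_linE; exact: linr.
have Flin : linear (fun x => linfun (b x : W -> K^o)).
  by move=> c x y; apply/lfunP => z; rewrite add_lfunE scale_lfunE !lbE linl.
exists (linfun (fun x => linfun (b x : W -> K^o))).
  apply/eqP; rewrite -subv0; apply/subvP => x; rewrite memv_ker (linfun_linE Flin) => /eqP Fx.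
  by rewrite memv0; apply/eqP/nd => y; rewrite -lbE Fx zero_lfunE.
by move=> x y; rewrite (linfun_linE Flin).
Qed.

Lemma nondeg_repr (K : fieldType) (V W : vectType K) (b : V -> W -> K) (phi : W -> K) :
  (forall y, scalar (b^~ y)) -> (forall x, scalar (b x)) ->
  (forall x, (forall y, b x y = 0) -> x = 0) -> (\dim {:W} <= \dim {:V})%N ->
  scalar phi -> exists x, forall y, b x y = phi y.
Proof.
move=> linl linr nd dWV linphi; have [F kF FE] := nondeg_embedding linl linr nd.
have imF : limg F = fullv.
  apply/eqP; rewrite eqEdim subvf /= limg_dim_eq ?kF ?capv0 //.
  rewrite !dimvf in dWV *; change (dim W * 1 <= dim V)%N; by rewrite muln1.
have phiE y : linfun (phi : W -> K^o) y = phi y by apply: linfun_linE.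
have : linfun (phi : W -> K^o) \in limg F by rewrite imF memvf.
by move=> /memv_imgP [x _ xE]; exists x => y; rewrite -phiE xE FE.
Qed.

Lemma nondeg_dim (K : fieldType) (V W : vectType K) (b : V -> W -> K) :
  (forall y, scalar (b^~ y)) -> (forall x, scalar (b x)) ->
  (forall x, (forall y, b x y = 0) -> x = 0) -> (\dim {:V} <= \dim {:W})%N.
Proof.
move=> linl linr nd; have [F kF _] := nondeg_embedding linl linr nd.
have <- : \dim (limg F) = \dim {:V} by rewrite limg_dim_eq ?kF ?capv0.
apply: leq_trans (dimvS (subvf _)) _.
rewrite !dimvf; change (dim W * 1 <= dim W)%N; by rewrite muln1.
Qed.

(** * Semisimple parts of operators *)

Lemma coprimep_linear_factors (K : fieldType) (c : K) (ds : seq K) m N : c \notin ds ->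
  coprimep (('X - c%:P) ^+ m) (\prod_(d <- ds) ('X - d%:P) ^+ N).
Proof.
elim: ds => [|d ds IH]; first by rewrite big_nil coprimep1.
rewrite inE negb_or big_cons => /andP [cd /IH]; rewrite coprimepMr => ->.
by rewrite andbT coprimep_expl // coprimep_expr // coprimep_XsubC2 // subr_eq0 eq_sym.
Qed.

Section PolyAction.
Variables (K : fieldType) (V : lmodType K) (f : V -> V).
Hypothesis flin : linear f.

(** p(f) x, for maps f that are not bundled as elements of an algebra. *)
Definition pact (p : {poly K}) (x : V) : V :=
  \sum_(i < size p) p`_i *: iter i f x.

Lemma pactE n (p : {poly K}) x : (size p <= n)%N -> pact p x = \sum_(i < n) p`_i *: iter i f x.
Proof.
move=> pn; rewrite /pact (big_ord_widen n (fun i => p`_i *: iter i f x) pn).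
rewrite big_mkcond; apply: eq_bigr => i _; case: ltnP => // ip.
by rewrite nth_default ?scale0r.
Qed.

Lemma pactD (p q : {poly K}) x : pact (p + q) x = pact p x + pact q x.
Proof.
pose n := maxn (size p) (size q).
rewrite (@pactE n p) ?leq_maxl // (@pactE n q) ?leq_maxr // (@pactE n) ?size_polyD //.
by rewrite -big_split; apply: eq_bigr => i _; rewrite coefD scalerDl.
Qed.

Lemma pactC c x : pact c%:P x = c *: x.
Proof. by rewrite (@pactE 1) ?size_polyC_leq1 // big_ord1 coefC. Qed.

Lemma iter_linear n : linear (iter n f).
Proof. by elim: n => // n IH c x y; rewrite !iterS IH flin. Qed.

Lemma pact_linear p : linear (pact p).
Proof.
move=> c x y; rewrite /pact scaler_sumr -big_split; apply: eq_bigr => i _ /=.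
by rewrite iter_linear scalerDr !scalerA mulrC.
Qed.

Lemma pactXM p x : pact ('X * p) x = f (pact p x).
Proof.
rewrite (@pactE (size p).+1); last by rewrite -commr_polyX (leq_trans (size_polyMleq _ _)) // size_polyX addn2.
rewrite big_ord_recl coefXM eqxx scale0r add0r /pact.
rewrite (lin_sum flin); apply: eq_bigr => i _.
by rewrite coefXM /= (linZ flin).
Qed.

Lemma pactMC p c x : pact (c%:P * p) x = c *: pact p x.
Proof.
rewrite (@pactE (size p)); last by rewrite mul_polyC size_scale_leq.
by rewrite /pact scaler_sumr; apply: eq_bigr => i _; rewrite coefCM scalerA.
Qed.

Lemma pactM p q x : pact (p * q) x = pact p (pact q x).
Proof.
elim/poly_ind: p q x => [|p c IH] q x.
  by rewrite mul0r -[0]polyC0 !pactC !scale0r.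
have pactX y : pact 'X y = f y by rewrite -['X]mulr1 pactXM -polyC1 pactC scale1r.
by rewrite mulrDl !pactD pactMC pactC -mulrA IH pactXM IH pactX.
Qed.

Lemma pactXsubC c x : pact ('X - c%:P) x = f x - c *: x.
Proof.
by rewrite pactD -polyCN pactC scaleNr -['X]mulr1 pactXM -polyC1 pactC scale1r.
Qed.

Lemma pactXsubC_exp c n x :
  pact (('X - c%:P) ^+ n) x = iter n (fun y => f y - c *: y) x.
Proof.
elim: n => [|n IH] /=; first by rewrite expr0 -polyC1 pactC scale1r.
by rewrite exprS pactM pactXsubC IH.
Qed.

Lemma pact_dvd p q x : p %| q -> pact p x = 0 -> pact q x = 0.
Proof.
by move=> /dvdpP [r ->] px; rewrite pactM px (lin0 (pact_linear r)).
Qed.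

Lemma pact_commute (T : V -> V) p x : linear T -> (forall y, T (f y) = f (T y)) ->
  T (pact p x) = pact p (T x).
Proof.
move=> Tlin Tf; have Ti n y : T (iter n f y) = iter n f (T y).
  by elim: n => // n IH; rewrite !iterS Tf IH.
rewrite /pact (lin_sum Tlin); apply: eq_bigr => i _.
by rewrite (linZ Tlin) Ti.
Qed.

(** Primary decomposition: powers of distinct linear factors are coprime. *)
Lemma pact_coprime (ds : seq K) N x : uniq ds ->
  pact (\prod_(d <- ds) ('X - d%:P) ^+ N) x = 0 ->
  lspan (fun y => exists c, pact (('X - c%:P) ^+ N) y = 0) x.
Proof.
elim: ds x => [|d ds IH] x /=.
  by rewrite big_nil -polyC1 pactC scale1r => _ ->; exact: lspan0.
move=> /andP [dds uds]; rewrite big_cons; set P := \prod_(_ <- _) _ => Px.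
have /Bezout_eq1_coprimepP [[u v] /= uv] : coprimep (('X - d%:P) ^+ N) P.
  exact: coprimep_linear_factors.
have -> : x = pact (u * ('X - d%:P) ^+ N) x + pact (v * P) x.
  by rewrite -pactD uv -polyC1 pactC scale1r.
apply: lspanD; last first.
  by apply: lspan_in; exists d; rewrite -pactM mulrCA pactM Px (lin0 (pact_linear v)).
by apply: (IH _ uds); rewrite -pactM mulrCA [P * _]mulrC pactM Px (lin0 (pact_linear u)).
Qed.

End PolyAction.

(** Chinese remainder theorem; q is the polynomial whose value at an operator
    is its semisimple part. *)
Lemma crt_linear_factors (K : fieldType) (ds : seq K) N : uniq ds ->
  exists q : {poly K}, forall d, d \in ds -> ('X - d%:P) ^+ N %| q - d%:P.
Proof.
elim: ds => [|d ds IH] /=; first by exists 0.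
move=> /andP [dds /IH [q qP]].
pose P := \prod_(e <- ds) ('X - e%:P) ^+ N.
have /Bezout_eq1_coprimepP [[u v] /= uv] : coprimep (('X - d%:P) ^+ N) P.
  exact: coprimep_linear_factors.
exists (q + v * P * (d%:P - q)) => e; rewrite inE => /orP [/eqP ->|eds].
  have -> : q + v * P * (d%:P - q) - d%:P = u * (q - d%:P) * ('X - d%:P) ^+ N.
    have -> : v * P = 1 - u * ('X - d%:P) ^+ N by rewrite -uv addrC addKr.
    by ring.
  exact: dvdp_mull.
rewrite addrAC dvdp_add ?qP // dvdp_mulr // dvdp_mull //.
by rewrite /P (big_rem e eds) dvdp_mulr.
Qed.

(** The powers of f are linearly dependent. *)
Lemma annihilating_poly (C : closedFieldType) (V : vectType C) (f : 'End(V)) :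
  exists2 ds : seq C, uniq ds & exists N, forall x,
    pact f (\prod_(d <- ds) ('X - d%:P) ^+ N) x = 0.
Proof.
pose n := (\dim {:'End(V)}).+1.
pose X := [seq (iter i (fun g : 'End(V) => f \o g)%VF \1%VF) | i <- iota 0 n].
have sX : size X = n by rewrite size_map size_iota.
have : ~~ free X.
  rewrite /free sX neq_ltn; apply/orP; left; rewrite ltnS; exact: dimvS (subvf _).
have Xi i x : (i < n)%N -> X`_i x = iter i f x.
  move=> li; rewrite (nth_map 0%N) ?size_iota // nth_iota //= add0n.
  elim: i {li} => [|i IH]; first by rewrite id_lfunE.
  by rewrite !iterS comp_lfunE IH.
move=> /negP nf.
have [k k0 [i ki]] : exists2 k : 'I_n -> C, \sum_(i < n) k i *: X`_i = 0 & exists i, k i != 0.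
  apply: contrapT => nk; apply: nf.
  suff : free (tcast sX (in_tuple X)) by rewrite val_tcast.
  apply/freeP => k; rewrite val_tcast => k0 i; apply: contrapT => /eqP ki; apply: nk.
  by exists k => //; exists i.
pose p := \poly_(i < n) (if insub i is Some j then k j else 0 : C).
have p0 : p != 0.
  apply/eqP => /(congr1 (fun p : {poly C} => p`_i)) /eqP; rewrite coef0 coef_poly ltn_ord.
  by rewrite valK (negbTE ki).
have pf x : pact f p x = 0.
  rewrite (@pactE _ _ _ n) ?size_poly //.
  transitivity ((\sum_(i < n) k i *: X`_i) x); last by rewrite k0 zero_lfunE.
  rewrite sum_lfunE; apply: eq_bigr => j _.
  by rewrite scale_lfunE Xi // coef_poly ltn_ord valK.
have [r rE] := closed_field_poly_normal p.
exists (undup r); first exact: undup_uniq.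
exists (size r) => x; apply: (@pact_dvd _ _ f _ p) => //; first exact: linearP.
rewrite rE dvdpZl ?lead_coef_eq0 //.
have dv (s ds : seq C) : uniq ds -> {subset s <= ds} ->
    \prod_(z <- s) ('X - z%:P) %| \prod_(d <- ds) ('X - d%:P) ^+ (size s).
  move=> uds; elim: s => [|z s IH] sub; first by rewrite big_nil dvd1p.
  have -> : \prod_(d <- ds) ('X - d%:P) ^+ size (z :: s) =
    \prod_(d <- ds) ('X - d%:P) * \prod_(d <- ds) ('X - d%:P) ^+ size s.
    by rewrite -big_split; apply: eq_bigr => d _; rewrite /= exprS.
  rewrite big_cons dvdp_mul ?IH //; last by move=> y ys; apply: sub; rewrite inE ys orbT.
  by rewrite (big_rem z) ?sub ?inE ?eqxx //= dvdp_mulr.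
by apply: dv; [exact: undup_uniq | move=> z; rewrite mem_undup].
Qed.

(** The Jordan decomposition: by the Chinese remainder theorem the semisimple part
    is a polynomial in f, so it commutes with all that commutes with f. *)
Lemma jordan_semisimple (C : closedFieldType) (V : vectType C) (f : 'End(V)) :
  exists (s : 'End(V)) (N : nat), [/\
    forall c n x, iter n (fun y => f y - c *: y) x = 0 -> s x = c *: x,
    forall x, lspan (fun y => exists c, iter N (fun y => f y - c *: y) y = 0) x,
    forall T : 'End(V), (forall x, T (f x) = f (T x)) ->
       forall x, T (s x) = s (T x) &
    forall x, iter N (fun y => f y - s y) x = 0].
Proof.
have [ds uds [N fN]] := annihilating_poly f.
have [q qP] := crt_linear_factors N uds.
have flin : linear f by exact: linearP.
pose s := linfun (pact f q).
have sE x : s x = pact f q x by apply: linfun_linE; exact: pact_linear.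
have sG c n x : iter n (fun y => f y - c *: y) x = 0 -> s x = c *: x.
  rewrite -(pactXsubC_exp flin) => fx.
  apply/eqP; rewrite -subr_eq0 sE -[c *: x](pactC f) -scaleN1r -(pactMC f) -pactD.
  rewrite polyCN mulN1r; apply/eqP.
  pose m := if c \in ds then N else 0%N; pose P := \prod_(d <- rem c ds) ('X - d%:P) ^+ N.
  have PE : \prod_(d <- ds) ('X - d%:P) ^+ N = ('X - c%:P) ^+ m * P.
    by rewrite /m /P; case: ifPn => cds; [rewrite (big_rem c) | rewrite rem_id // expr0 mul1r].
  have /Bezout_eq1_coprimepP [[u v] /= uv] : coprimep (('X - c%:P) ^+ n) P.
    by apply: coprimep_linear_factors; rewrite mem_rem_uniqF.
  have xm : pact f (('X - c%:P) ^+ m) x = 0.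
    have -> : ('X - c%:P) ^+ m = (u * ('X - c%:P) ^+ m) * ('X - c%:P) ^+ n
         + v * (('X - c%:P) ^+ m * P) by rewrite -[LHS]mulr1 -uv; ring.
    rewrite pactD (pactM flin v) -PE fN (pactM flin (u * _)) fx.
    by rewrite !(lin0 (pact_linear flin _)) addr0.
  move: xm; rewrite /m; case: ifP => [cds|_]; first exact: (pact_dvd flin (qP _ cds)).
  by rewrite expr0 -polyC1 pactC scale1r => ->; exact: lin0 (pact_linear flin _).
have span x : lspan (fun y => exists c, iter N (fun y => f y - c *: y) y = 0) x.
  apply: lspan_mono (pact_coprime flin uds (fN x)) => y [c].
  by rewrite (pactXsubC_exp flin) => yc; exists c.
exists s, N; split => //.
  by move=> T Tf x; rewrite !sE; apply: pact_commute Tf; exact: linearP.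
have nlin : linear (fun y => f y - s y).
  by move=> c x y; rewrite (linearP f) (linearP s) /= scalerBr opprD addrACA.
move=> x; elim: (span x) => [|c y z [d yd] _ IH]; first exact: lin0 (iter_linear nlin N).
rewrite (iter_linear nlin) IH addr0.
suff -> : iter N (fun y => f y - s y) y = iter N (fun y => f y - d *: y) y.
  by rewrite yd scaler0.
have G m : exists k, iter k (fun y => f y - d *: y) (iter m (fun y => f y - d *: y) y) = 0.
  exists N; rewrite -iterD addnC iterD yd.
  apply: lin0; apply: iter_linear => a x' y'.
  by rewrite (linearP f) /= scalerBr scalerDr opprD addrACA !scalerA [d * a]mulrC.
elim: (N) => // m IHm; rewrite !iterS IHm; have [k kP] := G m.
by rewrite (sG _ _ _ kP).
Qed.

Section Eigenvectors.
Variables (K : fieldType) (V : vectType K).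

Lemma pact_eig (f : V -> V) c x p : linear f -> f x = c *: x -> pact f p x = p.[c] *: x.
Proof.
move=> flin fx; elim/poly_ind: p => [|p d IH].
  by rewrite horner0 scale0r -[0]polyC0 pactC scale0r.
by rewrite hornerMXaddC pactD pactC mulrC (pactXM flin) IH (linZ flin) fx scalerDl scalerA.
Qed.

(** The eigencomponents of x are polynomials in f applied to x. *)
Lemma eig_sub (f : 'End(V)) (U : {vspace V}) x : (forall y, y \in U -> f y \in U) ->
  lspan (fun y => exists c, f y = c *: y) x -> x \in U ->
  lspan (fun y => y \in U /\ exists c, f y = c *: y) x.
Proof.
move=> fU Sx xU; have flin : linear f by exact: linearP.
have [ds uds dsx] : exists2 ds, uniq ds & pact f (\prod_(d <- ds) ('X - d%:P)) x = 0.
  elim: Sx => [|c s z [d sd] _ [ds uds dz]].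
    by exists [::] => //; rewrite (lin0 (pact_linear flin _)).
  have [ds' uds' [p1 p2]] : exists2 ds', uniq ds' & \prod_(d <- ds) ('X - d%:P) %|
      \prod_(d <- ds') ('X - d%:P) /\ ('X - d%:P) %| \prod_(d <- ds') ('X - d%:P).
    have [dd|dd] := boolP (d \in ds).
      by exists ds => //; split => //; rewrite (big_rem d) //= dvdp_mulr.
    by exists (d :: ds) => /=; rewrite ?dd // big_cons dvdp_mull ?dvdp_mulr.
  exists ds' => //; rewrite (pact_linear flin).
  have -> : pact f (\prod_(d <- ds') ('X - d%:P)) z = 0 by exact: pact_dvd p1 dz.
  have -> : pact f (\prod_(d <- ds') ('X - d%:P)) s = 0.
    by apply: pact_dvd p2 _ => //; rewrite (pactXsubC flin) sd subrr.
  by rewrite scaler0 addr0.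
have pU p y : y \in U -> pact f p y \in U.
  move=> yU; rewrite /pact; apply: memv_suml => i _; apply: memvZ.
  by elim: (i : nat) => //= j; apply: fU.
elim: ds uds x xU dsx {Sx} => [|d ds IH] /=.
  by move=> _ x _; rewrite big_nil -polyC1 pactC scale1r => ->; exact: lspan0.
move=> /andP [dds uds] x xU; rewrite big_cons (pactM flin); set y := pact _ _ x.
rewrite (pactXsubC flin) => /eqP; rewrite subr_eq0 => /eqP fy.
pose k := (\prod_(e <- ds) ('X - e%:P)).[d].
have k0 : k != 0.
  by rewrite /k -[_ == 0]/(root _ d) root_prod_XsubC.
have yU : y \in U by apply: pU.
rewrite -[x](subrK (k^-1 *: y)); apply: lspanD; last first.
  by apply: lspanZ; apply: lspan_in; split => //; exists d.
apply: IH => //; first by rewrite memvB ?memvZ.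
rewrite -scaleN1r addrC !(linD (pact_linear flin _), linZ (pact_linear flin _)).
by rewrite (pact_eig _ flin fy) -/y -/k [k^-1 *: _]scalerA mulVf // scale1r scaleN1r addNr.
Qed.

(** The eigenspaces of the first operator in U are stable under the others. *)
Lemma simdiag (fs : seq 'End(V)) (U : {vspace V}) :
  (forall f, f \in fs -> forall x, lspan (fun y => exists c, f y = c *: y) x) ->
  (forall f g, f \in fs -> g \in fs -> forall x, f (g x) = g (f x)) ->
  (forall f, f \in fs -> forall y, y \in U -> f y \in U) ->
  forall x, x \in U ->
  lspan (fun y => y \in U /\ forall f, f \in fs -> exists c, f y = c *: y) x.
Proof.
elim: fs U => [|f fs IH] U dg cm sU x xU; first by apply: lspan_in.
have ff : f \in f :: fs by rewrite inE eqxx.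
apply: lspan_trans (eig_sub (sU f ff) (dg f ff x) xU) => s [sinU [c sc]].
pose U' := (U :&: lker (f - c *: \1%VF))%VS.
have U'P y : y \in U' = (y \in U) && (f y == c *: y).
  rewrite memv_cap memv_ker; congr (_ && _).
  by rewrite add_lfunE opp_lfunE scale_lfunE id_lfunE subr_eq0.
have gs g : g \in fs -> g \in f :: fs by rewrite inE => ->; rewrite orbT.
have : lspan (fun y => y \in U' /\ forall g, g \in fs -> exists c, g y = c *: y) s.
  apply: IH => [g /gs /dg //|g h /gs gf /gs hf|g /gs gf y|]; first exact: cm.
    rewrite !U'P => /andP [yU /eqP fy]; rewrite sU // cm // fy.
    by rewrite linearZ /=.
  by rewrite U'P sinU sc eqxx.
apply: lspan_mono => y []; rewrite U'P => /andP [yU /eqP fy] yfs; split => // g.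
by rewrite inE => /orP [/eqP ->|/yfs //]; exists c.
Qed.

End Eigenvectors.

(** * Traces and the Killing form *)

Section Trace.
Variables (K : fieldType) (L : lieAlgType K).
Implicit Types f g : 'End(L).

Lemma lfun_trace_basis n (X : n.-tuple L) f : basis_of fullv X ->
  lfun_trace f = \sum_(i < n) coord X i (f X`_i).
Proof.
move=> bX; set Y := vbasis {:L}; have bY : basis_of fullv Y := vbasisP _.
have cX v : v = \sum_(i < n) coord X i v *: X`_i.
  by apply: coord_basis bX _; rewrite memvf.
have cY v : v = \sum_(i < \dim {:L}) coord Y i v *: Y`_i.
  by apply: coord_basis bY _; rewrite memvf.
transitivity (\sum_(i < n) \sum_(j < \dim {:L}) coord Y j X`_i * coord X i (f Y`_j)).
  rewrite exchange_big; apply: eq_bigr => j _ /=.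
  rewrite {1}[f _]cX linear_sum; apply: eq_bigr => i _.
  by rewrite linearZ /= mulrC.
apply: eq_bigr => i _; rewrite [X`_i in RHS]cY !linear_sum; apply: eq_bigr => j _.
by rewrite !linearZ.
Qed.

Lemma lfun_trace_linear : scalar (@lfun_trace K L).
Proof.
move=> c f g; rewrite /lfun_trace mulr_sumr -big_split; apply: eq_bigr => i _.
by rewrite add_lfunE scale_lfunE linearP.
Qed.

Lemma lfun_traceC f g : lfun_trace (f \o g)%VF = lfun_trace (g \o f)%VF.
Proof.
set Y := vbasis {:L}; have bY : basis_of fullv Y := vbasisP _.
have cY v : v = \sum_(i < \dim {:L}) coord Y i v *: Y`_i.
  by apply: coord_basis bY _; rewrite memvf.
have E f1 g1 : lfun_trace (f1 \o g1)%VF =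
  \sum_(i < \dim {:L}) \sum_(j < \dim {:L}) coord Y j (g1 Y`_i) * coord Y i (f1 Y`_j).
  rewrite /lfun_trace; apply: eq_bigr => i _; rewrite comp_lfunE {1}[g1 _]cY !linear_sum.
  by apply: eq_bigr => j _; rewrite !linearZ.
rewrite !E exchange_big; apply: eq_bigr => i _; apply: eq_bigr => j _.
by rewrite mulrC.
Qed.

End Trace.

(** The characteristic polynomial of a nilpotent operator is a power of 'X. *)
Lemma lfun_trace_nilpotent (C : closedFieldType) (L : lieAlgType C) (f : 'End(L)) N :
  (forall x, iter N f x = 0) -> lfun_trace f = 0.
Proof.
move=> fN; set Y := vbasis {:L}; have bY : basis_of fullv Y := vbasisP _.
have cY v : v = \sum_(i < \dim {:L}) coord Y i v *: Y`_i.
  by apply: coord_basis bY _; rewrite memvf.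
set n := \dim {:L} in Y bY cY *.
pose M : 'M[C]_n := \matrix_(i, j) coord Y j (f Y`_i).
have -> : lfun_trace f = \tr M by apply: eq_bigr => i _; rewrite mxE.
have [n0|n0] := posnP n.
  by rewrite /mxtrace big1 // => i _; move: (ltn_ord i); rewrite {2}n0.
have E0 a : eigenvalue M a -> a = 0.
  move=> /eigenvalueP [v vM v0].
  pose x := \sum_(i < n) v 0 i *: Y`_i.
  have x0 : x != 0.
    apply: contra v0 => /eqP x0; apply/eqP/rowP => i; rewrite mxE.
    by have /freeP := basis_free bY; apply.
  have fx : f x = a *: x.
    rewrite /x linear_sum scaler_sumr /=.
    transitivity (\sum_(i < n) \sum_(j < n) (v 0 i * M i j) *: Y`_j).
      apply: eq_bigr => i _; rewrite linearZ /= [f _]cY scaler_sumr.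
      by apply: eq_bigr => j _; rewrite mxE scalerA.
    rewrite exchange_big; apply: eq_bigr => j _ /=.
    by rewrite -scaler_suml scalerA; congr (_ *: _); have := congr1 (fun w : 'rV_n => w 0 j) vM; rewrite !mxE.
  have fi k : iter k f x = a ^+ k *: x.
    elim: k => [|k IH]; first by rewrite expr0 scale1r.
    by rewrite iterS IH linearZ /= fx scalerA exprSr.
  have /eqP := fN x; rewrite fi scaler_eq0 (negbTE x0) orbF expf_eq0.
  by move=> /andP [_ /eqP].
have [r rE] := closed_field_poly_normal (char_poly M).
have cm := char_poly_monic M.
rewrite (monicP cm) scale1r in rE.
have r0 z : z \in r -> z = 0.
  by move=> zr; apply: E0; rewrite eigenvalue_root_char rE root_prod_XsubC.
have rX : char_poly M = 'X^(size r).
  rewrite rE; transitivity (\prod_(z <- r) ('X : {poly C})).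
    by rewrite big_seq [RHS]big_seq; apply: eq_bigr => z /r0 ->; rewrite subr0.
  by rewrite big_const_seq count_predT iter_mulr_1.
have sr : size r = n.
  by have := size_char_poly M; rewrite rX size_polyXn => -[].
apply/eqP; rewrite -oppr_eq0 -char_poly_trace // rX sr coefXn.
by case: (n) n0 => // m _; rewrite /= eqn_leq ltnn andbF.
Qed.

Section KillingForm.
Variables (K : fieldType) (L : lieAlgType K).
Implicit Types x y z : L.

Lemma lie_leibniz x y z : lie x (lie y z) = lie (lie x y) z + lie y (lie x z).
Proof.
have /eqP := lie_jacobi x y z; rewrite -addrA addr_eq0 => /eqP ->.
by rewrite [lie z x]lieC [lie z _]lieC lieNr -opprD opprK addrC.
Qed.

Lemma lie_suml (I : Type) (r : seq I) (P : pred I) (F : I -> L) y :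
  lie (\sum_(i <- r | P i) F i) y = \sum_(i <- r | P i) lie (F i) y.
Proof. by apply: (big_morph (lie^~ y)) => [x z|]; rewrite ?lieDl ?lie0l. Qed.

Lemma lie_sumr (I : Type) (r : seq I) (P : pred I) (F : I -> L) y :
  lie y (\sum_(i <- r | P i) F i) = \sum_(i <- r | P i) lie y (F i).
Proof. by apply: (big_morph (lie y)) => [x z|]; rewrite ?lieDr ?lie0r. Qed.

Lemma killingC x y : killing x y = killing y x.
Proof. exact: lfun_traceC. Qed.

Lemma ad_linear : linear (@ad K L).
Proof.
by move=> c x y; apply/lfunP => z; rewrite add_lfunE scale_lfunE !adE lie_linearl.
Qed.

Lemma killing_linear x : scalar (killing x).
Proof.
move=> c y z; rewrite /killing ad_linear comp_lfunDr -comp_lfunZr.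
exact: lfun_trace_linear.
Qed.

Lemma ad_lie x y : ad (lie x y) = ((ad x \o ad y) - (ad y \o ad x))%VF.
Proof.
by apply/lfunP => z; rewrite add_lfunE opp_lfunE !comp_lfunE !adE lie_leibniz addrK.
Qed.

Lemma lfun_traceB (f g : 'End(L)) : lfun_trace (f - g) = lfun_trace f - lfun_trace g.
Proof. by rewrite -scaleN1r addrC lfun_trace_linear mulN1r addrC. Qed.

Lemma killing_inv x y z : killing (lie x y) z + killing y (lie x z) = 0.
Proof.
rewrite /killing !ad_lie comp_lfunDl comp_lfunDr comp_lfunNl comp_lfunNr !lfun_traceB.
rewrite !comp_lfunA [lfun_trace ((ad y \o ad z) \o ad x)%VF]lfun_traceC comp_lfunA.
by rewrite addrA subrK subrr.
Qed.

End KillingForm.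

(** * Derivations of a Lie algebra with nondegenerate Killing form *)

Section Derivations.
Variables (C : closedFieldType) (L : lieAlgType C).
Hypothesis killing_nondeg : forall x : L, (forall y, killing x y = 0) -> x = 0.

Lemma centerless (x : L) : (forall y, lie x y = 0) -> x = 0.
Proof.
move=> x0; apply: killing_nondeg => y; rewrite /killing.
have -> : ad x = 0 by apply/lfunP => z; rewrite adE x0 zero_lfunE.
by rewrite comp_lfun0l /lfun_trace big1 // => i _; rewrite zero_lfunE linear0.
Qed.

(** Subtracting an inner derivation makes D orthogonal to all of ad L for the
    trace form, and then D x is killing-orthogonal to everything. *)
Lemma derivation_inner (D : 'End(L)) :
  (forall x y, D (lie x y) = lie (D x) y + lie x (D y)) ->
  exists d, forall x, D x = lie d x.
Proof.
move=> Dder.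
have [d dP] : exists d, forall y, killing d y = lfun_trace (D \o ad y)%VF.
  apply: (nondeg_repr (b := @killing C L)) => //.
  - by move=> y c x z /=; rewrite ![killing _ y]killingC killing_linear.
  - exact: killing_linear.
  - move=> c x y; rewrite ad_linear comp_lfunDr -comp_lfunZr; exact: lfun_trace_linear.
pose E := D - ad d.
have EE x : E x = D x - lie d x by rewrite add_lfunE opp_lfunE adE.
have trE y : lfun_trace (E \o ad y)%VF = 0.
  by rewrite /E comp_lfunDl comp_lfunNl lfun_traceB -dP subrr.
have Eder x y : E (lie x y) = lie (E x) y + lie x (E y).
  by rewrite !EE Dder lieBl lieBr lie_leibniz opprD addrACA.
exists d => x; apply/eqP; rewrite -subr_eq0 -EE; apply/eqP/killing_nondeg => y; rewrite /killing.
have -> : ad (E x) = ((E \o ad x) - (ad x \o E))%VF.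
  by apply/lfunP => z; rewrite add_lfunE opp_lfunE !comp_lfunE !adE Eder addrK.
have := trE (lie x y); rewrite ad_lie comp_lfunDr comp_lfunNr lfun_traceB => /eqP.
rewrite subr_eq0 => /eqP tr1; rewrite comp_lfunDl comp_lfunNl lfun_traceB.
by rewrite -!comp_lfunA tr1 [X in _ - X]lfun_traceC -comp_lfunA subrr.
Qed.

(** The Jordan decomposition in L itself: the semisimple part of ad x is a
    derivation, hence inner. *)
Lemma jordan_ad (x : L) : exists (s : L) (N : nat), [/\
    forall c n y, iter n (fun y => lie x y - c *: y) y = 0 -> lie s y = c *: y,
    forall y, lspan (fun y => exists c, lie s y = c *: y) y,
    forall T : 'End(L), (forall y, T (lie x y) = lie x (T y)) ->
       forall y, T (lie s y) = lie s (T y) &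
    forall y, iter N (lie (x - s)) y = 0].
Proof.
have [S [N [SG Sspan Scom Snil]]] := jordan_semisimple (ad x).
have iE c n y : iter n (fun y => ad x y - c *: y) y = iter n (fun y => lie x y - c *: y) y.
  by apply: eq_iter => z; rewrite adE.
(* brackets of generalized eigenvectors are generalized eigenvectors for the sum
   of the eigenvalues, so that the semisimple part of ad x is a derivation *)
have shift (c d : C) n m : forall y z,
    iter n (fun y => lie x y - c *: y) y = 0 ->
    iter m (fun y => lie x y - d *: y) z = 0 ->
    iter (n + m) (fun y => lie x y - (c + d) *: y) (lie y z) = 0.
  have il e k : linear (iter k (fun y : L => lie x y - e *: y)).
    apply: iter_linear => a u v; rewrite lie_linearr scalerBr scalerDr opprD addrACA.
    by rewrite !scalerA mulrC.
  have [l] := ubnP (n + m).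
  elim: l n m => // l IH n m nm y z yn zm.
  case: n nm yn => [|n] nm yn; first by rewrite [y]yn lie0l (lin0 (il _ _)).
  case: m nm zm => [|m] nm zm; first by rewrite [z]zm lie0r (lin0 (il _ _)).
  rewrite addSn iterSr.
  have -> : lie x (lie y z) - (c + d) *: lie y z =
     lie (lie x y - c *: y) z + lie y (lie x z - d *: z).
    by rewrite lieBl lieBr lieZl lieZr addrACA -opprD scalerDl -lie_leibniz.
  rewrite (linD (il _ _)).
  have -> : iter (n + m.+1) (fun y => lie x y - (c + d) *: y) (lie (lie x y - c *: y) z) = 0.
    by apply: IH => //; rewrite -iterSr.
  rewrite addnS -addSn.
  have -> : iter (n.+1 + m) (fun y => lie x y - (c + d) *: y) (lie y (lie x z - d *: z)) = 0.
    by apply: IH; rewrite -?iterSr // -ltnS -addnS.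
  by rewrite addr0.
have Sder y z : S (lie y z) = lie (S y) z + lie y (S z).
  elim: (Sspan y) => [|a u v [c uc] _ IH]; first by rewrite lie0l !linear0 !lie0l addr0.
  rewrite lie_linearl !linearP /= IH !lie_linearl addrACA -scalerDr; congr (_ *: _ + _).
  elim: (Sspan z) => [|b w r [d wd] _ IHz]; first by rewrite lie0r !linear0 !lie0r addr0.
  rewrite lie_linearr !linearP /= IHz !lie_linearr addrACA -scalerDr; congr (_ *: _ + _).
  rewrite iE in uc; rewrite iE in wd.
  rewrite (SG (c + d) (N + N)%N); last by rewrite iE; apply: shift.
  rewrite (SG c N) ?iE // (SG d N) ?iE // lieZl lieZr scalerDl //.
have [s sE] := derivation_inner Sder.
exists s, N; split.
- by move=> c n y yc; rewrite -sE; apply: (SG c n); rewrite iE.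
- move=> y; apply: lspan_mono (Sspan y) => z [c zc].
  by exists c; rewrite -sE; apply: (SG c N).
- by move=> T Tx y; rewrite -!sE; apply: Scom => z; rewrite !adE.
- move=> y; rewrite -[RHS](Snil y); apply: eq_iter => z.
  by rewrite lieBl adE sE.
Qed.

End Derivations.

(** * Cartan subalgebras of the fixed point algebra *)

Section NilpotentAction.
Variables (K : fieldType) (L : lieAlgType K).
Implicit Types (U H : {vspace L}).

Lemma lie_prod_in U H u v : u \in U -> v \in H -> lie u v \in lie_prod U H.
Proof.
move=> uU vH; rewrite (coord_vbasis uU) (coord_vbasis vH).
rewrite lie_suml; apply: memv_suml => i _; rewrite lie_sumr; apply: memv_suml => j _.
rewrite lieZl lieZr; do 2!apply: memvZ; apply: memv_span.
by apply/allpairsP; exists ((vbasis U)`_i, (vbasis H)`_j); rewrite !mem_nth ?size_tuple.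
Qed.

Lemma lie_prod_ind U H (P : L -> Prop) x : P 0 ->
  (forall c u v y, u \in U -> v \in H -> P y -> P (c *: lie u v + y)) ->
  x \in lie_prod U H -> P x.
Proof.
move=> P0 PD; pose X := [seq lie u v | u <- vbasis U, v <- vbasis H] => xX.
suff : lspan (fun z => exists u v, [/\ u \in U, v \in H & z = lie u v]) x.
  by elim=> // c s z [u [v [uU vH ->]]] _; apply: PD.
rewrite (@coord_span _ _ _ (in_tuple X) x) //.
apply: lspan_sum => i _; apply/lspanZ/lspan_in.
have /allpairsP [[u v] [/= uU vH ->]] : (in_tuple X)`_i \in X by apply: mem_nth.
by exists u, v; rewrite !(vbasis_mem uU, vbasis_mem vH).
Qed.

Variables (t : {vspace L}).
Hypothesis t_closed : forall x y, x \in t -> y \in t -> lie x y \in t.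
Hypothesis t_nil : lie_nilpotent t.

Definition lcs j := iter j (lie_prod t) t.

Lemma lcs_sub j x : x \in lcs j -> x \in t.
Proof.
elim: j x => // j IH x; apply: (lie_prod_ind (P := fun z => z \in t)); first exact: mem0v.
by move=> c u v y ut /IH vt yt; rewrite memvD // memvZ // t_closed.
Qed.

Lemma lcsS j x : x \in lcs j.+1 -> x \in lcs j.
Proof.
elim: j x => [|j IH] x; first exact: (@lcs_sub 1).
apply: (lie_prod_ind (P := fun z => z \in lcs j.+1)); first exact: mem0v.
by move=> c u v y ut /IH vt yt; rewrite memvD // memvZ // lie_prod_in.
Qed.

Lemma nilpotent_ad x : x \in t -> exists n, forall y, y \in t -> iter n (lie x) y = 0.
Proof.
move=> xt; have [n n0] := t_nil; exists n => y yt; apply/eqP; rewrite -memv0 -n0.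
by elim: n {n0} => // n IH; rewrite !iterS lie_prod_in.
Qed.

(** Engel's theorem, by descending induction on the lower central series, using that the operators of each step commute modulo t on
    what the next step of the series maps into t. *)
Lemma engel_selfnormalizing (c : {vspace L}) :
  (forall x y, x \in t -> y \in c -> lie x y \in c) ->
  (forall x y, x \in t -> y \in c -> exists n, iter n (lie x) y = 0) ->
  (forall y, y \in c -> (forall h, h \in t -> lie y h \in t) -> y \in t) ->
  forall y, y \in c -> y \in t.
Proof.
move=> ct cnil cnorm.
have norm j : forall y, y \in c -> (forall h, h \in lcs j -> lie h y \in t) -> y \in t.
  elim: j => [|j IH] y yc yh.
    by apply: cnorm => // h /yh; rewrite lieC memvN.
  apply: contrapT => /negP yt.
  pose U y := [/\ y \in c, y \notin t & forall h, h \in lcs j.+1 -> lie h y \in t].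
  have Ustab h z : h \in lcs j -> U z -> lie h z \notin t -> U (lie h z).
    move=> hj [zc zt zh] hz; split => //; first exact: ct (lcs_sub hj) zc.
    move=> h' h'j.
    rewrite lie_leibniz.
    apply: memvD; last by apply: t_closed (lcs_sub hj) (zh _ h'j).
    apply: zh; rewrite lieC memvN; apply: lcsS.
    exact: lie_prod_in (lcs_sub hj) h'j.
  have [r rE] : {r : seq L | r = vbasis (lcs j)} by exists (vbasis (lcs j)).
  have rj h : h \in r -> h \in lcs j by rewrite rE => /vbasis_mem.
  have [z [zc zt zh] zr] : exists2 z, U z & forall h, h \in r -> lie h z \in t.
    elim: r rj {rE} => [|h r IHr] rj; first by exists y.
    have [|z zU zr] := IHr; first by move=> h' h'r; apply: rj; rewrite inE h'r orbT.
    have hj : h \in lcs j by apply: rj; rewrite inE eqxx.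
    have [n n0] : exists n, iter n (lie h) z \in t.
      have [n n0] := cnil h z (lcs_sub hj) (let: And3 zc _ _ := zU in zc).
      by exists n; rewrite n0 mem0v.
    elim: n z zU zr n0 => [|n IHn] z zU zr n0; first by case: zU => _ /negP [].
    have [hz|hz] := boolP (lie h z \in t).
      by exists z => // h'; rewrite inE => /orP [/eqP -> //|/zr].
    apply: (IHn (lie h z)); rewrite -?iterSr //; first exact: Ustab.
    move=> h' h'r; have h'j : h' \in lcs j by apply: rj; rewrite inE h'r orbT.
    rewrite lie_leibniz.
    case: zU => zc _ zh; apply: memvD; last by apply: t_closed (lcs_sub hj) (zr _ h'r).
    by apply: zh; apply: lie_prod_in hj; exact: lcs_sub h'j.
  case/negP: zt; apply: IH zc _ => h hj; rewrite (coord_vbasis hj).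
  rewrite lie_suml; apply: memv_suml => i _; rewrite lieZl; apply: memvZ; apply: zr.
  by rewrite rE mem_nth ?size_tuple.
move=> y yc; have [n n0] := t_nil; apply: (norm n) => // h.
by rewrite /lcs n0 memv0 => /eqP ->; rewrite lie0l mem0v.
Qed.

End NilpotentAction.

Section Toral.
Variables (C : numClosedFieldType) (L : lieAlgType C).
Hypothesis killing_nondeg : forall x : L, (forall y, killing x y = 0) -> x = 0.
Variable theta : 'End(L).
Hypotheses (theta_lie : lie_morphism theta) (theta_inv : (theta \o theta)%VF = \1%VF).
Let k := fixedSpace theta.
Let p := lker (theta + \1%VF).
Variables (t a : {vspace L}).
Hypotheses (t_cartan : cartan_subalg k t) (a_sub : (a <= p)%VS).
Hypothesis h_cartan : cartan_subalg fullv (t + a)%VS.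

Lemma thetaK x : theta (theta x) = x.
Proof. by rewrite -comp_lfunE theta_inv id_lfunE. Qed.

Lemma kP x : reflect (theta x = x) (x \in k).
Proof. exact: fixedSpaceP. Qed.

Lemma pP x : reflect (theta x = - x) (x \in p).
Proof.
rewrite memv_ker add_lfunE id_lfunE addr_eq0; exact: eqP.
Qed.

Lemma t_sub_k x : x \in t -> x \in k.
Proof. by case: t_cartan => /subvP tk _ _ _ /tk. Qed.

Lemma kp_split x : exists y z, [/\ y \in k, z \in p & x = y + z].
Proof.
exists (2^-1 *: (x + theta x)), (2^-1 *: (x - theta x)); split.
- by apply/kP; rewrite linearZ linearD /= thetaK addrC.
- by apply/pP; rewrite linearZ linearB /= thetaK -scalerN opprB.
- rewrite -scalerDr addrACA subrr addr0 -mulr2n -scaler_nat scalerA mulVf ?scale1r //.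
  by rewrite pnatr_eq0.
Qed.

Lemma killing_theta (x y : L) : killing (theta x) (theta y) = killing x y.
Proof.
have adT z : ad (theta z) = (theta \o (ad z \o theta))%VF.
  by apply/lfunP => w; rewrite !comp_lfunE !adE theta_lie thetaK.
rewrite /killing !adT -comp_lfunA lfun_traceC; congr lfun_trace.
by apply/lfunP => w; rewrite !comp_lfunE !thetaK.
Qed.

(** The product of ad x with an operator commuting with it is nilpotent. *)
Lemma killing_commuting_nilpotent (x y : L) N : lie x y = 0 ->
  (forall z, iter N (lie x) z = 0) -> killing x y = 0.
Proof.
move=> xy xN; apply: (lfun_trace_nilpotent (N := N)) => z.
have com w : lie y (lie x w) = lie x (lie y w).
  by rewrite [RHS]lie_leibniz xy lie0l add0r.
suff -> : iter N (ad x \o ad y)%VF z = iter N (lie x) (iter N (lie y) z) by rewrite xN.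
elim: (N) => // n IH; rewrite !iterS IH comp_lfunE !adE; congr lie.
move: (iter n (lie y) z) => w; elim: n {IH} => // n IH; rewrite !iterS com IH.
by [].
Qed.

(* the semisimple parts of the elements of t *)
Let ss_part (s : L) := [/\ s \in t, forall x, x \in t -> lie s x = 0 &
  forall y, lspan (fun y => exists c, lie s y = c *: y) y].

(* the semisimple part of x commutes with all that x acts nilpotently on, in
   particular with t; it is fixed by theta as x is *)
Let jordan_t x : x \in t -> exists s N, [/\ ss_part s,
  forall z, iter N (lie (x - s)) z = 0 &
  forall n y, iter n (lie x) y = 0 -> lie s y = 0].
Proof.
move=> xt; have [s [N [s1 s2 s3 s4]]] := jordan_ad killing_nondeg x.
have [tk tcl tnil tnorm] := t_cartan.
have s0 n y : iter n (lie x) y = 0 -> lie s y = 0.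
  move=> xn; rewrite (s1 0 n) ?scale0r // -[RHS]xn; apply: eq_iter => z.
  by rewrite scale0r subr0.
have st y : y \in t -> lie s y = 0.
  by move=> yt; have [n /(_ _ yt)] := nilpotent_ad tnil xt; apply: s0.
exists s, N; split=> //; split=> //; apply: tnorm; last first.
  by move=> h ht; rewrite st // mem0v.
apply/kP/eqP; rewrite -subr_eq0; apply/eqP/(centerless killing_nondeg) => y.
have thx : theta x = x by apply/kP/t_sub_k.
rewrite lieBl -[y]thetaK -theta_lie s3 ?subrr // => z.
by rewrite theta_lie thx.
Qed.

Let tcl x y : x \in t -> y \in t -> lie x y \in t.
Proof. by case: t_cartan => _ tc _ _; apply: tc. Qed.
Let tnil : lie_nilpotent t.
Proof. by case: t_cartan. Qed.
Let tnorm x : x \in k -> (forall h, h \in t -> lie x h \in t) -> x \in t.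
Proof. by case: t_cartan => _ _ _; apply. Qed.

(** t is the centralizer in k of its semisimple parts: there t acts by
    nilpotent operators, so Engel's theorem applies. *)
Let centralizer_ss y : y \in k -> (forall s, ss_part s -> lie s y = 0) -> y \in t.
Proof.
move=> yk ys.
have [c cP] := lspan_vspace (fun y => y \in k /\ forall s, ss_part s -> lie s y = 0).
have cE z : z \in c <-> z \in k /\ forall s, ss_part s -> lie s z = 0.
  split; last by move=> zz; apply/cP/lspan_in.
  move=> /cP; elim=> [|d u v [uk us] _ [vk vs]].
    by split; [exact: mem0v | move=> s _; rewrite lie0r].
  split; first by rewrite memvD ?memvZ.
  by move=> s ss; rewrite lie_linearr us // vs // scaler0 addr0.
apply: (engel_selfnormalizing tcl tnil (c := c)); last by apply/cE.
- move=> x z xt /cE [zk zs]; apply/cE; split.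
    by apply/kP; rewrite theta_lie; congr lie; apply/kP => //; exact: t_sub_k.
  move=> s ss; have [st sx _] := ss.
  by rewrite lie_leibniz (sx x xt) (zs s ss) lie0l lie0r addr0.
- move=> x z xt /cE [zk zs]; have [s [N [ss nil _]]] := jordan_t xt.
  exists N; rewrite -[RHS](nil z).
  have [st sx _] := ss.
  suff E n : iter n (lie x) z = iter n (lie (x - s)) z /\ lie s (iter n (lie x) z) = 0.
    by have [] := E N.
  elim: n => [|n [IH IHs]]; first by split => //; exact: zs.
  rewrite !iterS -IH lieBl IHs subr0; split => //.
  by rewrite lie_leibniz (sx x xt) IHs lie0l lie0r addr0.
- by move=> z /cE [zk _]; exact: tnorm.
Qed.

(** z is killing-orthogonal to p by invariance under theta, to the eigenvectors
    in k of the semisimple parts for nonzero eigenvalues by invariance, and the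
    common kernel of the semisimple parts in k is t. *)
Let killing_t_nondeg z : z \in t -> (forall y, y \in t -> killing z y = 0) -> z = 0.
Proof.
move=> zt z0; apply: killing_nondeg => y.
have zth : theta z = z by apply/kP/t_sub_k.
have [y1 [y2 [y1k /pP y2p ->]]] := kp_split y.
have kl := killing_linear z; rewrite (sclD kl).
have -> : killing z y2 = 0.
  have := killing_theta z y2; rewrite zth y2p -scaleN1r (sclZ kl) mulN1r => /eqP.
  by rewrite eq_sym -addr_eq0 -mulr2n mulrn_eq0 => /eqP.
rewrite addr0.
have [X [_ XS SX]] := lspan_finite ss_part.
have : lspan (fun y => y \in k /\
    forall f, f \in [seq ad s | s <- X] -> exists c, f y = c *: y) y1.
  apply: simdiag y1k => [_ /mapP [s /XS [_ _ sd] ->] x|_ _ /mapP [s /XS ss ->] /mapP [s' /XS ss' ->] x|].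
  - by apply: lspan_mono (sd x) => u [c uc]; exists c; rewrite adE.
  - rewrite !adE; have [st s0 _] := ss; have [st' _ _] := ss'.
    by rewrite lie_leibniz (s0 _ st') lie0l add0r.
  - move=> _ /mapP [s /XS [/t_sub_k sk _ _] ->] u uk; rewrite adE.
    by apply/kP; rewrite theta_lie; congr lie; apply/kP.
elim=> [|c u v [uk ud] _ IH]; first exact: (scl0 kl).
rewrite kl IH addr0.
case: (pselect (forall s, s \in X -> lie s u = 0)) => [us|].
  rewrite z0 ?mulr0 //; apply: centralizer_ss => // s /SX sX.
  rewrite (coord_span (X := in_tuple X) sX).
  by rewrite lie_suml big1 // => i _; rewrite lieZl us ?scaler0 // mem_nth.
move=> /existsNP [s] /not_implyP [sX su].
have [d] := ud (ad s) (map_f _ sX); rewrite adE => sud.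
have d0 : d != 0 by apply/eqP => d0; apply: su; rewrite sud d0 scale0r.
have [st s0 _] := XS s sX.
have := killing_inv s z u; rewrite s0 // killingC (scl0 (killing_linear u)) add0r sud (sclZ kl).
by move=> /eqP; rewrite mulf_eq0 (negbTE d0) => /eqP ->; rewrite mulr0.
Qed.

(** The last nonzero step [t, u] of the lower central series would be central in
    t, hence killing-orthogonal to the semisimple parts, by invariance, and to the
    nilpotent parts. *)
Lemma t_abelian x y : x \in t -> y \in t -> lie x y = 0.
Proof.
have central z : z \in lcs t 1 -> (forall x, x \in t -> lie z x = 0) -> z = 0.
  move=> z1 zc; have zt := lcs_sub tcl z1.
  apply: killing_t_nondeg => // w wt.
  have [s [N [[st s0 _] nil _]]] := jordan_t wt.
  rewrite -[w](subrK s) (sclD (killing_linear z)).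
  rewrite killingC (killing_commuting_nilpotent (N := N)) ?add0r //; last first.
    by rewrite lieC zc ?oppr0 // memvB.
  elim/lie_prod_ind: z1 => [|c u v z' ut vt IH].
    by rewrite killingC (scl0 (killing_linear s)).
  rewrite killingC (killing_linear s) ![killing s _]killingC IH addr0.
  have := killing_inv u v s => /eqP; rewrite addr_eq0 => /eqP ->.
  by rewrite [lie u s]lieC s0 // oppr0 (scl0 (killing_linear v)) oppr0 mulr0.
have lcs1 n : lcs t n.+1 = 0%VS -> lcs t 1 = 0%VS.
  elim: n => // n IH n0; apply: IH; apply/eqP; rewrite -subv0; apply/subvP => z zn.
  rewrite memv0; apply/eqP/central.
    by elim: (n) zn => // m IHm /(lcsS tcl) /IHm.
  move=> x' xt; apply/eqP; rewrite -memv0 -n0 lieC memvN; exact: lie_prod_in.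
move=> xt yt; apply/eqP; rewrite -memv0.
have [n n0] := tnil; rewrite -(@lcs1 n); first exact: lie_prod_in.
by apply/eqP; rewrite -subv0 -n0; apply/subvP => z /(lcsS tcl).
Qed.

(** The nilpotent part of an element of t commutes with t, hence is
    killing-orthogonal to t. *)
Let ss_all x : x \in t -> ss_part x /\ forall n y, iter n (lie x) y = 0 -> lie x y = 0.
Proof.
move=> xt; have [s [N [ss nil ss0]]] := jordan_t xt.
suff /eqP : x - s = 0 by rewrite subr_eq0 => /eqP xs; rewrite {1 3}xs.
have [st _ _] := ss; have xst : x - s \in t by rewrite memvB.
apply: killing_t_nondeg => // y yt; apply: killing_commuting_nilpotent nil.
exact: t_abelian.
Qed.

Lemma t_diag x : x \in t -> forall y, lspan (fun y => exists c, lie x y = c *: y) y.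
Proof. by move=> /ss_all [[]]. Qed.

(** t acts nilpotently on the nilpotent algebra t + a, and by diagonalizable
    operators. *)
Lemma ta_commute x y : x \in t -> y \in a -> lie x y = 0.
Proof.
move=> xt ya; have [_ _ hnil _] := h_cartan.
have xh : x \in (t + a)%VS by apply: subvP (addvSl _ _) _ xt.
have yh : y \in (t + a)%VS by apply: subvP (addvSr _ _) _ ya.
have [n xn] := nilpotent_ad hnil xh.
by have [_] := ss_all xt; apply; exact: xn.
Qed.

Lemma centralizer_k y : y \in k -> (forall x, x \in t -> lie x y = 0) -> y \in t.
Proof.
by move=> yk yc; apply: tnorm => // h /yc; rewrite lieC => /eqP; rewrite oppr_eq0 => /eqP ->; exact: mem0v.
Qed.

(** The p-part q of the centralizer of t satisfies [q, q] <= t, so it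
    normalizes t + a. *)
Lemma centralizer_t y : (forall x, x \in t -> lie x y = 0) -> y \in (t + a)%VS.
Proof.
have [y1 [y2 [y1k y2p ->]]] := kp_split y => yc.
have y12 x : x \in t -> lie x y1 = 0 /\ lie x y2 = 0.
  move=> xt; have e1 := yc x xt; rewrite lieDr in e1.
  have : theta (lie x y1 + lie x y2) = 0 by rewrite e1 linear0.
  rewrite linearD /= !theta_lie (kP _ (t_sub_k xt)) (kP _ y1k) (pP _ y2p) lieNr => e2.
  have : (lie x y1) *+ 2 = 0.
    by rewrite mulr2n -[RHS]addr0 -{1}e1 -e2 addrACA subrr addr0.
  move=> /eqP; rewrite -scaler_nat scaler_eq0 pnatr_eq0 /= => /eqP l1.
  by split => //; move: e1; rewrite l1 add0r.
apply: memvD.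
  by apply: subvP (addvSl _ _) _ _; apply: centralizer_k => // x /y12 [].
have [_ _ _ hnorm] := h_cartan; apply: hnorm; first exact: memvf.
move=> _ /memv_addP [h1 h1t [h2 h2a ->]]; rewrite lieDr lieC (proj2 (y12 _ h1t)) oppr0 add0r.
apply: subvP (addvSl _ _) _ _; apply: centralizer_k.
  have h2p := subvP a_sub _ h2a.
  by apply/kP; rewrite theta_lie (pP _ y2p) (pP _ h2p) lieNl lieNr opprK.
by move=> x xt; rewrite lie_leibniz (proj2 (y12 _ xt)) (ta_commute xt h2a) lie0l lie0r addr0.
Qed.

End Toral.

(** * Restricted roots and their reflections *)

Lemma last_nonzero_iterate (V : zmodType) (f : V -> V) n x : iter n f x = 0 -> x != 0 ->
  exists2 j, iter j.+1 f x = 0 & forall i, (i <= j)%N -> iter i f x != 0.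
Proof.
move=> /eqP xn x0; have [j jP jmin] := @ex_minnP (fun i => iter i f x == 0) (ex_intro _ n xn).
case: j jP jmin => [|j] jP jmin; first by rewrite /= (negbTE x0) in jP.
exists j => [|i ij]; first exact/eqP.
by apply/negP => /jmin; rewrite ltnNge ij.
Qed.

Section Sl2.
(* an sl2-triple up to the scalar b, which may be 0, and a highest weight vector *)
Variables (C : numFieldType) (L : lieAlgType C) (e f h : L) (b m : C) (y : L).
Hypotheses (ef : lie e f = h) (hf : lie h f = - ((2 * b) *: f)).
Hypotheses (ey : lie e y = 0) (hy : lie h y = m *: y).

Lemma sl2_weight j : lie h (iter j (lie f) y) = (m - (2 * b) *+ j) *: iter j (lie f) y.
Proof.
elim: j => [|j IH]; first by rewrite mulr0n subr0.
rewrite iterS; set z := iter j _ y in IH *.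
rewrite lie_leibniz hf IH lieNl lieZl lieZr addrC -scalerBl.
by rewrite [_ *+ j.+1]mulrSr opprD addrA.
Qed.

Lemma sl2_raise j :
  lie e (iter j.+1 (lie f) y) = (j.+1%:R * (m - b * j%:R)) *: iter j (lie f) y.
Proof.
elim: j => [|j IH].
  rewrite /= mul1r mulr0 subr0.
  by rewrite lie_leibniz ef ey lie0r addr0.
rewrite iterS; set z := iter j.+1 _ y in IH *.
rewrite lie_leibniz IH ef lieZr -iterS -/z sl2_weight -scalerDl.
congr (_ *: _).
rewrite -[(2 * b) *+ _]mulr_natr -[j.+2%:R]natr1 -[j.+1%:R]natr1; ring.
Qed.

(** The first vanishing iterate determines the highest weight. *)
Lemma sl2_top n : iter n (lie f) y = 0 -> y != 0 ->
  exists2 j, m = b * j%:R & forall i, (i <= j)%N -> iter i (lie f) y != 0.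
Proof.
move=> yn y0; have [j jP jn] := last_nonzero_iterate yn y0.
exists j => //; have := sl2_raise j; rewrite jP lie0r => /esym /eqP.
rewrite scaler_eq0 (negbTE (jn j _)) // orbF mulf_eq0 pnatr_eq0 /= subr_eq0.
by move=> /eqP.
Qed.

End Sl2.

Lemma subn_double r m : (r.*2 <= m)%N -> (m - r = r + (m - r.*2))%N.
Proof. lia. Qed.

Lemma leq_double_of_sum m n r s :
  (m + n = r.*2 + s.*2)%N -> (m < r.*2)%N -> (s.*2 <= n)%N.
Proof. lia. Qed.

Section Roots.
Variables (C : numClosedFieldType) (L : lieAlgType C).
Hypothesis center0 : forall x : L, (forall y, lie x y = 0) -> x = 0.
Variable theta : 'End(L).
Hypotheses (theta_lie : lie_morphism theta) (theta_inv : (theta \o theta)%VF = \1%VF).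
Variable B : L -> L -> C.
Hypotheses (B_linear : forall x, scalar (B x)) (B_sym : forall x y, B x y = B y x).
Hypothesis B_nondeg : forall x, (forall y, B x y = 0) -> x = 0.
Hypothesis B_ginv : forall x y z, B (lie x y) z + B y (lie x z) = 0.
Hypothesis B_thetainv : forall x y, B (theta x) (theta y) = B x y.
Variable t : {vspace L}.
Hypotheses (t_k : forall x, x \in t -> theta x = x)
  (tt : forall x y, x \in t -> y \in t -> lie x y = 0)
  (t_dg : forall x, x \in t -> forall y, lspan (fun y => exists c, lie x y = c *: y) y)
  (t_cent : forall y, theta y = y -> (forall x, x \in t -> lie x y = 0) -> y \in t).
Implicit Types mu nu alpha beta : tdual t.

Let thK x : theta (theta x) = x := thetaK theta_inv x.

Lemma weight_vector y : (forall x, x \in vbasis t -> exists c, lie x y = c *: y) ->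
  exists mu, y \in weight_space mu.
Proof.
move=> yt; have [->|y0] := eqVneq y 0; first by exists 0; exact: mem0v.
have all_c (h : subvs_of t) : exists c, lie (vsval h) y = c *: y.
  have : lspan (fun x => x \in (vbasis t : seq _)) (vsval h).
    rewrite (coord_vbasis (subvsP h)); apply: lspan_sum => i _.
    by apply/lspanZ/lspan_in; apply: mem_nth; rewrite size_tuple.
  elim=> [|c s z /yt [d sd] _ [d' zd]]; first by exists 0; rewrite lie0l scale0r.
  by exists (c * d + d'); rewrite lie_linearl sd zd scalerDl scalerA.
have [mu muP] := choice all_c.
have mulin : linear (mu : subvs_of t -> C^o).
  move=> c u v; apply/eqP; rewrite -subr_eq0.
  suff : (mu (c *: u + v) - (c * mu u + mu v)) *: y == 0.
    by rewrite scaler_eq0 (negbTE y0) orbF.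
  rewrite scalerBl scalerDl -scalerA -!muP linearP /= lie_linearl subrr.
  exact: eqxx.
exists (linfun (mu : subvs_of t -> C^o)); apply/weight_spaceP => h.
by rewrite (linfun_linE mulin) muP.
Qed.

Lemma weight_span (U : {vspace L}) x :
  (forall h y, h \in t -> y \in U -> lie h y \in U) -> x \in U ->
  lspan (fun y => y \in U /\ exists mu, y \in weight_space mu) x.
Proof.
move=> tU xU; have vt h : h \in (vbasis t : seq _) -> h \in t := @vbasis_mem _ _ _ _.
have := @simdiag _ _ [seq ad h | h <- vbasis t] U _ _ _ x xU.
move=> /(_ _ _ _) sd; apply: lspan_mono (sd _ _ _).
- move=> y [yU yd]; split=> //; apply: weight_vector => h ht.
  by have [c] := yd (ad h) (map_f _ ht); rewrite adE => hc; exists c.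
- move=> _ /mapP [h /vt ht ->] z; apply: lspan_mono (t_dg ht z) => u [c uc].
  by exists c; rewrite adE.
- move=> _ _ /mapP [h /vt ht ->] /mapP [h' /vt h't ->] z; rewrite !adE.
  by rewrite lie_leibniz (tt ht h't) lie0l add0r.
- by move=> _ /mapP [h /vt ht ->] y yU; rewrite adE; apply: tU.
Qed.

Lemma weight_span_full y : lspan (fun y => exists mu, y \in @weight_space _ _ t mu) y.
Proof.
apply: lspan_mono (weight_span (U := fullv) _ (memvf y)) => [z [] //|*]; exact: memvf.
Qed.

Lemma weight_theta mu y : y \in weight_space mu -> theta y \in weight_space mu.
Proof.
move=> /weight_spaceP ymu; apply/weight_spaceP => h.
by rewrite -{1}(t_k (subvsP h)) -theta_lie ymu linearZ.
Qed.

Lemma B_lieC x y z : B (lie x y) z = - B y (lie x z).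
Proof. by apply/eqP; rewrite -addr_eq0 B_ginv. Qed.

Lemma BZl c x y : B (c *: x) y = c * B x y.
Proof. by rewrite B_sym (sclZ (B_linear y)) B_sym. Qed.

Lemma B_weight mu nu x y : x \in weight_space mu -> y \in weight_space nu ->
  B x y != 0 -> mu + nu = 0.
Proof.
move=> /weight_spaceP xmu /weight_spaceP ynu Bxy; apply/lfunP => h.
rewrite add_lfunE zero_lfunE; have := B_ginv (vsval h) x y.
rewrite xmu ynu BZl (sclZ (B_linear x)) -mulrDl => /eqP.
by rewrite mulf_eq0 (negbTE Bxy) orbF => /eqP.
Qed.

Lemma lie_weight mu nu x y : x \in weight_space mu -> y \in weight_space nu ->
  lie x y \in weight_space (mu + nu).
Proof.
move=> /weight_spaceP xmu /weight_spaceP ynu; apply/weight_spaceP => h.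
by rewrite lie_leibniz xmu ynu lieZl lieZr add_lfunE -scalerDl.
Qed.

Lemma weight0_t y : y \in t -> y \in weight_space (0 : tdual t).
Proof.
move=> yt; apply/weight_spaceP => h; rewrite zero_lfunE scale0r; apply: tt yt; exact: subvsP.
Qed.

Lemma t_weight0 y : theta y = y -> y \in weight_space (0 : tdual t) -> y \in t.
Proof.
move=> yk /weight_spaceP y0; apply: t_cent => // x xt.
by have := y0 (vsproj t x); rewrite vsprojK // zero_lfunE scale0r.
Qed.

Lemma iter_weight mu alpha e x n : e \in weight_space alpha -> x \in weight_space mu ->
  iter n (lie e) x \in weight_space (mu + alpha *+ n).
Proof.
move=> ea xm; elim: n => [|n IH]; first by rewrite mulr0n addr0.
by rewrite iterS mulrS addrCA; apply: lie_weight.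
Qed.

Lemma weightMn mu n h : (mu *+ n) h = (mu h : C) *+ n.
Proof.
elim: n => [|n IH]; first by rewrite !mulr0n zero_lfunE.
by rewrite !mulrS add_lfunE IH.
Qed.

(** The nonzero iterates are eigenvectors of some element of t for distinct
    eigenvalues. *)
Lemma weight_nilpotent mu alpha e x : alpha != 0 -> e \in weight_space alpha ->
  x \in weight_space mu -> exists n, iter n (lie e) x = 0.
Proof.
move=> a0 ea xmu; apply: contrapT => nx.
have [h ah] : exists h, (alpha h : C) != 0.
  apply: contrapT => na; case/eqP: a0; apply/lfunP => h; rewrite zero_lfunE.
  by apply: contrapT => /eqP ah; apply: na; exists h.
have [ds uds [N dsN]] := annihilating_poly (ad (vsval h)).
pose ev i : C := mu h + alpha h *+ i.
have ei i := iter_weight i ea xmu.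
have evds i : ev i \in ds.
  have hx : ad (vsval h) (iter i (lie e) x) = ev i *: iter i (lie e) x.
    have /weight_spaceP/(_ h) := ei i; rewrite adE add_lfunE => ->; congr (_ *: _).
    by rewrite /ev weightMn.
  have := dsN (iter i (lie e) x); rewrite (pact_eig _ _ hx); last exact: linearP.
  move=> /eqP; rewrite scaler_eq0 => /orP [|/eqP ix]; last by case: nx; exists i.
  rewrite horner_prod prodf_seq_eq0 => /hasP [d dds /=].
  by rewrite horner_exp !hornerE expf_eq0 subr_eq0 => /andP [_ /eqP ->].
have : uniq [seq ev i | i <- iota 0 (size ds).+1].
  rewrite map_inj_uniq ?iota_uniq // => i j /addrI /eqP.
  rewrite -[alpha h *+ i]mulr_natr -[alpha h *+ j]mulr_natr => /eqP /(mulfI ah) /eqP.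
  by rewrite eqr_nat => /eqP.
move=> /uniq_leq_size uq; have /uq : {subset [seq ev i | i <- iota 0 (size ds).+1] <= ds}.
  by move=> _ /mapP [i _ ->].
by rewrite size_map size_iota ltnn.
Qed.

(** ** The form on t and coroots *)

(** A weight vector that is not orthogonal to t has weight 0, and its theta-fixed
    part lies in t. *)
Lemma B_t_nondeg x : x \in t -> (forall y, y \in t -> B x y = 0) -> x = 0.
Proof.
move=> xt x0; apply: B_nondeg => y; have Bx := B_linear x.
elim: (weight_span_full y) => [|c u v [mu um] _ IH]; first exact: scl0 Bx.
rewrite Bx IH addr0; have [Bxu|Bxu] := eqVneq (B x u) 0; first by rewrite Bxu mulr0.
have := B_weight (weight0_t xt) um Bxu; rewrite add0r => mu0; rewrite mu0 in um.
pose u' := 2^-1 *: (u + theta u).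
have u't : u' \in t.
  apply: t_weight0; first by rewrite /u' linearZ linearD /= thK addrC.
  by rewrite memvZ // memvD // weight_theta.
have := x0 _ u't; rewrite /u' (sclZ Bx) (sclD Bx) -{2}(t_k xt) B_thetainv -mulr2n => /eqP.
by rewrite mulf_eq0 invr_eq0 pnatr_eq0 /= mulrn_eq0 => /eqP ->; rewrite mulr0.
Qed.

Lemma flatE (h h' : subvs_of t) : flat B t h h' = B (vsval h) (vsval h').
Proof.
rewrite /flat (linfun_linE (f := fun h => linfun (fun h' : subvs_of t => B (vsval h) (vsval h') : C^o))).
  by apply: (linfun_linE (f := fun h' : subvs_of t => B (vsval h) (vsval h') : C^o)) => c u v; rewrite linearP /= B_linear.
move=> c u v; apply/lfunP => z; rewrite add_lfunE scale_lfunE.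
have E u0 : linfun (fun h' : subvs_of t => B (vsval u0) (vsval h') : C^o) z = B (vsval u0) (vsval z).
  by apply: (linfun_linE (f := fun h' : subvs_of t => B (vsval u0) (vsval h') : C^o)) => c' u' v'; rewrite linearP /= B_linear.
by rewrite !E linearP /= ![B _ (vsval z)]B_sym B_linear.
Qed.

Lemma sharpE alpha h : B (vsval (sharp B alpha)) (vsval h) = alpha h.
Proof.
have [x xP] : exists x : subvs_of t, forall y, B (vsval x) (vsval y) = alpha y.
  apply: (nondeg_repr (b := fun x y : subvs_of t => B (vsval x) (vsval y))) => //.
  - by move=> y c u v; rewrite linearP /= ![B _ (vsval y)]B_sym B_linear.
  - by move=> x c u v; rewrite linearP /= B_linear.
  - move=> x x0; apply: val_inj; apply: B_t_nondeg (subvsP x) _ => y yt.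
    by have := x0 (vsproj t y); rewrite vsprojK.
  - by move=> c u v; rewrite linearP.
have xa : flat B t x = alpha by apply/lfunP => y; rewrite flatE xP.
have aim : alpha \in limg (flat B t) by rewrite -xa memv_img ?memvf.
by rewrite -flatE /sharp limg_lfunVK.
Qed.

(** The sl2-triple of a root alpha, made of eigenvectors e, f of theta for the same
    sign, so that [e, f] is fixed by theta and is the multiple B(e, f) t_alpha of
    the element t_alpha dual to alpha.  If alpha(t_alpha) were 0, then by sl2_top
    with b = 0 the element [e, f] would act by 0 on all weight spaces, contrary to
    the triviality of the center. *)
Lemma root_triple alpha : is_root fullv alpha -> exists e f, [/\
  e \in weight_space alpha, f \in weight_space (- alpha),
  lie e f = vsval (coroot B alpha) & alpha (coroot B alpha) = 2].
Proof.
move=> [a0]; rewrite capvf -subv0 => /subvPn [x xa]; rewrite memv0 => x0.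
have [eps [e [eps2 ea e0 eth]]] : exists eps : C, exists e, [/\ eps * eps = 1,
    e \in weight_space alpha, e != 0 & theta e = eps *: e].
  have [x1|x1] := eqVneq (x + theta x) 0; last first.
    exists 1, (x + theta x); split; rewrite ?mulr1 ?scale1r //.
      by rewrite memvD ?weight_theta.
    by rewrite linearD /= thK addrC.
  exists (-1), x; split=> //; first by rewrite mulrNN mulr1.
  by rewrite scaleN1r; apply/eqP; rewrite -addr_eq0 addrC x1.
have [f [fa fth Bef]] : exists f, [/\ f \in weight_space (- alpha),
    theta f = eps *: f & B e f != 0].
  have [y [mu [ym Bey]]] : exists y mu, y \in @weight_space _ _ t mu /\ B e y != 0.
    apply: contrapT => ny; case/eqP: e0; apply: B_nondeg => y.
    elim: (weight_span_full y) => [|c u v [mu um] _ IH]; first exact: scl0.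
    rewrite B_linear IH addr0; have [->|Bu] := eqVneq (B e u) 0; first by rewrite mulr0.
    by case: ny; exists u, mu.
  have mE : mu = - alpha.
    by apply/eqP; rewrite -addr_eq0 addrC; apply/eqP; exact: B_weight Bey.
  rewrite mE in ym; exists (y + eps *: theta y); split.
  - by rewrite memvD ?memvZ ?weight_theta.
  - by rewrite linearD linearZ /= thK scalerDr scalerA eps2 scale1r addrC.
  - rewrite (sclD (B_linear e)) (sclZ (B_linear e)).
    have -> : B e (theta y) = eps * B e y by rewrite -B_thetainv thK eth BZl.
    by rewrite mulrA eps2 mul1r -mulr2n mulrn_eq0.
have eft : lie e f \in t.
  apply: t_weight0; first by rewrite theta_lie eth fth lieZl lieZr scalerA eps2 scale1r.
  by rewrite -(subrr alpha); apply: lie_weight.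
pose s := sharp B alpha.
have efE : lie e f = B e f *: vsval s.
  apply/eqP; rewrite -subr_eq0; apply/eqP/B_t_nondeg.
    by rewrite memvB // memvZ // subvsP.
  move=> y yt; rewrite -scaleN1r addrC B_sym (sclD (B_linear y)) !(sclZ (B_linear y)).
  rewrite ![B y _]B_sym -[y](vsprojK yt) sharpE mulN1r.
  apply/eqP; rewrite addrC subr_eq0; apply/eqP.
  rewrite lieC -scaleN1r BZl B_lieC mulN1r opprK [lie f _]lieC.
  have /weight_spaceP -> := fa.
  by rewrite opp_lfunE scaleNr opprK (sclZ (B_linear e)) mulrC.
have as0 : alpha s != 0.
  apply/eqP => as0; case/eqP: (a0).
  suff s0 : s = 0.
    by apply/lfunP => h; rewrite -sharpE -/s s0 zero_lfunE linear0 B_sym (scl0 (B_linear _)).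
  apply: val_inj; apply: (scalerI Bef); rewrite scaler0 -efE.
  apply: center0 => y.
  elim: (weight_span_full y) => [|c u v [mu um] _ IH]; first exact: lie0r.
  rewrite lie_linearr IH addr0.
  have [->|u0] := eqVneq u 0; first by rewrite lie0r scaler0.
  pose hh := B e f *: s.
  have hE : lie e f = vsval hh by rewrite efE.
  have ha : alpha hh = 0 by rewrite linearZ /= as0 scaler0.
  have [n en] := weight_nilpotent a0 ea um.
  have [j jP jn] := last_nonzero_iterate en u0.
  pose z := iter j (lie e) u; have z0 : z != 0 by exact: jn.
  have zm := iter_weight j ea um; rewrite -/z in zm.
  have hz : lie (vsval hh) z = (mu hh : C) *: z.
    have /weight_spaceP -> := zm; rewrite add_lfunE; congr (_ *: _).
    by rewrite weightMn ha mul0rn addr0.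
  have hf : lie (vsval hh) f = - ((2 * 0) *: f).
    by have /weight_spaceP -> := fa; rewrite opp_lfunE ha mulr0 oppr0 !scale0r oppr0.
  have a0' : - alpha != 0 by rewrite oppr_eq0.
  have [n' fn] := weight_nilpotent a0' fa zm.
  have [i mi _] := sl2_top hE hf jP hz fn z0.
  by rewrite hE; have /weight_spaceP -> := um; rewrite mi mul0r scale0r scaler0.
have cancel_den (c d : C) : c != 0 -> d != 0 -> 2 / (c * d) * c = 2 / d.
  by move=> c0 d0; field; rewrite c0 d0.
have BsE : B (vsval s) (vsval s) = alpha s by rewrite sharpE.
exists e, ((2 / (B e f * alpha s)) *: f); split => //; first by rewrite memvZ.
  rewrite lieZr efE /coroot -/s BsE linearZ /= scalerA; congr (_ *: _).
  by rewrite mulrC; exact: cancel_den.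
rewrite /coroot -/s BsE linearZ /=; exact: (mulfVK as0).
Qed.

Lemma weight_root mu x : mu != 0 -> x \in weight_space mu -> x != 0 -> is_root fullv mu.
Proof.
move=> m0 xm x0; split=> //; rewrite capvf; apply: contra x0 => /eqP U0.
by rewrite -memv0 -U0.
Qed.

Lemma root_vector mu : is_root fullv mu -> exists2 x, x \in weight_space mu & x != 0.
Proof.
move=> [_]; rewrite capvf -subv0 => /subvPn [x xm]; rewrite memv0 => x0.
by exists x.
Qed.

Lemma reflectionE alpha mu :
  reflection B alpha mu = mu - (mu (coroot B alpha) : C) *: alpha.
Proof.
apply: (linfun_linE (f := fun mu : tdual t => mu - (mu (coroot B alpha) : C) *: alpha)).
move=> c u v; rewrite add_lfunE scale_lfunE scalerDl opprD addrACA scalerBr scalerA.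
by [].
Qed.

Lemma reflectionK alpha : is_root fullv alpha -> involutive (reflection B alpha).
Proof.
move=> /root_triple [_ [_ [_ _ _ a2]]] mu; rewrite !reflectionE.
rewrite add_lfunE opp_lfunE scale_lfunE a2 -addrA -opprD -scalerDl.
rewrite [X in X *: alpha](_ : _ = 0) ?scale0r ?subr0 //.
by rewrite -[_ *: 2]/(_ * 2); ring.
Qed.

(** Move a weight vector x of weight beta to the top of its alpha-string by e and
    down again by f, or the other way around: the two highest weights that
    sl2_top provides tell that one of the two ways passes through the reflected
    weight before the iterates vanish. *)
Lemma reflection_root alpha beta : is_root fullv alpha -> is_root fullv beta ->
  is_root fullv (reflection B alpha beta).
Proof.
move=> ra rb; have [e [f [ea fa ef a2]]] := root_triple ra.
have [x xb x0] := root_vector rb; have [a0 _] := ra.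
have na0 : - alpha != 0 by rewrite oppr_eq0.
set h := coroot B alpha in ef a2.
suff [z [za z0]] : exists z, z \in weight_space (reflection B alpha beta) /\ z != 0.
  apply: weight_root za z0; apply/eqP => r0; case: rb => /eqP []; rewrite -[beta](reflectionK ra).
  by rewrite r0 linear0.
rewrite reflectionE -/h.
have top e' (al : tdual t) : al != 0 -> e' \in weight_space al -> exists r, iter r (lie e') x != 0 /\
    iter r.+1 (lie e') x = 0.
  move=> al0 e'a; have [n en] := weight_nilpotent al0 e'a xb.
  by have [j jP jn] := last_nonzero_iterate en x0; exists j; rewrite jn.
have hv mu (y : L) n : y \in weight_space (mu + alpha *+ n) -> lie (vsval h) y = (mu h + n.*2%:R : C) *: y.
  move=> /weight_spaceP ->; rewrite add_lfunE; congr ((_ + _) *: _).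
  by rewrite weightMn a2 -mulrnA mul2n.
have [r [er0 er]] := top e alpha a0 ea.
have erm := iter_weight r ea xb; set y := iter r (lie e) x in er0 er erm.
have hf : lie (vsval h) f = - ((2 * 1) *: f).
  by have /weight_spaceP -> := fa; rewrite opp_lfunE a2 mulr1 scaleNr.
have [n fn] := weight_nilpotent na0 fa erm.
have [m mE mtop] := sl2_top ef hf er (hv _ _ _ erm) fn er0.
have [s [fs0 fs]] := top f (- alpha) na0 fa.
have fsm := iter_weight s fa xb; set y' := iter s (lie f) x in fs0 fs fsm.
have fe : lie f e = vsval (- h) by rewrite lieC ef linearN.
have he : lie (vsval (- h)) e = - ((2 * 1) *: e).
  by rewrite linearN lieNl; have /weight_spaceP -> := ea; rewrite a2 mulr1.
have hy' : lie (vsval (- h)) y' = (- (beta h : C) + s.*2%:R) *: y'.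
  rewrite linearN lieNl; have /weight_spaceP -> := fsm; rewrite -scaleNr; congr (_ *: _).
  rewrite add_lfunE opprD; congr (_ + _).
  by rewrite weightMn opp_lfunE a2 mulNrn opprK -mulrnA mul2n.
have [n' en] := weight_nilpotent a0 ea fsm.
have [m' mE' mtop'] := sl2_top fe he fs hy' en fs0.
rewrite mul1r in mE; rewrite mul1r in mE'.
have bh : beta h = m%:R - r.*2%:R :> C by rewrite -mE addrK.
have [rm|mr] := leqP r.*2 m.
  exists (iter (m - r) (lie f) y); split; last by apply: mtop; rewrite leq_subr.
  have -> : beta - (beta h : C) *: alpha = (beta + alpha *+ r) + (- alpha) *+ (m - r).
    rewrite bh -natrB // scaler_nat mulNrn -addrA; congr (_ + _).
    rewrite (subn_double rm).
    by rewrite mulrnDr opprD addNKr.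
  exact: iter_weight.
have mm : (m + m' = r.*2 + s.*2)%N.
  apply/eqP; rewrite -(eqr_nat C) !natrD -mE -mE'; apply/eqP; ring.
have sm := leq_double_of_sum mm mr.
exists (iter (m' - s) (lie e) y'); split; last by apply: mtop'; rewrite leq_subr.
have -> : beta - (beta h : C) *: alpha = (beta + (- alpha) *+ s) + alpha *+ (m' - s).
  have -> : (beta h : C) = - (m' - s.*2)%:R by rewrite natrB // -mE'; ring.
  rewrite scaleNr opprK scaler_nat -addrA; congr (_ + _).
  rewrite (subn_double sm).
  by rewrite mulrnDr mulNrn addKr.
exact: iter_weight.
Qed.

Lemma weyl_roots w : weyl_group B w -> [/\ forall beta, is_root fullv beta -> is_root fullv (w beta),
  forall beta, is_root fullv beta -> exists2 gamma, is_root fullv gamma & w gamma = beta &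
  injective w].
Proof.
elim=> [|alpha w' ra _ [w1 w2 w3]].
  split=> [b|b rb|b c]; rewrite ?id_lfunE //; exists b; rewrite ?id_lfunE //.
split=> [b rb|b rb|b c].
- by rewrite comp_lfunE; apply/reflection_root/w1.
- have [g rg gE] := w2 _ (reflection_root ra rb).
  by exists g; rewrite // comp_lfunE gE reflectionK.
- by rewrite !comp_lfunE => /(can_inj (reflectionK ra)) /w3.
Qed.

(** If positive roots summed to 0, one of them would pair negatively with the
    coroot of another, so that their sum would be a positive root: the sum
    could be shortened. *)
Lemma positive_sum (P : {fset tdual t}) (s : seq (tdual t)) :
  positive_system (is_root fullv) P -> (forall a, a \in s -> a \in P) -> s != [::] ->
  \sum_(a <- s) a != 0.
Proof.
move=> [Proot Pxor Psum]; have [n] := ubnP (size s).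
elim: n s => // n IH [|alpha s] //=; rewrite ltnS => sn sP _.
have aP : alpha \in P by apply: sP; rewrite inE eqxx.
have ra := Proot _ aP; have [e [f [ea fa ef a2]]] := root_triple ra.
set h := coroot B alpha in ef a2.
have sP' b : b \in s -> b \in P by move=> bs; apply: sP; rewrite inE bs orbT.
apply/eqP => s0.
have [b bs [x [xb ex]]] : exists2 b, b \in s & exists x, x \in weight_space b /\ lie e x != 0.
  apply: contrapT => nb.
  have b0 b : b \in s -> 0 <= (b h : C).
    move=> bs; have [x xb x0] := root_vector (Proot _ (sP' _ bs)).
    have ex : lie e x = 0.
      by apply: contrapT => /eqP ex; apply: nb; exists b => //; exists x.
    have hf : lie (vsval h) f = - ((2 * 1) *: f).
      by have /weight_spaceP -> := fa; rewrite opp_lfunE a2 mulr1 scaleNr.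
    have na0 : - alpha != 0 by rewrite oppr_eq0; case: ra.
    have [n' fn] := weight_nilpotent na0 fa xb.
    have hx : lie (vsval h) x = (b h : C) *: x by have /weight_spaceP := xb.
    by have [m -> _] := sl2_top ef hf ex hx fn x0; rewrite mul1r ler0n.
  have : (\sum_(a <- alpha :: s) a) h = 0 by rewrite s0 zero_lfunE.
  rewrite sum_lfunE big_cons a2 => /eqP; apply/negP; rewrite gt_eqF //.
  by rewrite ltr_wpDr ?ltr0n // big_seq sumr_ge0.
have exab := lie_weight ea xb.
have ab0 : alpha + b != 0.
  apply/eqP => ab0; have := Pxor _ ra; rewrite aP.
  have -> : - alpha = b by apply/eqP; rewrite eq_sym -addr_eq0 addrC ab0.
  by rewrite sP'.
have abP := Psum _ _ aP (sP' _ bs) (weight_root ab0 exab ex).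
have : \sum_(a <- (alpha + b) :: rem b s) a != 0.
  apply: IH => //=.
    by rewrite size_rem // prednK //; case: (s) bs.
  move=> a; rewrite inE => /orP [/eqP -> //|/mem_rem]; exact: sP'.
have E : \sum_(a <- s) a = b + \sum_(a <- rem b s) a by rewrite (big_rem b bs).
by move: s0; rewrite !big_cons -addrA -E => ->; rewrite eqxx.
Qed.

End Roots.

(** * The triangular decomposition of p *)

Section Triangular.
Variables (C : numClosedFieldType) (L : lieAlgType C).
Variable theta : 'End(L).
Hypotheses (theta_lie : lie_morphism theta) (theta_inv : (theta \o theta)%VF = \1%VF).
Let p := lker (theta + \1%VF).
Variable B : L -> L -> C.
Hypotheses (B_linear : forall x, scalar (B x)) (B_sym : forall x y, B x y = B y x).
Hypothesis B_nondeg : forall x, (forall y, B x y = 0) -> x = 0.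
Hypothesis B_ginv : forall x y z, B (lie x y) z + B y (lie x z) = 0.
Hypothesis B_thetainv : forall x y, B (theta x) (theta y) = B x y.
Variables t a : {vspace L}.
Hypotheses (t_k : forall x, x \in t -> theta x = x)
  (tt : forall x y, x \in t -> y \in t -> lie x y = 0)
  (t_dg : forall x, x \in t -> forall y, lspan (fun y => exists c, lie x y = c *: y) y)
  (a_sub : (a <= p)%VS)
  (ta : forall x y, x \in t -> y \in a -> lie x y = 0)
  (t_cent : forall y, (forall x, x \in t -> lie x y = 0) -> y \in (t + a)%VS).
Variable pos : tdual t -> Prop.
Hypothesis pos_sum : forall s : seq (tdual t), (forall mu, mu \in s -> pos mu) ->
  s != [::] -> \sum_(mu <- s) mu != 0.
Hypothesis pos_total : forall (mu : tdual t) x, mu != 0 -> x \in weight_space mu -> x != 0 ->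
  pos mu \/ pos (- mu).
Implicit Types (mu nu : tdual t) (P Q : tdual t -> Prop) (n : {vspace L}).

(** n is the sum of the weight spaces with weights in P; stated through elements
    since the set of weights in P need not be given as a finite list. *)
Definition graded P n := forall x, x \in n <->
  lspan (fun y => exists2 mu, P mu & y \in weight_space mu) x.

Let BZl := BZl B_linear B_sym.
Let Bl y : scalar (B^~ y).
Proof. by move=> c u v; rewrite /= ![B _ y]B_sym B_linear. Qed.
Let pE x : (x \in p) = (theta x == - x).
Proof. by apply/pP/eqP. Qed.

Lemma p_stable h y : theta h = h -> y \in p -> lie h y \in p.
Proof. by rewrite !pE => hk /eqP yp; rewrite theta_lie hk yp lieNr. Qed.

Lemma p_weight0 y : y \in p -> y \in weight_space (0 : tdual t) -> y \in a.
Proof.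
move=> yp /weight_spaceP y0.
have : y \in (t + a)%VS.
  apply: t_cent => x xt; have := y0 (vsproj t x).
  by rewrite vsprojK // zero_lfunE scale0r.
move=> /memv_addP [x xt [z za yE]].
have zp := subvP a_sub _ za.
move: yp zp; rewrite yE !pE linearD /= t_k // => /eqP + /eqP zE; rewrite zE => /eqP.
rewrite opprD; move=> /eqP /addIr /eqP; rewrite -addr_eq0 -mulr2n -scaler_nat scaler_eq0.
by rewrite pnatr_eq0 /= => /eqP ->; rewrite add0r.
Qed.

Lemma weight_unique mu nu x : x != 0 -> x \in weight_space mu -> x \in weight_space nu -> mu = nu.
Proof.
move=> x0 /weight_spaceP xm /weight_spaceP xn; apply/lfunP => h.
have /eqP := xm h; rewrite xn -subr_eq0 -scalerBl scaler_eq0 (negbTE x0) orbF subr_eq0.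
by move=> /eqP.
Qed.

Lemma graded_stable P n h x : graded P n -> h \in t -> x \in n -> lie h x \in n.
Proof.
move=> nP ht /nP xn; apply/nP; apply: lspan_map xn => [c u v|s [mu Pmu smu]].
  exact: lie_linearr.
have /weight_spaceP/(_ (vsproj t h)) := smu; rewrite vsprojK // => ->.
by apply/lspanZ/lspan_in; exists mu.
Qed.

(** A weight vector y of p lies in n, and by lspan_weight it is a combination of
    vectors of n of the same weight, which therefore satisfies P unless y = 0. *)
Lemma graded_span P n x : graded P n -> x \in (p :&: n)%VS ->
  lspan (fun y => y \in (p :&: n)%VS /\ exists2 mu, P mu & y \in weight_space mu) x.
Proof.
move=> nP xpn.
have : lspan (fun y => y \in (p :&: n)%VS /\ exists mu, y \in @weight_space _ _ t mu) x.
  apply: (weight_span tt t_dg) => // h y ht; rewrite !memv_cap => /andP [yp yn].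
  by rewrite p_stable ?t_k //= (graded_stable nP).
apply: lspan_trans => y [ypn [mu ymu]].
have [->|y0] := eqVneq y 0; first exact: lspan0.
have yn : lspan (fun y => exists2 mu, P mu & y \in weight_space mu) y.
  by apply/nP; move: ypn; rewrite memv_cap => /andP [].
have := @lspan_weight _ _ _ (fun (h : subvs_of t) x => lie (vsval h) x) _
  (fun h => mu h) y _ _ _ yn.
move=> /(_ _ _ _) H.
have {H} yl : lspan (fun s => (exists2 nu, P nu & s \in weight_space nu) /\
    forall h : subvs_of t, lie (vsval h) s = (mu h : C) *: s) y.
  apply: H => [h c u v|s [nu _ snu]|h]; first exact: lie_linearr.
    by exists (fun h => nu h) => h; apply/weight_spaceP.
  by apply/weight_spaceP.
apply: lspan_in; split => //; exists mu => //.
have [s [s0 [nu Pnu snu] smu]] : exists s, [/\ s != 0, exists2 nu, P nu & s \in weight_space nu &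
    forall h : subvs_of t, lie (vsval h) s = (mu h : C) *: s].
  apply: contrapT => ns; case/eqP: y0; elim: yl => // c s z [sP smu] _ ->; rewrite addr0.
  have [->|s0] := eqVneq s 0; first by rewrite scaler0.
  by case: ns; exists s.
by rewrite (weight_unique s0 (_ : s \in weight_space mu) snu) //; apply/weight_spaceP.
Qed.

Lemma graded_orth P Q n n' x y : graded P n -> graded Q n' ->
  (forall mu nu, P mu -> Q nu -> mu + nu != 0) -> x \in n -> y \in n' -> B x y = 0.
Proof.
move=> nP nQ PQ /nP xn /nQ yn.
elim: xn => [|c s z [mu Pmu smu] _ IH]; first exact: scl0 (Bl y).
rewrite Bl IH addr0; apply/eqP; rewrite mulf_eq0; apply/orP; right.
elim: yn => [|d r z' [nu Qnu rnu] _ /eqP IHr]; first by rewrite (scl0 (B_linear s)).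
rewrite (B_linear s) IHr addr0 mulf_eq0; apply/orP; right.
apply/negPn/negP => Bsr; have := PQ _ _ Pmu Qnu.
by rewrite (B_weight B_linear B_sym B_ginv smu rnu Bsr) eqxx.
Qed.

Lemma B_kp x y : theta x = x -> y \in p -> B x y = 0.
Proof.
rewrite pE => xk /eqP yp; have := B_thetainv x y; rewrite xk yp (sclN (B_linear x)).
by move=> /eqP; rewrite eq_sym -addr_eq0 -mulr2n mulrn_eq0 => /eqP.
Qed.

Variables np nm : {vspace L}.
Hypotheses (npP : graded pos np) (nmP : graded (fun mu => pos (- mu)) nm).
Let pp := (p :&: np)%VS.
Let pm := (p :&: nm)%VS.

Lemma pos_neq0 mu : pos mu -> mu != 0.
Proof.
move=> pmu; have := pos_sum (s := [:: mu]); rewrite big_seq1; apply => // nu.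
by rewrite inE => /eqP ->.
Qed.

Lemma pos_add mu nu : pos mu -> pos nu -> mu + nu != 0.
Proof.
move=> pmu pnu; have := pos_sum (s := [:: mu; nu]); rewrite big_cons big_seq1; apply => // x.
by rewrite !inE => /orP [] /eqP ->.
Qed.

Lemma a_weight0 x : x \in a -> x \in weight_space (0 : tdual t).
Proof.
move=> xa; apply/weight_spaceP => h.
by rewrite ta ?subvsP // zero_lfunE scale0r.
Qed.

Lemma pp_pp x y : x \in pp -> y \in pp -> B x y = 0.
Proof.
rewrite !memv_cap => /andP [_ xn] /andP [_ yn]; apply: graded_orth npP npP _ xn yn.
exact: pos_add.
Qed.

Lemma pm_pm x y : x \in pm -> y \in pm -> B x y = 0.
Proof.
rewrite !memv_cap => /andP [_ xn] /andP [_ yn]; apply: graded_orth nmP nmP _ xn yn.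
by move=> mu nu pmu pnu; rewrite -oppr_eq0 opprD; apply: pos_add.
Qed.

Let a_n P n x y : graded P n -> (forall mu, P mu -> mu != 0) -> x \in a -> y \in n -> B x y = 0.
Proof.
move=> nP P0 xa /nP; elim=> [|c s z [mu Pmu smu] _ IH]; first exact: scl0.
rewrite (B_linear x) IH addr0; have [->|Bxs] := eqVneq (B x s) 0; first by rewrite mulr0.
have := B_weight B_linear B_sym B_ginv (a_weight0 xa) smu Bxs; rewrite add0r => mu0.
by have := P0 _ Pmu; rewrite mu0 eqxx.
Qed.

Lemma a_pp x y : x \in a -> y \in pp -> B x y = 0.
Proof.
move=> xa; rewrite memv_cap => /andP [_]; apply: a_n npP _ xa; exact: pos_neq0.
Qed.

Lemma a_pm x y : x \in a -> y \in pm -> B x y = 0.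
Proof.
move=> xa; rewrite memv_cap => /andP [_]; apply: a_n nmP _ xa.
by move=> mu /pos_neq0; rewrite oppr_eq0.
Qed.

Lemma p_decomp x : x \in p -> exists f y e, [/\ f \in pm, y \in a, e \in pp & x = f + y + e].
Proof.
move=> xp.
have : lspan (fun y => y \in p /\ exists mu, y \in @weight_space _ _ t mu) x.
  by apply: (weight_span tt t_dg) => // h y ht; apply: p_stable; rewrite t_k.
elim=> [|c s z [sp [mu smu]] _ [f [y [e [fp ya ep ->]]]]].
  by exists 0, 0, 0; rewrite !mem0v !addr0.
have [->|s0] := eqVneq s 0.
  by exists f, y, e; rewrite scaler0 add0r.
have [mu0|mu0] := eqVneq mu 0.
  exists f, (c *: s + y), e; split=> //; last by rewrite !addrA (addrC f).
  by rewrite memvD // memvZ // p_weight0 // -mu0.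
have [pmu|pmu] := pos_total mu0 smu s0.
  exists f, y, (c *: s + e); split=> //; last by rewrite addrCA.
  rewrite memvD // memvZ // memv_cap sp; apply/npP/lspan_in; by exists mu.
exists (c *: s + f), y, e; split=> //; last by rewrite !addrA.
rewrite memvD // memvZ // memv_cap sp; apply/nmP/lspan_in; by exists mu.
Qed.

Let B_p x : x \in p -> (forall y, y \in p -> B x y = 0) -> x = 0.
Proof.
move=> xp x0; apply: B_nondeg => y; have [y1 [y2 [/(kP theta) y1k y2p ->]]] := kp_split theta_inv y.
by rewrite (sclD (B_linear x)) (x0 _ y2p) addr0 B_sym B_kp.
Qed.

(** p- is orthogonal to a, to itself and to k, so the form on it only sees p+. *)
Lemma pm_nondeg x : x \in pm -> (forall y, y \in pp -> B x y = 0) -> x = 0.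
Proof.
move=> xm x0; have := xm; rewrite memv_cap => /andP [xp _].
apply: B_p => // y /p_decomp [f [z [e [fm za ep ->]]]].
rewrite !(sclD (B_linear x)) (x0 e) // (pm_pm xm fm).
by rewrite B_sym a_pm ?addr0.
Qed.

Lemma pp_nondeg x : x \in pp -> (forall y, y \in pm -> B x y = 0) -> x = 0.
Proof.
move=> xm x0; have := xm; rewrite memv_cap => /andP [xp _].
apply: B_p => // y /p_decomp [f [z [e [fm za ep ->]]]].
rewrite !(sclD (B_linear x)) (x0 f) // (pp_pp xm ep).
by rewrite B_sym a_pp ?addr0.
Qed.

(** es is any basis of p+ by weight vectors and fs its dual basis in p-: it consists
    of weight vectors because the form is invariant.  The form separates a, p+ and
    p- from each other, so that the three bases together are free. *)
Lemma triangular_basis : exists m (es fs : seq L) (bs : seq (tdual t)),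
  [/\ size es = m /\ size fs = m,
   forall i, (i < m)%N -> [/\ es`_i \in weight_space bs`_i,
     fs`_i \in weight_space (- bs`_i) & pos bs`_i],
   forall i j, (i < m)%N -> (j < m)%N -> 2 * B es`_i fs`_j = (i == j)%:R,
   <<es>>%VS = pp /\ <<fs>>%VS = pm &
   basis_of p (fs ++ vbasis a ++ es)].
Proof.
have [es [ef eP eS]] := lspan_finite (fun y => y \in pp /\ exists2 mu, pos mu & y \in weight_space mu).
have esp : <<es>>%VS = pp.
  apply/eqP; rewrite eqEsubv; apply/andP; split; first by apply/span_subvP => y /eP [].
  apply/subvP => x /(graded_span npP); elim=> [|c s z /eS ss _ zs]; first exact: mem0v.
  by rewrite memvD ?memvZ.
pose m := size es.
have be i : (i < m)%N -> es`_i \in pp /\ exists2 mu, pos mu & es`_i \in weight_space mu.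
  by move=> im; apply: eP; rewrite mem_nth.
have /choice [bf bfP] : forall i, exists mu, (i < m)%N -> pos mu /\ es`_i \in weight_space mu.
  move=> i; case: (ltnP i m) => [im|_]; last by exists 0.
  by have [_ [mu pmu emu]] := be i im; exists mu.
pose bs := mkseq bf m.
have bsE i : (i < m)%N -> bs`_i = bf i by move=> im; rewrite nth_mkseq.
pose b (x : subvs_of pm) (y : subvs_of pp) := 2 * B (vsval x) (vsval y).
have blinl y : scalar (b^~ y).
  by move=> c u v; rewrite /b linearP /= Bl mulrDr mulrCA.
have blinr x : scalar (b x).
  by move=> c u v; rewrite /b linearP /= B_linear mulrDr mulrCA.
have two0 : (2 : C) != 0 by rewrite pnatr_eq0.
have bnd x : (forall y, b x y = 0) -> x = 0.
  move=> x0; apply: val_inj; apply: pm_nondeg (subvsP x) _ => y yp.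
  have /eqP := x0 (vsproj pp y); rewrite /b vsprojK // mulf_eq0 (negbTE two0) /=.
  by move=> /eqP.
have bnd' y : (forall x, b x y = 0) -> y = 0.
  move=> y0; apply: val_inj; apply: pp_nondeg (subvsP y) _ => x xp.
  have /eqP := y0 (vsproj pm x); rewrite /b vsprojK // mulf_eq0 (negbTE two0) /= B_sym.
  by move=> /eqP.
have dimmp : (\dim {:subvs_of pp} <= \dim {:subvs_of pm})%N.
  by apply: (nondeg_dim (b := fun y x => b x y)).
have dimpm : (\dim {:subvs_of pm} <= \dim {:subvs_of pp})%N.
  by apply: (nondeg_dim (b := b)).
have dimE : \dim pm = \dim pp.
  by move: dimmp dimpm; rewrite !dimvf /dim /= => h1 h2; apply/eqP; rewrite eqn_leq h1 h2.
have cE (e : L) : e \in pp -> e = \sum_(i < m) coord (in_tuple es) i e *: es`_i.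
  by rewrite -esp => /(@coord_span _ _ _ (in_tuple es)).
have /choice [ff ffP] : forall i : 'I_m, exists f, f \in pm /\
    forall e, e \in pp -> 2 * B f e = coord (in_tuple es) i e.
  move=> i; have [|f fP] := nondeg_repr (phi := fun y : subvs_of pp =>
      coord (in_tuple es) i (vsval y)) blinl blinr bnd dimmp.
    by move=> c u v; rewrite !linearP.
  exists (vsval f); split=> [|e ep]; first exact: subvsP.
  by have := fP (vsproj pp e); rewrite /b vsprojK.
pose fs := codom ff.
have sf : size fs = m by rewrite size_codom card_ord.
have fsE (i : 'I_m) : fs`_i = ff i.
  by rewrite (nth_map i) ?size_enum_ord // nth_ord_enum.
have dual i j : (i < m)%N -> (j < m)%N -> 2 * B es`_i fs`_j = (i == j)%:R.
  move=> im jm; rewrite B_sym (fsE (Ordinal jm)) (proj2 (ffP _)); last by have [] := be i im.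
  by rewrite (coord_free (X := in_tuple es) (Ordinal im) (Ordinal jm)).
have fpm j : (j < m)%N -> fs`_j \in pm.
  by move=> jm; rewrite (fsE (Ordinal jm)); have [] := ffP (Ordinal jm).
have ffree : free fs.
  apply: (dual_free (f := fun i : 'I_m => fun y => 2 * B es`_i y) sf) => [i c u v|i j].
    by rewrite B_linear mulrDr mulrCA.
  by rewrite dual.
have fsp : <<fs>>%VS = pm.
  apply/eqP; rewrite eqEdim; apply/andP; split.
    by apply/span_subvP => x /(nthP 0) [j jm <-]; apply: fpm; rewrite -sf.
  by rewrite dimE -esp (eqP (_ : \dim <<es>> == size es)) // (eqP (_ : \dim <<fs>> == size fs)) // sf.
exists m, es, fs, bs; split => //.
- move=> i im; rewrite bsE //; have [pb eb] := bfP i im; split => //.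
  apply/weight_spaceP => h; rewrite opp_lfunE scaleNr.
  have fi := fpm i im; set f := fs`_i in fi *.
  apply/eqP; rewrite -addr_eq0; apply/eqP; apply: pm_nondeg.
    rewrite memvD ?memvZ //; move: fi; rewrite !memv_cap => /andP [fp fn].
    by rewrite p_stable ?t_k ?subvsP //= (graded_stable nmP) // subvsP.
  move=> e ep; rewrite (cE _ ep) (scl_sum (B_linear _)) big1 // => j _.
  rewrite (sclZ (B_linear _)); apply/eqP; rewrite mulf_eq0; apply/orP; right.
  have /weight_spaceP ej : es`_j \in weight_space (bf j) := proj2 (bfP j (ltn_ord j)).
  rewrite (sclD (Bl _)) (sclZ (Bl _)) (B_lieC B_ginv) ej (sclZ (B_linear f)).
  rewrite addrC -mulrBl -(inj_eq (mulfI two0)) mulr0 mulrCA B_sym dual //.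
  have [ij|ij] := eqVneq (j : nat) i; last by rewrite mulr0.
  by rewrite ij subrr mul0r.
- have ap : forall x, x \in a -> x \in pp -> x = 0.
    move=> x xa xm; apply: pp_nondeg => // y; exact: a_pm.
  rewrite /basis_of !span_cat esp fsp (span_basis (vbasisP a)); apply/andP; split.
    rewrite eqEsubv !subv_add !capvSl a_sub /=.
    apply/subvP => x /p_decomp [f [y [e [fm ya ep ->]]]].
    rewrite -addrA; apply/memv_addP; exists f => //; exists (y + e) => //.
    by apply/memv_addP; exists y => //; exists e.
  rewrite !cat_free ffree ef (basis_free (vbasisP a)) /= !span_cat esp fsp (span_basis (vbasisP a)).
  apply/andP; split; apply/directv_addP/eqP; rewrite -subv0; apply/subvP => x; rewrite memv_cap memv0.
    by move=> /andP [xa xp]; apply/eqP/ap.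
  move=> /andP [xm /memv_addP [y ya [e ep xE]]]; apply/eqP/pm_nondeg => // z zp.
  by rewrite xE (sclD (Bl z)) a_pp // pp_pp // addr0.
Qed.

End Triangular.

(** * Clifford algebras and their matrix models *)

Section QuotientHom.
Variables (K : fieldType) (A B : algType K) (S : A -> Prop) (F : A -> B).
Hypotheses (Flin : linear F) (Fmon : monoid_morphism F) (FS : forall x, S x -> F x = 0).

Lemma quotient_hom : exists phi : alg_quot S -> B,
  [/\ linear phi, monoid_morphism phi & forall x, phi (quot_pi S x) = F x].
Proof.
have FI x : ideal_gen S x -> F x = 0.
  elim=> {x} [x /FS //||x y _ Fx _ Fy|a x _ Fx|a x _ Fx].
  - exact: lin0.
  - by rewrite (linD Flin) Fx Fy addr0.
  - by rewrite Fmon.2 Fx mulr0.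
  - by rewrite Fmon.2 Fx mul0r.
pose phi (x : alg_quot S) := F (repr x).
have phiE x : phi (quot_pi S x) = F x.
  apply/eqP; rewrite -subr_eq0 -(linB Flin); apply/eqP/FI; exact: ideal_gen_repr.
exists phi; split => //.
  move=> c x y; rewrite -[x]quot_reprK -[y]quot_reprK -quot_piZ -quot_piD !phiE.
  exact: Flin.
split; first by rewrite -Fmon.1 -phiE.
by move=> x y; rewrite -[x]quot_reprK -[y]quot_reprK -quot_piM !phiE Fmon.2.
Qed.

End QuotientHom.

Section Clifford.
Variables (K : fieldType) (V : lmodType K) (b : V -> V -> K).
Local Notation A := (clifford b).
Local Notation gen := (clifford_gen b).

Lemma clscaleAl (c : K) (x y : A) : c *: (x * y) = (c *: x) * y.
Proof. exact: (@quot_scaleAl K _ (clifford_rel b)). Qed.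

Lemma clscaleAr (c : K) (x y : A) : c *: (x * y) = x * (c *: y).
Proof. exact: (@quot_scaleAr K _ (clifford_rel b)). Qed.

Lemma mull_linear (x : A) : linear (fun y : A => x * y).
Proof. by move=> c y z; rewrite mulrDr clscaleAr. Qed.

Lemma clifford_words (x : A) :
  lspan (fun y : A => exists s : seq V, y = \prod_(v <- s) gen v) x.
Proof.
rewrite -[x]quot_reprK; move: (repr x) => {}x.
rewrite -[x]quot_reprK; move: (repr x) => {}x.
elim/free_alg_ind: x => [|c m x IH]; first by rewrite !raddf0; exact: lspan0.
rewrite quot_piD quot_piZ quot_piD quot_piZ; apply: lspanS => //.
exists m; rewrite free_wordE rmorph_prod rmorph_prod.
by apply: eq_bigr.
Qed.

Lemma clifford_ind (P : A -> Prop) : P 0 -> (forall c x y, P x -> P y -> P (c *: x + y)) ->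
  P 1 -> (forall v x, P x -> P (gen v * x)) -> forall x, P x.
Proof.
move=> P0 PD P1 PM x; elim: (clifford_words x) => // c _ z [s ->] _; apply: PD.
by elim: s => [|v s IH]; rewrite ?big_nil // big_cons; apply: PM.
Qed.

Definition monomial (s : seq V) (x : A) : Prop :=
  exists2 m : bitseq, size m = size s & x = \prod_(v <- mask m s) gen v.

Lemma monomial_cons v s x :
  monomial (v :: s) x <-> exists2 y, monomial s y & x = y \/ x = gen v * y.
Proof.
split=> [[[|bt m] //= [sm] ->]|[y [m sm ->] [->|->]]].
- exists (\prod_(u <- mask m s) gen u); first by exists m.
  by case: bt; rewrite ?big_cons; [right|left].
- by exists (false :: m); rewrite /= ?sm.
- by exists (true :: m); rewrite /= ?sm ?big_cons.
Qed.

Hypothesis two_neq0 : (2 : K) != 0.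

Lemma clifford_gen_sq v : gen v * gen v = b v v *: (1 : A).
Proof.
apply: (scalerI two_neq0); rewrite scalerA -clifford_genM.
by rewrite -mulr2n scaler_nat.
Qed.

(** By the Clifford relations, moving w to its place past the generators of an
    ordered monomial only produces further ordered monomials. *)
Lemma monomial_mul (s : seq V) w (x : A) : w \in s ->
  lspan (monomial s) x -> lspan (monomial s) (gen w * x).
Proof.
elim: s x => // v s IH x ws.
apply: lspan_map => [|_ /monomial_cons [y ys [->|->]]]; first exact: mull_linear.
  move: ws; rewrite inE => /orP [/eqP ->|ws].
    by apply: lspan_in; apply/monomial_cons; exists y => //; right.
  apply: lspan_mono (IH y ws (lspan_in ys)) => z zs.
  by apply/monomial_cons; exists z => //; left.
have sub z : monomial s z -> monomial (v :: s) z.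
  by move=> zs; apply/monomial_cons; exists z => //; left.
move: ws; rewrite inE => /orP [/eqP ->|ws].
  rewrite mulrA clifford_gen_sq -clscaleAl mul1r; apply/lspanZ/lspan_in; exact: sub.
rewrite mulrA; have -> : gen w * gen v = (2 * b w v) *: (1 : A) - gen v * gen w.
  by rewrite -clifford_genM addrK.
rewrite mulrDl -clscaleAl mul1r mulNr -mulrA -scaleN1r; apply: lspanD.
  by apply/lspanZ/lspan_in/sub.
apply: lspanZ; apply: lspan_map (IH y ws (lspan_in ys)); first exact: mull_linear.
by move=> z zs; apply: lspan_in; apply/monomial_cons; exists z => //; right.
Qed.

Lemma clifford_monomials (s : seq V) : (forall v, lspan (fun u => u \in s) v) ->
  forall x : A, lspan (monomial s) x.
Proof.
move=> sV; elim/clifford_ind => [|c x y IHx IHy||v x IHx].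
- exact: lspan0.
- by apply: lspanD => //; apply: lspanZ.
- apply: lspan_in; exists (nseq (size s) false); first by rewrite size_nseq.
  by rewrite mask_false big_nil.
- elim: (sV v) => [|c u w us _ IH].
    by rewrite (lin0 (@clifford_gen_linear K V b)) mul0r; exact: lspan0.
  rewrite clifford_gen_linear mulrDl -clscaleAl; apply: lspanD => //.
  by apply: lspanZ; apply: monomial_mul.
Qed.

End Clifford.

(** The universal property: f extends to the free algebra, and the extension kills
    the two sets of relations in turn. *)
Lemma clifford_lift (K : fieldType) (V : lmodType K) (b : V -> V -> K) (B : algType K)
    (f : V -> B) : linear f ->
  (forall u v, f u * f v + f v * f u = (2 * b u v)%:A) ->
  exists phi : clifford b -> B, [/\ linear phi, monoid_morphism phi &
    forall v, phi (clifford_gen b v) = f v].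
Proof.
move=> flin fM.
pose F : free_alg V -> B := free_ext (fun s => \prod_(v <- s) f v).
have Flin : linear F by exact: free_ext_linear.
have Fgen v : F (free_gen v) = f v by rewrite /F free_extU fmU big_seq1.
have Fmon : monoid_morphism F.
  split=> [|x y]; first by rewrite /F free_extU fm1 big_nil.
  apply: (span_monoid (@free_alg_ind K V)) Flin _ x y => m n.
  by rewrite malgUM /F !free_extU fmM big_cat.
have [|T [Tlin Tmon TE]] := @quotient_hom _ _ _ (@linear_rel K V) F Flin Fmon.
  move=> _ [c [u [v ->]]]; rewrite (linB Flin) Flin !Fgen flin.
  exact: subrr.
have Tgen v : T (tensor_gen v) = f v by rewrite TE.
have [|phi [plin pmon pE]] := @quotient_hom _ _ _ (clifford_rel b) T Tlin Tmon.
  move=> _ [u [v ->]]; rewrite (linB Tlin) (linD Tlin) (linZ Tlin) Tmon.1 !Tmon.2 !Tgen fM.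
  exact: subrr.
by exists phi; split=> // v; rewrite pE.
Qed.

(** The masks that index ordered monomials in a list of length n. *)
Fixpoint bits n : seq bitseq :=
  if n is n'.+1 then map (cons false) (bits n') ++ map (cons true) (bits n')
  else [:: [::]].

Lemma mem_bits n m : (m \in bits n) = (size m == n).
Proof.
elim: n m => [|n IH] [|c m] //=.
  by rewrite mem_cat; apply/negP => /orP [] /mapP [].
rewrite mem_cat eqSS -IH; apply/orP/idP => [[] /mapP [m' m'n [_ ->]] //|mn].
by case: c; [right|left]; rewrite map_f.
Qed.

Lemma bits_uniq n : uniq (bits n).
Proof.
elim: n => // n IH /=; rewrite cat_uniq !map_inj_uniq ?IH ?andbT /=; try by move=> ? ? [].
by apply/hasPn => _ /mapP [m _ ->]; apply/negP => /mapP [].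
Qed.

Lemma lspan_bits (K : fieldType) (V : lmodType K) n (F : bitseq -> V) x :
  lspan (fun y => exists2 m, size m = n & y = F m) x ->
  exists c : bitseq -> K, x = \sum_(m <- bits n) c m *: F m.
Proof.
elim=> [|c _ y [m sm ->] _ [c' ->]].
  by exists (fun _ => 0); rewrite big1 // => i _; rewrite scale0r.
exists (fun m' => c * (m' == m)%:R + c' m').
under [RHS]eq_bigr do rewrite scalerDl; rewrite big_split /=; congr (_ + _).
have mb : m \in bits n by rewrite mem_bits sm.
rewrite (bigD1_seq m) ?bits_uniq //= eqxx mulr1 [X in _ + X]big1 ?addr0 // => i /negbTE ->.
by rewrite mulr0 scale0r.
Qed.

Lemma free_mapP (K : fieldType) (V : vectType K) (I : eqType) (r : seq I) (F : I -> V) :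
  uniq r -> free [seq F i | i <- r] <->
  (forall c : I -> K, \sum_(i <- r) c i *: F i = 0 -> forall i, i \in r -> c i = 0).
Proof.
move=> ur; set X := [seq _ | _ <- _].
have sX : size X = size r by rewrite size_map.
have -> : free X = free (tcast sX (in_tuple X)) by rewrite val_tcast.
split=> [/freeP fX c c0 i ir|H].
  case: r ur @X sX fX c0 ir => // i0 r ur X sX fX c0 ir.
  have := fX (fun j => c (nth i0 (i0 :: r) j)); rewrite val_tcast => H.
  have il : (index i (i0 :: r) < size (i0 :: r))%N by rewrite index_mem.
  have <- := H _ (Ordinal il); first by rewrite /= -/(nth i0 (i0 :: r) _) nth_index.
  rewrite -[RHS]c0 (big_nth i0) big_mkord; apply: eq_bigr => j _.
  by rewrite (nth_map i0).
apply/freeP => k; rewrite val_tcast => k0 j.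
case: r ur @X sX H k k0 j => [|i0 r] ur X sX H k k0 j; first by case: j.
pose c i := if insub (index i (i0 :: r)) is Some j then k j else 0.
have cE (l : 'I_(size (i0 :: r))) : c (nth i0 (i0 :: r) l) = k l.
  by rewrite /c index_uniq // valK.
rewrite -cE; apply: H; last exact: mem_nth.
rewrite -[RHS]k0 (big_nth i0) big_mkord; apply: eq_bigr => l _.
by rewrite cE (nth_map i0).
Qed.

Definition adj (C : numClosedFieldType) n (M : 'M[C]_n) : 'M[C]_n :=
  map_mx Num.conj (M^T).

(** By doubling the size of the matrices: the next involution is [0 1; 1 0], and
    the given involutions E become diag(E, -E).  The independence of the monomials
    is read off from the left blocks. *)
Lemma involutions_exist (C : numClosedFieldType) n : exists d (Es : seq 'M[C]_d.+1), [/\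
  size Es = n, (forall E, E \in Es -> adj E = E /\ E * E = 1),
  (forall i j, (i < n)%N -> (j < n)%N -> i != j -> Es`_i * Es`_j + Es`_j * Es`_i = 0) &
  free [seq \prod_(E <- mask m Es) E | m <- bits n]].
Proof.
elim: n => [|n [d [Es [sE Ead Eanti Efree]]]].
  exists 0%N, [::]; split => //; rewrite /= big_nil seq1_free; exact: oner_neq0.
pose e := (d + d.+1)%N.
(* the block lemmas at the size at which 'M_e.+1 is read as a matrix of blocks *)
have mulE := @mulmx_block C d.+1 d.+1 d.+1 d.+1 d.+1 d.+1.
have addE := @add_block_mx C d.+1 d.+1 d.+1 d.+1.
have scaleE := @scale_block_mx C d.+1 d.+1 d.+1 d.+1.
have trE := @tr_block_mx C d.+1 d.+1 d.+1 d.+1.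
have mapE := @map_block_mx C C Num.conj d.+1 d.+1 d.+1 d.+1.
pose D (E : 'M[C]_d.+1) : 'M[C]_e.+1 := block_mx E 0 0 (- E) : 'M_(d.+1 + d.+1).
pose J : 'M[C]_e.+1 := block_mx 0 1%:M 1%:M 0 : 'M_(d.+1 + d.+1).
have DM E F : D E * D F = block_mx (E * F) 0 0 (E * F) :> 'M_(d.+1 + d.+1).
  by rewrite -!mulmxE mulE !mulmx0 !mul0mx !addr0 !add0r mulNmx mulmxN opprK.
have JD E : J * D E = block_mx 0 (- E) E 0 :> 'M_(d.+1 + d.+1).
  by rewrite -!mulmxE mulE !mulmx0 !mul0mx !mul1mx !addr0 !add0r.
have DJ E : D E * J = block_mx 0 E (- E) 0 :> 'M_(d.+1 + d.+1).
  by rewrite -!mulmxE mulE !mulmx0 !mul0mx !mulmx1 !addr0 !add0r.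
exists e, (J :: map D Es); split.
- by rewrite /= size_map sE.
- have oneE : (1 : 'M[C]_e.+1) = block_mx 1%:M 0 0 1%:M :> 'M_(d.+1 + d.+1).
    exact: (scalar_mx_block d.+1 d.+1 1).
  move=> E; rewrite inE => /orP [/eqP ->|/mapP [F /Ead [Fa F2] ->]]; split.
  + by rewrite /adj trE mapE
      !trmx0 !trmx1 !map_mx0 !map_mx1.
  + by rewrite -!mulmxE mulE !mulmx0 !mul0mx !mul1mx
      !addr0 !add0r oneE.
  + rewrite /adj trE mapE.
    by rewrite !trmx0 !map_mx0 -[map_mx _ F^T]/(adj F) Fa linearN /= map_mxN -[map_mx _ F^T]/(adj F) Fa.
  + by rewrite DM F2 oneE.
- have JDa i : (i < n)%N -> J * D Es`_i + D Es`_i * J = 0.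
    move=> _; rewrite JD DJ addE !addr0 addNr subrr.
    exact: (@block_mx0 _ d.+1 d.+1 d.+1 d.+1).
  move=> [|i] [|j] //= li lj ij.
  + by rewrite (nth_map 0) ?sE // JDa.
  + by rewrite (nth_map 0) ?sE // addrC JDa.
  + rewrite !(nth_map 0) ?sE // !DM addE !addr0 Eanti //.
    exact: (@block_mx0 _ d.+1 d.+1 d.+1 d.+1).
- pose P m := \prod_(E <- mask m Es) E.
  have /choice [Q QE] : forall m, exists Q, \prod_(E <- mask m (map D Es)) E =
      block_mx (P m) 0 0 Q :> 'M_(d.+1 + d.+1).
    move=> m; rewrite /P -map_mask big_map.
    elim: (mask m Es) => [|E s [Q QE]].
      exists 1; rewrite !big_nil; exact: (scalar_mx_block d.+1 d.+1 1).
    exists (- E * Q); rewrite !big_cons QE -!mulmxE mulE.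
    by rewrite !mulmx0 !mul0mx !addr0 !add0r.
  apply/free_mapP; first exact: bits_uniq.
  move=> c; rewrite big_cat !big_map /=.
  have F1 m : c (false :: m) *: \prod_(E <- mask (false :: m) (J :: map D Es)) E =
     block_mx (c (false :: m) *: P m) 0 0 (c (false :: m) *: Q m) :> 'M_(d.+1 + d.+1).
    by rewrite /= QE scaleE !scaler0.
  have F2 m : c (true :: m) *: \prod_(E <- mask (true :: m) (J :: map D Es)) E =
     block_mx 0 (c (true :: m) *: Q m) (c (true :: m) *: P m) 0 :> 'M_(d.+1 + d.+1).
    rewrite /= big_cons QE -mulmxE mulE.
    by rewrite !mulmx0 !mul0mx !mul1mx !addr0 !add0r scaleE !scaler0.
  under eq_bigr do rewrite F1; under [X in _ + X]eq_bigr do rewrite F2.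
  move=> c0.
  have u0 : \sum_(m <- bits n) c (false :: m) *: P m = 0.
    pose ul (M : 'M[C]_e.+1) : 'M[C]_d.+1 := @ulsubmx _ d.+1 d.+1 d.+1 d.+1 M.
    have ulin : linear ul by move=> x M N; apply/matrixP => i j; rewrite !mxE.
    have := congr1 ul c0; rewrite (linD ulin) !(lin_sum ulin) (lin0 ulin) /ul.
    under eq_bigr do rewrite block_mxKul; under [X in _ + X]eq_bigr do rewrite block_mxKul.
    by rewrite [X in _ + X]big1 ?addr0.
  have d0 : \sum_(m <- bits n) c (true :: m) *: P m = 0.
    pose dl (M : 'M[C]_e.+1) : 'M[C]_d.+1 := @dlsubmx _ d.+1 d.+1 d.+1 d.+1 M.
    have dlin : linear dl by move=> x M N; apply/matrixP => i j; rewrite !mxE.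
    have := congr1 dl c0; rewrite (linD dlin) !(lin_sum dlin) (lin0 dlin) /dl.
    under eq_bigr do rewrite block_mxKdl; under [X in _ + X]eq_bigr do rewrite block_mxKdl.
    by rewrite [X in X + _]big1 ?add0r.
  have fP := (free_mapP P (bits_uniq n)).1 Efree.
  by move=> i; rewrite mem_cat => /orP [] /mapP [m mn ->];
     [apply: (fP (fun m => c (false :: m))) | apply: (fP (fun m => c (true :: m)))].
Qed.

Section Model.
Variables (C : numClosedFieldType) (V : vectType C) (b : V -> V -> C).
Hypotheses (b_sym : forall u v, b u v = b v u) (b_lin : forall u, scalar (b u)).

(** The orthonormal basis e goes to hermitian involutions.  Independence of its
    monomials makes the model faithful; the monomials of any other basis span the
    same space and are equally many, hence independent as well. *)
Lemma clifford_model n (e : n.-tuple V) : basis_of fullv e ->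
  (forall i j : 'I_n, b e`_i e`_j = (i == j)%:R) ->
  exists d (phi : clifford b -> 'M[C]_d.+1), [/\ linear phi, monoid_morphism phi,
    injective phi, forall i : 'I_n, adj (phi (clifford_gen b e`_i)) = phi (clifford_gen b e`_i) &
    forall s : seq V, <<s>>%VS = fullv -> size s = n ->
      free [seq phi (\prod_(v <- mask m s) clifford_gen b v) | m <- bits n]].
Proof.
move=> be orth; have [d [Es [sE Ead Eanti Efree]]] := involutions_exist C n.
pose f (v : V) := \sum_(i < n) coord e i v *: Es`_i.
have flin : linear f.
  move=> c u v; rewrite /f scaler_sumr -big_split; apply: eq_bigr => i _ /=.
  by rewrite linearP /= scalerDl scalerA.
have bE u v : b u v = \sum_(i < n) coord e i u * coord e i v.
  have cV w : w = \sum_(i < n) coord e i w *: e`_i by apply: coord_basis be _; rewrite memvf.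
  have b_linl w : scalar (b^~ w) by move=> c x y /=; rewrite ![b _ w]b_sym b_lin.
  rewrite {1}[u]cV (scl_sum (b_linl v)); apply: eq_bigr => i _.
  rewrite (sclZ (b_linl v)); congr (_ * _); rewrite {1}[v]cV (scl_sum (b_lin _)).
  rewrite (bigD1 i) //= (sclZ (b_lin _)) orth eqxx mulr1 big1 ?addr0 // => j ji.
  by rewrite (sclZ (b_lin _)) orth eq_sym (negbTE ji) mulr0.
have fM u v : f u * f v + f v * f u = (2 * b u v)%:A.
  rewrite /f !mulr_suml.
  under eq_bigr do rewrite mulr_sumr; under [X in _ + X]eq_bigr do rewrite mulr_sumr.
  rewrite [X in _ + X]exchange_big -big_split /= bE mulr_sumr scaler_suml.
  apply: eq_bigr => i _; rewrite -big_split /= (bigD1 i) //= [X in _ + X]big1 ?addr0.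
    have [_ E2] : adj Es`_i = Es`_i /\ Es`_i * Es`_i = 1 by apply: Ead; rewrite mem_nth ?sE.
    rewrite -!scalerAl -!scalerAr E2 !scalerA [coord e i v * _]mulrC -scalerDl.
    by rewrite mulr_natl mulr2n.
  move=> j ji; rewrite -!scalerAl -!scalerAr !scalerA [coord e j v * _]mulrC -scalerDr.
  by rewrite Eanti ?scaler0 // eq_sym.
have [phi [plin pmon pE]] := clifford_lift flin fM.
have fe (i : 'I_n) : f e`_i = Es`_i.
  rewrite /f (bigD1 i) //= coord_free ?(basis_free be) // eqxx scale1r big1 ?addr0 // => j ji.
  by rewrite coord_free ?(basis_free be) // eq_sym (negbTE ji) scale0r.
have pprod (r : seq V) : phi (\prod_(v <- r) clifford_gen b v) = \prod_(v <- r) f v.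
  elim: r => [|v r IH]; first by rewrite !big_nil pmon.1.
  by rewrite !big_cons pmon.2 pE IH.
have emap : map f e = Es.
  apply: (@eq_from_nth _ 0); first by rewrite size_map size_tuple sE.
  move=> i; rewrite size_map size_tuple => li; rewrite (nth_map 0) ?size_tuple //.
  exact: (fe (Ordinal li)).
have freeE : free [seq phi (\prod_(v <- mask m e) clifford_gen b v) | m <- bits n].
  congr free : Efree; apply: eq_map => m; rewrite pprod.
  by rewrite -emap -map_mask big_map.
have two0 : (2 : C) != 0 by rewrite pnatr_eq0.
have mons (s : seq V) : <<s>>%VS = fullv -> forall x, lspan (monomial (b := b) s) x.
  move=> sV; apply: clifford_monomials => // v.
  by apply: span_lspan; rewrite sV memvf.
exists d, phi; split => //.
- move=> x y xy; apply/eqP; rewrite -subr_eq0.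
  have p0 : phi (x - y) = 0 by rewrite (linB plin) xy subrr.
  have [c xE] := lspan_bits (mons e (span_basis be) (x - y)).
  rewrite size_tuple in xE; move: p0; rewrite {1}xE (lin_sum plin).
  under eq_bigr do rewrite (linZ plin).
  move=> /((free_mapP _ (bits_uniq n)).1 freeE c) c0.
  by rewrite xE big_seq big1 // => m /c0 ->; rewrite scale0r.
- by move=> i; rewrite pE fe; have [] : adj Es`_i = Es`_i /\ Es`_i * Es`_i = 1 by apply: Ead; rewrite mem_nth ?sE.
- move=> s sV ss; set X := [seq _ | _ <- _].
  have sX : size X = size (bits n) by rewrite size_map.
  rewrite /free sX eqn_leq -{1}sX dim_span /=.
  move: freeE; rewrite /free size_map => /eqP <-; apply: dimvS.
  apply/span_subvP => _ /mapP [m _ ->].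
  have [c ->] := lspan_bits (mons s sV (\prod_(v <- mask m e) clifford_gen b v)).
  rewrite (lin_sum plin) ss big_seq; apply: memv_suml => m' mb; rewrite (linZ plin).
  by apply/memvZ/memv_span/map_f.
Qed.

End Model.

(** * The Clifford algebras of subspaces *)

Section NonzeroClifford.
Variables (K : fieldType) (V : lmodType K) (b : V -> V -> K).
(** That 1 != 0 in a Clifford algebra is known from a matrix model only, which has to
    be available before the algebra structure can be declared. *)
Definition nzclifford of (1 : clifford b) != 0 := clifford b.
Variable ne : (1 : clifford b) != 0.
HB.instance Definition _ := GRing.PzRing.on (nzclifford ne).
HB.instance Definition _ := GRing.Lmodule.on (nzclifford ne).
HB.instance Definition _ := GRing.PzSemiRing_isNonZero.Build (nzclifford ne) ne.
HB.instance Definition _ := GRing.Lmodule_isLalgebra.Build K (nzclifford ne)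
  (@clscaleAl K V b).
HB.instance Definition _ := GRing.Lalgebra_isAlgebra.Build K (nzclifford ne)
  (@clscaleAr K V b).
End NonzeroClifford.

Section CliffordOfSubspaces.
Variables (C : numFieldType) (L : lieAlgType C) (B : L -> L -> C).
Implicit Types U : {vspace L}.

Definition cl_gen U (x : L) : Cl B U := Cl_gen B (vsproj U x).

Lemma cl_gen_val U (v : subvs_of U) : Cl_gen B v = cl_gen U (vsval v).
Proof. by rewrite /cl_gen vsvalK. Qed.

Lemma cl_gen_linear U : linear (cl_gen U).
Proof. by move=> c x y; rewrite /cl_gen linearP; exact: clifford_gen_linear. Qed.

Lemma cl_gen_anti U x y : x \in U -> y \in U ->
  cl_gen U x * cl_gen U y + cl_gen U y * cl_gen U x = (2 * B x y) *: (1 : Cl B U).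
Proof.
move=> xU yU; have := clifford_genM (@form_on _ _ B U) (vsproj U x) (vsproj U y).
by rewrite /form_on !vsprojK.
Qed.

Lemma Cl_inclP U U' : (U <= U')%VS -> [/\ linear (@Cl_incl C L B U U'),
  monoid_morphism (@Cl_incl C L B U U') &
  forall x, x \in U -> @Cl_incl C L B U U' (cl_gen U x) = cl_gen U' x].
Proof.
move=> sUU'; have [||ilin imon igen] := @clifford_map_hom C _ _ (@form_on C L B U)
  (@form_on C L B U') (fun v => vsproj U' (vsval v)).
- by move=> c u v; rewrite !linearP.
- by move=> u v; rewrite /form_on !vsprojK // (subvP sUU') ?subvsP.
split=> // x xU; apply: etrans (igen _) _.
by rewrite vsprojK.
Qed.

Lemma Cl_adP U X : (forall x y z, B (lie x y) z + B y (lie x z) = 0) ->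
  (forall y, y \in U -> lie X y \in U) ->
  [/\ linear (@Cl_ad C L B U X), leibniz (@Cl_ad C L B U X) &
  forall v, v \in U -> Cl_ad X (cl_gen U v) = cl_gen U (lie X v)].
Proof.
move=> B_ginv XU.
have [|u v|Dlin Dlei Dgen] := @clifford_der_der C _ (@form_on _ _ B U)
  (fun v => vsproj U (lie X (vsval v))).
- by move=> c u v; rewrite !linearP /= lie_linearr linearP.
- by rewrite /form_on !vsprojK ?XU ?subvsP // B_ginv.
by split => // v vU; apply: etrans (Dgen _) _; rewrite vsprojK.
Qed.

Lemma span_vsproj U (s : seq L) : <<s>>%VS = U -> <<map (vsproj U) s>>%VS = fullv.
Proof.
move=> sU; apply/eqP; rewrite eqEsubv subvf; apply/subvP => v _; rewrite -[v]vsvalK.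
have : vsval v \in <<s>>%VS by rewrite sU subvsP.
move=> /span_lspan; elim=> [|c w y ws _ IH]; first by rewrite linear0 mem0v.
by rewrite linearP memvD // memvZ // memv_span // map_f.
Qed.

Lemma monomials_vsproj U (s : seq L) : <<s>>%VS = U ->
  forall x : Cl B U, lspan (fun y => exists2 mk,
    size mk = size s & y = \prod_(x <- mask mk s) cl_gen U x) x.
Proof.
move=> sp x; have two0 : (2 : C) != 0 by rewrite pnatr_eq0.
have sV (v : subvs_of U) : lspan (fun u => u \in map (vsproj U) s) v.
  by apply: span_lspan; rewrite span_vsproj ?memvf.
apply: lspan_mono (clifford_monomials two0 sV x) => y [mk].
by rewrite size_map => smk ->; exists mk => //; rewrite -map_mask big_map.
Qed.

Lemma hc_kernelZ U pm pp c (x : Cl B U) : hc_kernel pm pp x -> hc_kernel pm pp (c *: x).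
Proof.
elim=> [|y z _ IHy _ IHz|y z yp|y z yp].
- by rewrite scaler0; exact: hc_kernel0.
- by rewrite scalerDr; exact: hc_kernelD.
- by rewrite clscaleAr; exact: hc_kernel_minus.
- by rewrite clscaleAl; exact: hc_kernel_plus.
Qed.

Lemma hc_kernelP U pm pp : (pp <= U)%VS -> (pm <= U)%VS ->
  forall x : Cl B U, hc_kernel pm pp x <-> lspan (fun z : Cl B U =>
  (exists2 f, f \in pm & exists b, z = cl_gen U f * b) \/
  (exists2 e, e \in pp & exists b, z = b * cl_gen U e)) x.
Proof.
move=> pp_U pm_U x; split.
  elim=> [|y z _ IHy _ IHz|y z yp|y z yp].
  - exact: lspan0.
  - exact: lspanD.
  - by apply: lspan_in; left; exists (vsval y) => //; exists z; rewrite cl_gen_val.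
  - by apply: lspan_in; right; exists (vsval z) => //; exists y; rewrite cl_gen_val.
elim=> [|c s y Ss _ IH]; first exact: hc_kernel0.
apply: hc_kernelD => //; apply: hc_kernelZ; case: Ss => -[f fp [b ->]].
  by apply: hc_kernel_minus; rewrite vsprojK // (subvP pm_U).
by apply: hc_kernel_plus; rewrite vsprojK // (subvP pp_U).
Qed.

End CliffordOfSubspaces.

(** * Averaging over a *-closed matrix algebra *)

Section Star.
Variables (C : numClosedFieldType) (d : nat).
Local Notation M := 'M[C]_d.+1.
Implicit Types x y z : M.

Lemma adjD x y : adj (x + y) = adj x + adj y.
Proof. by rewrite /adj linearD /= map_mxD. Qed.

Lemma adjZ c x : adj (c *: x) = c^* *: adj x.
Proof. by rewrite /adj linearZ /= map_mxZ. Qed.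

Lemma adjM x y : adj (x * y) = adj y * adj x.
Proof. by rewrite /adj -!mulmxE trmx_mul map_mxM. Qed.

Lemma adj1 : adj 1 = 1 :> M.
Proof. by rewrite /adj trmx1 map_mx1. Qed.

Lemma adj0 : adj 0 = 0 :> M.
Proof. by rewrite /adj trmx0 map_mx0. Qed.

Lemma adjK x : adj (adj x) = x.
Proof. by apply/matrixP => i j; rewrite !mxE conjCK. Qed.

Lemma trM x y : \tr (x * y) = \tr (y * x).
Proof. exact: mxtrace_mulC. Qed.

Lemma tr_linear x : scalar (fun y : M => \tr (x * y)).
Proof. by move=> c y z; rewrite mulrDr -scalerAr linearP. Qed.

Lemma tr_adj x : \tr (adj x * x) = \sum_i \sum_j `|x j i| ^+ 2.
Proof.
apply: eq_bigr => i _; rewrite -mulmxE mxE; apply: eq_bigr => j _.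
by rewrite !mxE normCK mulrC.
Qed.

Lemma tr_adj_gt0 x : x != 0 -> 0 < \tr (adj x * x).
Proof.
move=> x0; rewrite tr_adj lt_neqAle eq_sym; apply/andP; split; last first.
  by apply: sumr_ge0 => i _; apply: sumr_ge0 => j _; rewrite exprn_ge0.
apply: contra x0 => s0; apply/eqP/matrixP => j i; rewrite mxE.
have ge0 i' : true -> 0 <= \sum_j `|x j i'| ^+ 2.
  by move=> _; apply: sumr_ge0 => j' _; rewrite exprn_ge0.
have := s0; rewrite psumr_eq0 // => /allP /(_ i (mem_index_enum _)) /=.
rewrite psumr_eq0; last by move=> *; rewrite exprn_ge0.
by move=> /allP /(_ j (mem_index_enum _)) /=; rewrite expf_eq0 normr_eq0 => /eqP.
Qed.

Section Average.
Variable G : {vspace M}.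
Hypotheses (G1 : 1 \in G) (GM : forall x y, x \in G -> y \in G -> x * y \in G).
Hypothesis Gadj : forall x, x \in G -> adj x \in G.

(** The trace of x^* x is positive and x^* lies in G. *)
Lemma tr_nondeg x : x \in G -> (forall g, g \in G -> \tr (g * x) = 0) -> x = 0.
Proof.
move=> xG x0; apply: contrapT => /eqP /tr_adj_gt0.
by rewrite x0 ?ltxx // Gadj.
Qed.

Local Notation n := (\dim G).
Local Notation X i := ((vbasis G)`_i).

(** The Gram matrix of the trace form in a basis of G is invertible. *)
Lemma dual_basis : exists X' : 'I_n -> M, [/\ forall i, X' i \in G,
  forall x, x \in G -> x = \sum_(i < n) \tr (x * X' i) *: X i &
  forall x, x \in G -> x = \sum_(i < n) \tr (x * X i) *: X' i].
Proof.
have bG := vbasisP G; have XG i : (i < n)%N -> X i \in G.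
  by move=> li; apply: vbasis_mem; rewrite mem_nth // size_tuple.
pose Gr : 'M[C]_n := \matrix_(i, j) \tr (X i * X j).
have Gru : Gr \in unitmx.
  rewrite -row_free_unit -kermx_eq0; apply/eqP/row_matrixP => i; rewrite row0.
  set r := row i _; have rG : r *m Gr = 0.
    by apply/sub_kermxP; rewrite row_sub.
  have x0 : \sum_(j < n) r 0 j *: X j = 0.
    apply: tr_nondeg.
      by apply: memv_suml => j _; rewrite memvZ // XG.
    move=> g gG; rewrite (coord_vbasis gG) trM (scl_sum (tr_linear _)) big1 // => j _.
    rewrite (sclZ (tr_linear _)); have := congr1 (fun v : 'rV_n => v 0 j) rG.
    rewrite !mxE => rG0; rewrite trM (scl_sum (tr_linear _)).
    rewrite -[RHS](mulr0 (coord (vbasis G) j g)) -[Y in _ = _ * Y]rG0; congr (_ * _).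
    by apply: eq_bigr => k _; rewrite (sclZ (tr_linear _)) [Gr _ _]mxE trM.
  have /freeP fG := basis_free bG.
  by apply/rowP => j; rewrite [RHS]mxE; exact: (fG (fun j => r 0 j) x0 j).
pose X' (i : 'I_n) := \sum_(j < n) invmx Gr i j *: X j.
have X'G i : X' i \in G by apply: memv_suml => j _; rewrite memvZ // XG.
have dual (i k : 'I_n) : \tr (X' i * X k) = (i == k)%:R.
  have := congr1 (fun A : 'M_n => A i k) (mulVmx Gru); rewrite !mxE => <-.
  rewrite trM (scl_sum (tr_linear _)); apply: eq_bigr => j _.
  by rewrite (sclZ (tr_linear _)) mxE trM.
have XE x : x \in G -> x = \sum_(i < n) \tr (x * X' i) *: X i.
  move=> xG; under eq_bigr do rewrite trM.
  apply: (dual_coord (f := fun i y => \tr (X' i * y))) => //; rewrite ?size_tuple //.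
    by move=> i; exact: tr_linear.
  by rewrite (span_basis bG).
exists X'; split => // x xG; apply/eqP; rewrite -subr_eq0; apply/eqP/tr_nondeg.
  by rewrite memvB //; apply: memv_suml => i _; rewrite memvZ.
move=> g gG; rewrite (coord_vbasis gG) trM (scl_sum (tr_linear _)) big1 // => k _.
rewrite (sclZ (tr_linear _)) mulrBl linearB /= mulr_suml linear_sum /= (bigD1 k) //=.
rewrite -scalerAl linearZ /= dual eqxx mulr1 big1 ?addr0 ?subrr ?mulr0 // => i ik.
by rewrite -scalerAl linearZ /= dual (negbTE ik) mulr0.
Qed.

Variables (Nm H Np : M -> Prop) (sigma : M -> C).
(* G is generated by a Lie algebra of matrices Nm + H + Np *)
Let gk := lspan (fun z => [\/ Nm z, H z | Np z]).
Hypothesis gk_lie : forall x y, gk x -> gk y -> gk (x * y - y * x).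
Hypothesis G_words : forall x, x \in G <->
  lspan (fun y => exists2 s : seq M, (forall z, z \in s -> gk z) & y = \prod_(z <- s) z) x.

(* left and right extremal elements, of the same weight sigma *)
Definition lowest y : Prop :=
  (forall z, Nm z -> y * z = 0) /\ (forall z, H z -> y * z = sigma z *: y).
Definition highest x : Prop :=
  (forall z, Np z -> z * x = 0) /\ (forall z, H z -> z * x = sigma z *: x).

(** The triangular decomposition of an enveloping algebra, seen by extremal
    vectors: raising operators are moved to the right through a word. *)
Lemma extremal_word g : g \in G ->
  exists c, forall y x, lowest y -> highest x -> y * g * x = c *: (y * x).
Proof.
pose Q g := exists c, forall y x, lowest y -> highest x -> y * g * x = c *: (y * x).
have QL c g1 g2 : Q g1 -> Q g2 -> Q (c *: g1 + g2).
  move=> [c1 Q1] [c2 Q2]; exists (c * c1 + c2) => y x ly hx.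
  by rewrite mulrDr mulrDl -scalerAr -scalerAl Q1 // Q2 // scalerDl scalerA.
have Q0 : Q 0 by exists 0 => y x _ _; rewrite mulr0 mul0r scale0r.
move=> /G_words; rewrite -/(Q g); elim=> // c _ z [s sk ->] _; apply: (QL) => {c z}.
have [m] := ubnP (size s); elim: m s sk => // m IH [|z s] sk.
  by move=> _; exists 1 => y x _ _; rewrite big_nil mulr1 scale1r.
rewrite ltnS /= => sm; rewrite big_cons.
have sk' x : x \in s -> gk x by move=> xs; apply: sk; rewrite inE xs orbT.
have zk0 : gk z by apply: sk; rewrite inE eqxx.
clear sk; elim: zk0 => [|c {}z z' zN _ IHz]; first by rewrite mul0r.
rewrite mulrDl -scalerAl; apply: (QL) => // {z' IHz}; case: zN => [zN|zH|zP].
- by exists 0 => y x [yN _] _; rewrite mulrA yN // !mul0r scale0r.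
- have [c' cP] := IH s sk' sm; exists (sigma z * c') => y x [yN yH] hx.
  by rewrite mulrA yH // -!scalerAl cP // scalerA.
have zk : gk z by apply: lspan_in; constructor 3.
suff E s1 s2 : (forall x, x \in s1 ++ s2 -> gk x) -> (size (s1 ++ s2) < m)%N ->
    Q ((\prod_(x <- s1) x) * z * \prod_(x <- s2) x).
  by have := E [::] s; rewrite big_nil mul1r; apply.
elim: s2 s1 => [|b s2 IH2] s1 s12 s12m.
  by exists 0 => y x _ [xP _]; rewrite big_nil mulr1 -!mulrA xP // !mulr0 scale0r.
have -> : (\prod_(x <- s1) x) * z * \prod_(x <- b :: s2) x =
   1 *: (\prod_(x <- s1 ++ (z * b - b * z) :: s2) x)
   + (\prod_(x <- rcons s1 b) x) * z * \prod_(x <- s2) x.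
  rewrite scale1r big_cat !big_cons -cats1 big_cat big_seq1 /= mulrBl mulrBr !mulrA.
  by rewrite subrK.
apply: (QL); last by apply: IH2; rewrite cat_rcons.
apply: IH; last by move: s12m; rewrite !size_cat.
have bk : gk b by apply: s12; rewrite mem_cat inE eqxx orbT.
move=> x; rewrite mem_cat inE => /or3P [xs|/eqP ->|xs]; last 1 first.
- by apply: s12; rewrite mem_cat inE xs !orbT.
- by apply: s12; rewrite mem_cat xs.
- exact: gk_lie.
Qed.

(** Averaging over dual bases of G gives elements commuting with G.  Let c be
    the coefficient functional v g u = c(g) v u on G, and q in G its
    representative for the trace form.  Then q is extremal on both sides, so
    q g q = c(g) q^2 on G, and tr ((q^* q)^2) > 0 forces c(q) <> 0. *)
Lemma extremal_average v u : lowest v -> highest u -> v * u != 0 ->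
  exists (T : M -> M), [/\ forall a g, g \in G -> g * T a = T a * g,
    forall x, highest x -> v * T (x * v) * u = v * x * v * u &
    forall a, exists (I : finType) (x y : I -> M),
      (forall i, x i \in G /\ y i \in G) /\ T a = \sum_i x i * a * y i].
Proof.
move=> lv hu vu0.
have [i0 [j0 e0]] : exists i j, (v * u) i j != 0.
  apply: contrapT => ne; case/eqP: vu0; apply/matrixP => i j; rewrite [RHS]mxE.
  by apply: contrapT => /eqP ij; apply: ne; exists i, j.
pose c g := (v * g * u) i0 j0 / (v * u) i0 j0.
have clin : scalar c.
  move=> a g h; rewrite /c mulrDr mulrDl -scalerAr -scalerAl !mxE mulrDl.
  by rewrite mulrA.
have cq g : g \in G -> forall y x, lowest y -> highest x -> y * g * x = c g *: (y * x).
  move=> /extremal_word [s sP] y x ly hx; rewrite sP // /c sP // mxE mulfK //.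
have [X' [X'G XE X'E]] := dual_basis.
have XG (i : 'I_n) : X i \in G by apply: vbasis_mem; rewrite mem_nth // size_tuple.
pose q := \sum_(i < n) c (X i) *: X' i.
have qG : q \in G by apply: memv_suml => i _; rewrite memvZ.
have trq g : g \in G -> \tr (g * q) = c g.
  move=> gG; rewrite (scl_sum (tr_linear g)) {2}(XE g gG) (scl_sum clin).
  by apply: eq_bigr => i _; rewrite (sclZ (tr_linear g)) (sclZ clin) mulrC.
have gkG z : gk z -> z \in G.
  move=> zk; apply/G_words/lspan_in; exists [:: z]; last by rewrite big_seq1.
  by move=> y; rewrite inE => /eqP ->.
have NG z : Nm z -> z \in G by move=> zN; apply/gkG/lspan_in; constructor 1.
have HG z : H z -> z \in G by move=> zN; apply/gkG/lspan_in; constructor 2.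
have PG z : Np z -> z \in G by move=> zN; apply/gkG/lspan_in; constructor 3.
have cdef g : c g = 0 <-> (v * g * u) i0 j0 = 0.
  rewrite /c; split=> [/eqP|->]; last by rewrite mul0r.
  by rewrite mulf_eq0 invr_eq0 (negbTE e0) orbF => /eqP.
have eqG x y : x \in G -> y \in G -> (forall g, g \in G -> \tr (g * x) = \tr (g * y)) -> x = y.
  move=> xG yG xy; apply/eqP; rewrite -subr_eq0; apply/eqP/tr_nondeg; first by rewrite memvB.
  by move=> g gG; rewrite mulrBr linearB /= xy ?subrr.
have lq : lowest q.
  split=> z zN.
    apply: tr_nondeg => [|g gG]; first by rewrite GM // NG.
    rewrite mulrA trM mulrA trq; last by rewrite GM // NG.
    apply/cdef.
    by rewrite mulrA lv.1 // !mul0r mxE.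
  apply: (eqG) => [||g gG]; [by apply: GM => //; apply: HG | by rewrite memvZ |].
  rewrite [g * (q * z)]mulrA [\tr (_ * z)]trM [z * (g * q)]mulrA trq; last by rewrite GM // HG.
  rewrite (sclZ (tr_linear g)) trq //.
  by rewrite /c mulrA lv.2 // -!scalerAl mxE mulrA.
have hq : highest q.
  split=> z zN.
    apply: tr_nondeg => [|g gG]; first by rewrite GM // PG.
    rewrite mulrA trq; last by rewrite GM // PG.
    apply/cdef.
    by rewrite -!mulrA hu.1 // !mulr0 mxE.
  apply: (eqG) => [||g gG]; [by apply: GM => //; apply: HG | by rewrite memvZ |].
  rewrite mulrA trq; last by rewrite GM // HG.
  rewrite (sclZ (tr_linear g)) trq //.
  have E : v * (g * z) * u = sigma z *: (v * g * u) by rewrite -!mulrA hu.2 // -!scalerAr.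
  by rewrite /c E mxE mulrA.
have qq g : g \in G -> q * g * q = c g *: (q * q) by move=> gG; exact: cq.
have c1 : c 1 = 1 by rewrite /c mulr1 divff.
have q0 : q != 0.
  by apply/eqP => q0; have := trq 1 G1; rewrite q0 mulr0 linear0 c1 => /eqP; rewrite eq_sym oner_eq0.
have cq0 : c q != 0.
  have aqG : adj q \in G by exact: Gadj.
  have w0 : adj q * q != 0.
    by apply/eqP => w0; have := tr_adj_gt0 q0; rewrite w0 linear0 ltxx.
  have := tr_adj_gt0 w0; rewrite adjM adjK.
  have -> : adj q * q * (adj q * q) = c (adj q) *: (adj q * q * q).
    by rewrite -mulrA [q * (_ * _)]mulrA qq // -scalerAr mulrA.
  rewrite linearZ /= trq ?GM // => /gt_eqF /negbT; rewrite mulf_eq0 negb_or => /andP [_].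
  have -> : c (adj q * q) = c (adj q) * c q.
    by rewrite -trq ?GM // -mulrA trM -mulrA trM qq // linearZ /= trq.
  by rewrite mulf_eq0 negb_or => /andP [].
exists (fun a => (c q)^-1 *: \sum_(i < n) X i * a * X' i); split.
- move=> a g gG; rewrite -scalerAr -scalerAl; congr (_ *: _).
  rewrite mulr_sumr mulr_suml.
  transitivity (\sum_(i < n) \sum_(k < n) \tr (g * X i * X' k) *: (X k * a * X' i)).
    apply: eq_bigr => i _; rewrite !mulrA {1}(XE (g * X i)) ?GM // !mulr_suml.
    by apply: eq_bigr => k _; rewrite -!scalerAl.
  rewrite exchange_big; apply: eq_bigr => k _ /=.
  rewrite -[RHS]mulrA {1}(X'E (X' k * g)) ?GM // mulr_sumr; apply: eq_bigr => i _.
  rewrite -scalerAr; congr (_ *: _). by rewrite -[X' k * g * _]mulrA [RHS]trM.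
- move=> x hx; rewrite -scalerAr -scalerAl mulr_sumr mulr_suml.
  rewrite (eq_bigr (fun i : 'I_n => (c (X i) * c (X' i)) *: (v * x * v * u))).
    rewrite -scaler_suml scalerA.
    have -> : \sum_(i < n) c (X i) * c (X' i) = c q.
      by rewrite (scl_sum clin); apply: eq_bigr => i _; rewrite (sclZ clin).
    by rewrite mulVf // scale1r.
  move=> i _; have E1 := cq _ (XG i) v x lv hx; have E2 := cq _ (X'G i) v u lv hu.
  have -> : v * (X i * (x * v) * X' i) * u = v * X i * x * (v * X' i * u) by rewrite !mulrA.
  by rewrite E1 E2 -scalerAl -scalerAr scalerA !mulrA.
- move=> a; exists 'I_n, (fun i : 'I_n => (c q)^-1 *: X i), X'; split.
    by move=> i; rewrite memvZ.
  by rewrite scaler_sumr; apply: eq_bigr => i _; rewrite -!scalerAl.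
Qed.

End Average.
End Star.

(** * The Harish-Chandra projection *)

Section AntiCommuting.
Variable R : pzRingType.
Implicit Types (x y z : R) (s : seq R).

Lemma commutator_anti x y z c d : y * z + z * y = c -> x * z + z * x = d ->
  x * y * z - z * (x * y) = x * c - d * y.
Proof.
by move=> <- <-; rewrite mulrDr mulrDl !mulrA opprD addrA addrK.
Qed.

Lemma prod_commute s z : (forall x, x \in s -> z * x = x * z) ->
  z * (\prod_(x <- s) x) = (\prod_(x <- s) x) * z.
Proof.
elim: s => [|x s IH] zs; first by rewrite big_nil mulr1 mul1r.
rewrite big_cons mulrA zs ?inE ?eqxx // -!mulrA IH // => y ys.
by apply: zs; rewrite inE ys orbT.
Qed.

Lemma prod_killl s x : (forall y z, y \in s -> z \in s -> y * z = - (z * y)) ->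
  (forall y, y \in s -> y * y = 0) -> x \in s -> x * (\prod_(y <- s) y) = 0.
Proof.
elim: s => // y s IH anti sq; rewrite inE big_cons mulrA => /orP [/eqP ->|xs].
  by rewrite sq ?mul0r // inE eqxx.
have sub z : z \in s -> z \in y :: s by rewrite inE => ->; rewrite orbT.
rewrite (anti x y (sub x xs) (mem_head y s)) mulNr -mulrA IH ?mulr0 ?oppr0 //.
  by move=> z w zs ws; apply: anti; apply: sub.
by move=> z zs; apply/sq/sub.
Qed.

Lemma prod_killr s x : (forall y z, y \in s -> z \in s -> y * z = - (z * y)) ->
  (forall y, y \in s -> y * y = 0) -> x \in s -> (\prod_(y <- s) y) * x = 0.
Proof.
elim/last_ind: s => // s y IH anti sq; rewrite mem_rcons -cats1 big_cat big_seq1 /= => xs.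
have sub z : z \in s -> z \in rcons s y by rewrite mem_rcons inE => ->; rewrite orbT.
have ys : y \in rcons s y by rewrite mem_rcons inE eqxx.
move: xs; rewrite inE => /orP [/eqP ->|xs]; first by rewrite -mulrA sq ?mulr0.
rewrite -mulrA (anti y x ys (sub x xs)) mulrN mulrA IH ?mul0r ?oppr0 //.
  by move=> z w zs ws; apply: anti; apply: sub.
by move=> z zs; apply/sq/sub.
Qed.

Lemma leibniz_identity (z x y : R) : (z * x - x * z) * y + x * (z * y - y * z) = z * (x * y) - x * y * z.
Proof. by rewrite mulrBl mulrBr !mulrA addrA subrK. Qed.

(** Each e f is an idempotent commuting with the other generators, and e f e = e. *)
Lemma dual_products (fs es : seq R) : size fs = size es ->
  (forall i, (i < size es)%N -> es`_i * es`_i = 0 /\ es`_i * fs`_i + fs`_i * es`_i = 1) ->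
  (forall i j, (i < size es)%N -> (j < size es)%N -> i != j ->
    [/\ es`_i * es`_j = - (es`_j * es`_i), fs`_i * fs`_j = - (fs`_j * fs`_i) &
        es`_i * fs`_j = - (fs`_j * es`_i)]) ->
  let u := \prod_(x <- rev es) x in let v := \prod_(x <- fs) x in u * v * u = u.
Proof.
elim: fs es => [|f fs IH] [|e es] //=; first by rewrite /rev /= !big_nil !mulr1.
move=> [sfe] sq anti; have [ee ef] := sq 0%N isT; rewrite /= in ee ef.
have IH' : (\prod_(x <- rev es) x) * (\prod_(x <- fs) x) * (\prod_(x <- rev es) x)
    = \prod_(x <- rev es) x.
  apply: IH => // [i li|i j li lj ij]; first exact: (sq i.+1).
  by apply: (anti i.+1 j.+1).
rewrite rev_cons -cats1 big_cat big_seq1 big_cons /=.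
set u := \prod_(x <- rev es) x in IH' *; set v := \prod_(x <- fs) x in IH' *.
have anti0 j : (j < size es)%N -> [/\ e * es`_j = - (es`_j * e), f * fs`_j = - (fs`_j * f),
    e * fs`_j = - (fs`_j * e) & es`_j * f = - (f * es`_j)].
  move=> lj; have [h1 h2 h3] := anti 0%N j.+1 isT lj isT.
  by have [_ _ h4] := anti j.+1 0%N lj isT isT.
have efu : (e * f) * u = u * (e * f).
  apply: prod_commute => x; rewrite mem_rev => /(nthP 0) [j lj <-].
  have [h1 h2 h3 h4] := anti0 j lj.
  have h4' : f * es`_j = - (es`_j * f) by rewrite h4 opprK.
  by rewrite -mulrA h4' mulrN mulrA h1 mulNr opprK mulrA.
have efv : (e * f) * v = v * (e * f).
  apply: prod_commute => x /(nthP 0) [j lj <-]; rewrite sfe in lj.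
  have [h1 h2 h3 h4] := anti0 j lj.
  by rewrite -mulrA h2 mulrN mulrA h3 mulNr opprK mulrA.
have efe : e * f * e = e.
  have -> : e * f = 1 - f * e by rewrite -ef addrK.
  by rewrite mulrBl mul1r -mulrA ee mulr0 subr0.
transitivity (u * (e * f * v) * (u * e)); first by rewrite !mulrA.
rewrite efv -mulrA -[v * (e * f) * (u * e)]mulrA [e * f * (u * e)]mulrA efu.
by rewrite -(mulrA u (e * f)) efe !mulrA IH'.
Qed.

End AntiCommuting.

Lemma scale_quarter (F : numFieldType) (V : lmodType F) (x : V) : 4^-1 *: (2 *: (x + x)) = x.
Proof.
have -> : 2 *: (x + x) = 4 *: x by rewrite scaler_nat -mulr2n -mulrnA scaler_nat.
by rewrite scalerA mulVf ?scale1r // pnatr_eq0.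
Qed.

Lemma lspan_ker (K : fieldType) (V W : lmodType K) (f : V -> W) (S : V -> Prop) x : linear f ->
  (forall s, S s -> f s = 0) -> lspan S x -> f x = 0.
Proof.
move=> flin fS; elim=> [|c s y Ss _ IH]; first exact: lin0.
by rewrite flin fS // IH scaler0 addr0.
Qed.

Lemma anticommute_past (R : pzRingType) (x y z w : R) :
  x * y = - (y * x) -> x * (z * w) = 0 -> x * (y * z * w) = 0.
Proof. by move=> xy xzw; rewrite -mulrA mulrA xy mulNr -mulrA xzw mulr0 oppr0. Qed.

Lemma free_subfamily (K : fieldType) (V : vectType K) (I : eqType) (r r' : seq I) (F : I -> V)
    (c : I -> K) : uniq r -> uniq r' -> {subset r' <= r} -> free [seq F i | i <- r] ->
  \sum_(i <- r') c i *: F i = 0 -> forall i, i \in r' -> c i = 0.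
Proof.
move=> ur ur' sub /(free_mapP F ur) fF c0 i ir'.
have : (if i \in r' then c i else 0) = 0.
  apply: (fF (fun i => if i \in r' then c i else 0)); last exact: sub.
  rewrite -[RHS]c0.
  transitivity (\sum_(j <- r | j \in r') c j *: F j).
    by rewrite [RHS]big_mkcond; apply: eq_bigr => j _; case: ifP => // _; rewrite scale0r.
  rewrite -big_filter; apply: perm_big; apply: uniq_perm => //; first exact: filter_uniq.
  by move=> j; rewrite mem_filter; apply/andP/idP => [[] //|jr']; split => //; exact: sub.
by rewrite ir'.
Qed.

Section HarishChandra.
Variables (C : numClosedFieldType) (L : lieAlgType C).
Variable B : L -> L -> C.
Hypotheses (B_linear : forall x, scalar (B x)) (B_sym : forall x y, B x y = B y x).
Hypothesis B_ginv : forall x y z, B (lie x y) z + B y (lie x z) = 0.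
Variables k p t a pp pm : {vspace L}.
Hypotheses (t_k : forall x, x \in t -> x \in k) (a_p : (a <= p)%VS).
Hypotheses (pp_p : (pp <= p)%VS) (pm_p : (pm <= p)%VS).
Hypothesis ta : forall x y, x \in t -> y \in a -> lie x y = 0.
Variable pos : tdual t -> Prop.
Hypothesis pos_sum : forall s : seq (tdual t), (forall mu, mu \in s -> pos mu) ->
  s != [::] -> \sum_(mu <- s) mu != 0.
Hypotheses (pp_pp : forall x y, x \in pp -> y \in pp -> B x y = 0)
  (pm_pm : forall x y, x \in pm -> y \in pm -> B x y = 0)
  (a_pp : forall x y, x \in a -> y \in pp -> B x y = 0)
  (a_pm : forall x y, x \in a -> y \in pm -> B x y = 0).
Variables (m : nat) (es fs : seq L) (bs : seq (tdual t)).
Hypotheses (ses : size es = m) (sfs : size fs = m).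
Hypothesis weights : forall i, (i < m)%N -> [/\ es`_i \in weight_space bs`_i,
     fs`_i \in weight_space (- bs`_i) & pos bs`_i].
Hypothesis dual : forall i j, (i < m)%N -> (j < m)%N -> 2 * B es`_i fs`_j = (i == j)%:R.
Hypotheses (es_span : <<es>>%VS = pp) (fs_span : <<fs>>%VS = pm).
Hypothesis p_basis : basis_of p (fs ++ vbasis a ++ es).
Hypotheses (k_lie : forall X Y, X \in k -> Y \in k -> lie X Y \in k)
  (k_p : forall X y, X \in k -> y \in p -> lie X y \in p).
Hypothesis k_span : forall X, X \in k -> lspan (fun X => X \in k /\
  [\/ exists2 mu, pos mu & X \in weight_space (- mu), X \in t |
      exists2 mu, pos mu & X \in @weight_space _ _ t mu]) X.

(* an orthonormal basis of p and the conjugation of k with respect to the real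
   form of p that it spans *)
Variables (n : nat) (o : n.-tuple L).
Hypotheses (o_basis : basis_of p o)
  (o_orth : forall i j : 'I_n, B o`_i o`_j = (i == j)%:R).
Hypothesis k_conj : forall X, X \in k -> exists2 Y, Y \in k &
  forall i j : 'I_n, B o`_j (lie Y o`_i) = (B o`_j (lie X o`_i))^*.

Section Algebra.
(* the Clifford algebras of p and of a, with the action of k *)
Variables (A Aa : algType C) (g : L -> A) (ga : L -> Aa) (iota : Aa -> A).
Variable Cl_ad : L -> A -> A.
Hypothesis glin : linear g.
Hypothesis g_anti : forall x y, x \in p -> y \in p -> g x * g y + g y * g x = (2 * B x y)%:A.
Hypotheses (ilin : linear iota) (imon : monoid_morphism iota)
  (igen : forall x, x \in a -> iota (ga x) = g x).
Local Notation gs s := (\prod_(x <- s) g x).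
Hypothesis monomials_p : forall x : A, lspan (fun y => exists2 mk,
  size mk = size (fs ++ vbasis a ++ es) & y = gs (mask mk (fs ++ vbasis a ++ es))) x.
Hypothesis monomials_a : forall x : Aa, lspan (fun y => exists2 mk,
  size mk = size (vbasis a) & y = \prod_(x <- mask mk (vbasis a)) ga x) x.
Hypothesis Cl_adP : forall X, X \in k -> [/\ linear (Cl_ad X), leibniz (Cl_ad X) &
  forall v, v \in p -> Cl_ad X (g v) = g (lie X v)].
Variables (d : nat) (phi : A -> 'M[C]_d.+1).
Hypotheses (plin : linear phi) (pmon : monoid_morphism phi) (pinj : injective phi).
Hypothesis padj : forall i : 'I_n, adj (phi (g o`_i)) = phi (g o`_i).
Hypothesis pfree : forall s : seq L, perm_eq s (fs ++ vbasis a ++ es) ->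
  free [seq phi (gs (mask mk s)) | mk <- bits (size s)].

Let two0 : (2 : C) != 0. Proof. by rewrite pnatr_eq0. Qed.

Lemma es_pp x : x \in es -> x \in pp. Proof. by move=> xs; rewrite -es_span memv_span. Qed.
Lemma fs_pm x : x \in fs -> x \in pm. Proof. by move=> xs; rewrite -fs_span memv_span. Qed.
Lemma es_p x : x \in es -> x \in p. Proof. by move=> /es_pp; apply: subvP. Qed.
Lemma fs_p x : x \in fs -> x \in p. Proof. by move=> /fs_pm; apply: subvP. Qed.
Lemma a_inp x : x \in a -> x \in p. Proof. exact: subvP. Qed.

Lemma mull_lin (x : A) : linear (fun y : A => x * y).
Proof. by move=> c y z; rewrite mulrDr scalerAr. Qed.
Lemma mulr_lin (x : A) : linear (fun y : A => y * x).
Proof. by move=> c y z; rewrite mulrDl scalerAl. Qed.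

Lemma g_anti0 x y : x \in p -> y \in p -> B x y = 0 -> g x * g y = - (g y * g x).
Proof.
by move=> xp yp xy; apply/eqP; rewrite -addr_eq0 g_anti // xy mulr0 scale0r.
Qed.

Lemma g_sq0 x : x \in p -> B x x = 0 -> g x * g x = 0.
Proof.
move=> xp xx; apply: (scalerI two0); rewrite scaler0 scaler_nat mulr2n.
by rewrite g_anti // xx mulr0 scale0r.
Qed.

Let DP H : H \in t -> [/\ linear (Cl_ad H), leibniz (Cl_ad H) &
  forall v, v \in p -> Cl_ad H (g v) = g (lie H v)].
Proof. by move=> /t_k; exact: Cl_adP. Qed.

Lemma Cl_ad1 X : X \in k -> Cl_ad X 1 = 0.
Proof.
move=> Xk; have [_ Dlei _] := Cl_adP Xk.
by have /eqP := Dlei 1 1; rewrite !mulr1 mul1r -subr_eq0 opprD addrA subrr add0r oppr_eq0 => /eqP.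
Qed.

(** ** The action of k by commutators *)

Let o_p (i : 'I_n) : o`_i \in p.
Proof. by rewrite -(span_basis o_basis) memv_span // mem_nth ?size_tuple. Qed.

Lemma o_complete x : x \in p -> x = \sum_(i < n) B o`_i x *: o`_i.
Proof.
move=> xp; apply: (dual_coord (f := fun i => B o`_i)) => //; first exact: size_tuple.
by rewrite (span_basis o_basis).
Qed.

(** The element of Cl(p) whose commutator is the action of X, the image of X under
    the spin representation. *)
Definition spin (X : L) : A := 4^-1 *: \sum_(i < n) g (lie X o`_i) * g o`_i.

Lemma spin_linear : linear spin.
Proof.
move=> c X Y; rewrite /spin scalerA mulrC -scalerA -scalerDr; congr (_ *: _).
rewrite scaler_sumr -big_split; apply: eq_bigr => i _ /=.
by rewrite lie_linearl glin mulrDl scalerAl.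
Qed.

Lemma spin_gen X v : X \in k -> v \in p -> spin X * g v - g v * spin X = g (lie X v).
Proof.
move=> Xk vp.
have com x y : x \in p -> y \in p -> g x * g y * g v - g v * (g x * g y) =
    (2 * B y v) *: g x - (2 * B x v) *: g y.
  move=> xp yp; rewrite (commutator_anti (g_anti yp vp) (g_anti xp vp)).
  by rewrite -scalerAr mulr1 -scalerAl mul1r.
rewrite /spin -scalerAl -scalerAr -scalerBr mulr_suml mulr_sumr -sumrB.
rewrite (eq_bigr (fun i : 'I_n => 2 *: (B o`_i v *: g (lie X o`_i) + B o`_i (lie X v) *: g o`_i))).
  rewrite -scaler_sumr big_split /=.
  have -> : \sum_(i < n) B o`_i v *: g (lie X o`_i) = g (lie X v).
    rewrite {2}[v]o_complete //.
    have ll : linear (lie X) by move=> c x y; exact: lie_linearr.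
    rewrite (lin_sum ll) (lin_sum glin); apply: eq_bigr => i _.
    by rewrite (linZ ll) (linZ glin).
  have -> : \sum_(i < n) B o`_i (lie X v) *: g o`_i = g (lie X v).
    rewrite {2}[lie X v]o_complete ?k_p // (lin_sum glin); apply: eq_bigr => i _.
    by rewrite (linZ glin).
  exact: scale_quarter.
move=> i _; rewrite com ?k_p // scalerDr !scalerA; congr (_ + _).
rewrite -scaleNr -mulrN; congr ((_ * _) *: _).
by apply/eqP; rewrite eq_sym -addr_eq0 addrC B_ginv.
Qed.

Lemma Cl_ad_spin X x : X \in k -> Cl_ad X x = spin X * x - x * spin X.
Proof.
move=> Xk; have [Dlin Dlei Dgen] := Cl_adP Xk.
have DE s : {subset s <= p} -> Cl_ad X (gs s) = spin X * gs s - gs s * spin X.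
  elim: s => [|y s IH] sp; first by rewrite big_nil Cl_ad1 // mulr1 mul1r subrr.
  rewrite big_cons Dlei Dgen ?sp ?mem_head // IH => [|z zs]; last by rewrite sp // inE zs orbT.
  by rewrite -spin_gen ?sp ?mem_head // leibniz_identity.
elim: (monomials_p x) => [|c _ y [mk _ ->] _ IH]; first by rewrite (lin0 Dlin) mulr0 mul0r subrr.
rewrite Dlin IH DE => [|z /mem_mask zs]; last by rewrite -(span_basis p_basis) memv_span.
by rewrite mulrDr mulrDl -(scalerAl c _ (spin X)) -(scalerAr c (spin X)) scalerBr opprD addrACA.
Qed.

Lemma spin_lie X Y : X \in k -> Y \in k -> spin X * spin Y - spin Y * spin X = spin (lie X Y).
Proof.
move=> Xk Yk; rewrite -Cl_ad_spin //; have [Dlin Dlei Dgen] := Cl_adP Xk.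
have lX : linear (lie X) by move=> c x y; exact: lie_linearr.
have lY : linear (lie Y) by move=> c x y; exact: lie_linearr.
rewrite /spin (linZ Dlin) (lin_sum Dlin); congr (_ *: _).
transitivity (\sum_(i < n) (g (lie X (lie Y o`_i)) * g o`_i) +
              \sum_(i < n) (g (lie Y o`_i) * g (lie X o`_i))).
  rewrite -big_split; apply: eq_bigr => i _ /=.
  by rewrite Dlei !Dgen ?k_p.
have -> : \sum_(i < n) (g (lie Y o`_i) * g (lie X o`_i)) =
    - \sum_(i < n) (g (lie Y (lie X o`_i)) * g o`_i).
  transitivity (\sum_(i < n) \sum_(j < n) B o`_j (lie X o`_i) *: (g (lie Y o`_i) * g o`_j)).
    apply: eq_bigr => i _; rewrite {1}[lie X o`_i]o_complete ?k_p // (lin_sum glin) mulr_sumr.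
    by apply: eq_bigr => j _; rewrite (linZ glin) scalerAr.
  rewrite exchange_big -sumrN; apply: eq_bigr => j _ /=.
  rewrite [lie X o`_j]o_complete ?k_p // (lin_sum lY) (lin_sum glin) mulr_suml -sumrN.
  apply: eq_bigr => i _; rewrite (linZ lY) (linZ glin) -scalerAl -scaleNr; congr (_ *: _).
  by apply/eqP; rewrite -addr_eq0 B_sym B_ginv.
rewrite -sumrB; apply: eq_bigr => i _; rewrite -mulrBl; congr (_ * _).
by rewrite [lie X (lie Y _)]lie_leibniz (linD glin) addrK.
Qed.

Lemma p_coord x : x \in p -> exists2 y, y \in a &
  x = \sum_(j < m) (2 * B es`_j x) *: fs`_j + y + \sum_(j < m) (2 * B fs`_j x) *: es`_j.
Proof.
have esp j : (j < m)%N -> es`_j \in pp.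
  by move=> lj; rewrite -es_span memv_span // mem_nth ?ses.
have fsp j : (j < m)%N -> fs`_j \in pm.
  by move=> lj; rewrite -fs_span memv_span // mem_nth ?sfs.
move=> xp; have : x \in <<fs ++ vbasis a ++ es>>%VS by rewrite (span_basis p_basis).
rewrite !span_cat (span_basis (vbasisP a)) => /memv_addP [f fS [_ /memv_addP [y ya [z zS ->]] xE]].
have fp : f \in pm by rewrite -fs_span.
have zp : z \in pp by rewrite -es_span.
have lin2 w : scalar (fun y => 2 * B w y) by move=> c u v; rewrite /= B_linear mulrDr mulrCA.
exists y => //; rewrite xE addrA; congr (_ + _ + _).
  rewrite [LHS](dual_coord (f := fun j : 'I_m => fun y => 2 * B es`_j y) sfs _ _ fS) //.
    apply: eq_bigr => j _; congr (_ * _ *: _).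
    by rewrite !(sclD (B_linear _)) (pp_pp (esp _ _) zp) // addr0 -(B_sym y) (a_pp ya) ?esp ?addr0.
  by move=> i j; rewrite dual.
rewrite [LHS](dual_coord (f := fun j : 'I_m => fun y => 2 * B fs`_j y) ses _ _ zS) //.
  apply: eq_bigr => j _; congr (_ * _ *: _).
  by rewrite !(sclD (B_linear _)) (pm_pm (fsp _ _) fp) // add0r -(B_sym y) (a_pm ya) ?fsp ?add0r.
by move=> i j; rewrite B_sym dual // eq_sym.
Qed.

(** H acts diagonally in the dual bases, so that spin H is a combination of the
    e_j f_j - f_j e_j; normal ordering produces the scalar. *)
Lemma spin_t H : H \in t -> exists (c : C) (d : nat -> C),
  spin H = c%:A + \sum_(j < m) d j *: (g fs`_j * g es`_j).
Proof.
move=> Ht; have esp j : (j < m)%N -> es`_j \in p.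
  by move=> lj; apply: (subvP pp_p); rewrite -es_span memv_span // mem_nth ?ses.
have fsp j : (j < m)%N -> fs`_j \in p.
  by move=> lj; apply: (subvP pm_p); rewrite -fs_span memv_span // mem_nth ?sfs.
pose bt j : C := (bs`_j : tdual t) (vsproj t H).
have He j : (j < m)%N -> lie H es`_j = bt j *: es`_j.
  by move=> lj; have [/weight_spaceP /(_ (vsproj t H)) + _ _] := weights lj; rewrite vsprojK.
have Hf j : (j < m)%N -> lie H fs`_j = - bt j *: fs`_j.
  move=> lj; have [_ /weight_spaceP /(_ (vsproj t H)) + _] := weights lj.
  by rewrite vsprojK // opp_lfunE.
have lH : linear (lie H) by move=> c x y; exact: lie_linearr.
have HE x : x \in p -> lie H x = \sum_(j < m) ((2 * bt j * B fs`_j x) *: es`_j -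
    (2 * bt j * B es`_j x) *: fs`_j).
  move=> xp; have [y ya xE] := p_coord xp; rewrite {1}xE !(linD lH) (ta Ht ya) addr0.
  rewrite !(lin_sum lH) sumrB addrC -sumrN; congr (_ + _); apply: eq_bigr => j _.
    by rewrite (linZ lH) He // scalerA mulrAC.
  by rewrite (linZ lH) Hf // scalerA -scaleNr mulrN mulrAC.
have gE x : x \in p -> g x = \sum_(i < n) B x o`_i *: g o`_i.
  move=> xp; rewrite {1}(o_complete xp) (lin_sum glin); apply: eq_bigr => i _.
  by rewrite (linZ glin) B_sym.
have sumE : \sum_(i < n) g (lie H o`_i) * g o`_i =
    \sum_(j < m) (2 * bt j) *: (g es`_j * g fs`_j - g fs`_j * g es`_j).
  transitivity (\sum_(i < n) \sum_(j < m) ((2 * bt j * B fs`_j o`_i) *: (g es`_j * g o`_i) -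
      (2 * bt j * B es`_j o`_i) *: (g fs`_j * g o`_i))).
    apply: eq_bigr => i _; rewrite HE // (lin_sum glin) mulr_suml; apply: eq_bigr => j _.
    by rewrite (linB glin) !(linZ glin) mulrBl !scalerAl.
  rewrite exchange_big; apply: eq_bigr => j _ /=.
  rewrite sumrB scalerBr; congr (_ - _).
    rewrite [g fs`_j]gE ?fsp // mulr_sumr scaler_sumr; apply: eq_bigr => i _.
    by rewrite -scalerAr scalerA.
  rewrite [g es`_j]gE ?esp // mulr_sumr scaler_sumr; apply: eq_bigr => i _.
  by rewrite -scalerAr scalerA.
exists (4^-1 * \sum_(j < m) 2 * bt j), (fun j => 4^-1 * (2 * bt j) * (- 2)).
rewrite /spin sumE -scalerA scaler_suml.
have -> : \sum_(j < m) (4^-1 * (2 * bt j) * (- 2)) *: (g fs`_j * g es`_j) =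
   4^-1 *: \sum_(j < m) (2 * bt j) *: (- (g fs`_j * g es`_j) - g fs`_j * g es`_j).
  rewrite scaler_sumr; apply: eq_bigr => j _; rewrite -!scalerA; congr (_ *: (_ *: _)).
  by rewrite scaleNr scaler_nat mulr2n opprD.
rewrite -scalerDr -big_split; congr (_ *: _); apply: eq_bigr => j _ /=.
rewrite -scalerDr; congr (_ *: _).
have := g_anti (esp j (ltn_ord j)) (fsp j (ltn_ord j)); rewrite dual // eqxx scale1r => <-.
by rewrite addrA addrK.
Qed.

(** The o_i are hermitian and X acts on p by a skew-symmetric matrix, so the adjoint
    of spin X is - spin of the conjugate of X. *)
Lemma spin_adj X : X \in k -> exists2 Y, Y \in k & adj (phi (spin X)) = phi (spin Y).
Proof.
move=> Xk; have [Y Yk YX] := k_conj Xk; exists (- Y).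
  by rewrite memvN.
pose E (i : 'I_n) := phi (g o`_i).
have EE i : adj (E i) = E i by rewrite /E padj.
have spE Z : Z \in k -> phi (spin Z) = 4^-1 *: \sum_(i < n) \sum_(j < n) B o`_j (lie Z o`_i) *: (E j * E i).
  move=> Zk; rewrite /spin (linZ plin) (lin_sum plin); congr (_ *: _).
  apply: eq_bigr => i _; rewrite pmon.2 {1}[lie Z o`_i]o_complete ?k_p //.
  rewrite (lin_sum glin) (lin_sum plin) mulr_suml; apply: eq_bigr => j _.
  by rewrite (linZ glin) (linZ plin) -scalerAl.
have adj_sum (F : 'I_n -> 'M[C]_d.+1) : adj (\sum_i F i) = \sum_i adj (F i).
  by apply: (big_morph (@adj C d.+1)); [exact: adjD | exact: adj0].
rewrite !spE ?memvN // adjZ adj_sum exchange_big /=.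
have -> : (4^-1 : C)^* = 4^-1 by rewrite fmorphV /= conjC_nat.
congr (_ *: _); rewrite exchange_big /= [RHS]exchange_big /=; apply: eq_bigr => i _.
rewrite adj_sum; apply: eq_bigr => j _; rewrite adjZ adjM !EE; congr (_ *: _).
rewrite lieNl (sclN (B_linear _)) YX -rmorphN /=; congr (_^*).
by apply/eqP; rewrite -addr_eq0 B_sym B_ginv.
Qed.

(** ** Normal ordering *)

Lemma gs_iota (s : seq L) : {subset s <= (vbasis a : seq L)} ->
  gs s = iota (\prod_(x <- s) ga x).
Proof.
elim: s => [|x s IH] sa; first by rewrite !big_nil imon.1.
rewrite !big_cons imon.2 IH => [|y ys]; last by apply: sa; rewrite inE ys orbT.
by rewrite igen //; apply/vbasis_mem/sa/mem_head.
Qed.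

Definition normal (y : A) : Prop := exists s1 s2 s3 : seq L,
  [/\ {subset s1 <= fs}, {subset s2 <= (vbasis a : seq L)}, {subset s3 <= es} &
      y = gs s1 * gs s2 * gs s3].

Lemma normal_span (x : A) : lspan normal x.
Proof.
apply: lspan_mono (monomials_p x) => y [mk]; rewrite size_cat => smk ->.
rewrite -[mk](cat_take_drop (size fs)) mask_cat; last first.
  by rewrite size_take_min smk; apply/minn_idPl; rewrite leq_addr.
set mk' := drop _ mk; rewrite -[mk'](cat_take_drop (size (vbasis a))) mask_cat; last first.
  by rewrite size_take_min size_drop smk addKn size_cat; apply/minn_idPl; rewrite leq_addr.
exists (mask (take (size fs) mk) fs), (mask (take (size (vbasis a)) mk') (vbasis a)),
  (mask (drop (size (vbasis a)) mk') es); split; try by move=> z /mem_mask.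
by rewrite !big_cat /= mulrA.
Qed.

Lemma gs_weight (P : tdual t -> Prop) (s : seq L) :
  (forall x, x \in s -> x \in p /\ exists2 mu, P mu & x \in weight_space mu) ->
  exists mus : seq (tdual t), [/\ size mus = size s, forall mu, mu \in mus -> P mu &
    forall H : subvs_of t, Cl_ad (vsval H) (gs s) = ((\sum_(mu <- mus) mu) H : C) *: gs s].
Proof.
elim: s => [|x s IH] sP.
  exists [::]; split=> // H; rewrite !big_nil Cl_ad1 ?t_k ?subvsP //.
  by rewrite zero_lfunE scale0r.
have [mus [smu musP muE]] : exists mus : seq (tdual t), [/\ size mus = size s,
   forall mu, mu \in mus -> P mu &
    forall H : subvs_of t, Cl_ad (vsval H) (gs s) = ((\sum_(mu <- mus) mu) H : C) *: gs s].
  by apply: IH => y ys; apply: sP; rewrite inE ys orbT.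
have [xp [mu Pmu /weight_spaceP xmu]] := sP x (mem_head x s).
exists (mu :: mus); split; first by rewrite /= smu.
  by move=> nu; rewrite inE => /orP [/eqP -> //|/musP].
move=> H; have [Dlin Dlei Dgen] := DP (subvsP H).
rewrite !big_cons Dlei Dgen // muE xmu (linZ glin) add_lfunE scalerDl.
by rewrite -scalerAl -scalerAr.
Qed.

(** A normally ordered monomial of weight nu, with the weights of its factors. *)
Definition wnormal (nu : tdual t) (y : A) : Prop :=
  exists (s1 s2 s3 : seq L) (m1 m3 : seq (tdual t)),
  [/\ [/\ {subset s1 <= fs}, {subset s2 <= (vbasis a : seq L)} & {subset s3 <= es}],
      size m1 = size s1 /\ size m3 = size s3, forall mu, mu \in m1 ++ m3 -> pos mu,
      y = gs s1 * gs s2 * gs s3 & nu = \sum_(mu <- m3) mu - \sum_(mu <- m1) mu].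

Lemma normal_weight y : normal y -> exists2 nu, wnormal nu y &
  forall H : subvs_of t, Cl_ad (vsval H) y = (nu H : C) *: y.
Proof.
move=> [s1 [s2 [s3 [h1 h2 h3 yE]]]].
have [|m1 [sm1 m1P m1E]] := @gs_weight (fun mu => pos (- mu)) s1.
  move=> x /h1 xf; split; first exact: fs_p.
  have [i im <-] := nthP 0 xf; rewrite sfs in im; have [_ fi bi] := weights im.
  by exists (- bs`_i) => //; rewrite opprK.
have [|m2 [sm2 m2P m2E]] := @gs_weight (fun mu => mu = 0) s2.
  move=> x /h2 /vbasis_mem xa; split; first exact: a_inp.
  exists 0 => //; apply/weight_spaceP => H.
  by rewrite ta ?subvsP // zero_lfunE scale0r.
have [|m3 [sm3 m3P m3E]] := @gs_weight pos s3.
  move=> x /h3 xe; split; first exact: es_p.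
  have [i im <-] := nthP 0 xe; rewrite ses in im; have [ei _ bi] := weights im.
  by exists bs`_i.
have m20 : \sum_(mu <- m2) mu = 0 by rewrite big_seq big1 // => mu /m2P.
exists (\sum_(mu <- m3) mu + \sum_(mu <- m1) mu).
  exists s1, s2, s3, (map -%R m1), m3; split; rewrite ?size_map //.
    move=> mu; rewrite mem_cat => /orP [/mapP [nu /m1P nuP ->] //|/m3P //].
  by rewrite big_map sumrN opprK.
move=> H; have [Dlin Dlei _] := DP (subvsP H).
rewrite yE !Dlei m1E m2E m3E m20 zero_lfunE scale0r mulr0 addr0.
by rewrite -!scalerAl -scalerAr add_lfunE scalerDl addrC.
Qed.

(** Normally ordered monomials are weight vectors and span Cl(p), so the elements
    of weight nu are combinations of those of weight nu. *)
Lemma weight_part (nu : tdual t) (x : A) :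
  (forall H : subvs_of t, Cl_ad (vsval H) x = (nu H : C) *: x) -> lspan (wnormal nu) x.
Proof.
move=> xnu.
have : lspan (fun y => normal y /\ forall H : subvs_of t, Cl_ad (vsval H) y = (nu H : C) *: y) x.
  apply: (@lspan_weight _ _ _ (fun (H : subvs_of t) y => Cl_ad (vsval H) y) _ (fun H => nu H)).
  - by move=> H; have [] := DP (subvsP H).
  - by move=> y /normal_weight [nu' _ nuE]; exists (fun H => nu' H).
  - exact: xnu.
  - exact: normal_span.
apply: lspan_trans => y [/normal_weight [nu' wy nuE] yE].
have [->|y0] := eqVneq y 0; first exact: lspan0.
suff -> : nu = nu' by exact: lspan_in.
apply/lfunP => H; have /eqP := yE H; rewrite nuE -subr_eq0 -scalerBl.
by rewrite scaler_eq0 (negbTE y0) orbF subr_eq0 => /eqP.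
Qed.

Let psum (s : seq (tdual t)) : (forall mu, mu \in s -> pos mu) -> \sum_(mu <- s) mu = 0 -> s = [::].
Proof.
move=> sP s0; apply: contrapT => /eqP sn; have := pos_sum sP sn.
by rewrite s0 eqxx.
Qed.

(* In the next three lemmas, a monomial of weight nu with no factor from fs, or
   none from es, would make a nonempty sum of positive weights vanish. *)
Lemma wnormal0 y : wnormal 0 y -> (exists z, y = iota z) \/
  exists f e b, [/\ f \in fs, e \in es & y = g f * b * g e].
Proof.
move=> [s1 [s2 [s3 [m1 [m3 [[h1 h2 h3] [sm1 sm3] mP yE /esym /eqP]]]]]].
rewrite subr_eq0 => /eqP m13.
have p1 mu : mu \in m1 -> pos mu by move=> mm; apply: mP; rewrite mem_cat mm.
have p3 mu : mu \in m3 -> pos mu by move=> mm; apply: mP; rewrite mem_cat mm orbT.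
case: s1 h1 sm1 yE => [|f s1] h1 sm1 yE.
  rewrite (size0nil sm1) big_nil in m13.
  rewrite (psum p3 m13) in sm3; rewrite yE (size0nil (esym sm3)) !big_nil mul1r mulr1.
  by left; exists (\prod_(x <- s2) ga x); rewrite gs_iota.
right; case/lastP: s3 h3 sm3 yE => [|s3 e] h3 sm3 yE.
  rewrite (size0nil sm3) big_nil in m13; have := psum p1 (esym m13).
  by move=> m10; rewrite m10 in sm1.
exists f, e, (gs s1 * gs s2 * gs s3); split; first exact/h1/mem_head.
  by apply: h3; rewrite mem_rcons mem_head.
by rewrite yE big_cons -cats1 big_cat big_seq1 /= !mulrA.
Qed.

Lemma wnormal_neg mu y : pos mu -> wnormal (- mu) y -> exists f b, f \in fs /\ y = g f * b.
Proof.
move=> pmu [s1 [s2 [s3 [m1 [m3 [[h1 h2 h3] [sm1 sm3] mP yE muE]]]]]].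
case: s1 h1 sm1 yE => [|f s1] h1 sm1 yE; last first.
  exists f, (gs s1 * gs s2 * gs s3); split; first exact/h1/mem_head.
  by rewrite yE big_cons !mulrA.
rewrite (size0nil sm1) big_nil subr0 in muE.
have : [:: mu & m3] = [::] :> seq (tdual t).
  apply: psum; last by rewrite big_cons -muE subrr.
  by move=> nu; rewrite inE => /orP [/eqP -> //|nm]; apply: mP; rewrite mem_cat nm orbT.
by [].
Qed.

Lemma wnormal_pos mu y : pos mu -> wnormal mu y -> exists e b, e \in es /\ y = b * g e.
Proof.
move=> pmu [s1 [s2 [s3 [m1 [m3 [[h1 h2 h3] [sm1 sm3] mP yE muE]]]]]].
case/lastP: s3 h3 sm3 yE => [|s3 e] h3 sm3 yE; last first.
  exists e, (gs s1 * gs s2 * gs s3); split; first by apply: h3; rewrite mem_rcons mem_head.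
  by rewrite yE -cats1 big_cat big_seq1 /= !mulrA.
rewrite (size0nil sm3) big_nil sub0r in muE.
have : [:: mu & m1] = [::] :> seq (tdual t).
  apply: psum; last by rewrite big_cons muE addNr.
  by move=> nu; rewrite inE => /orP [/eqP -> //|nm]; apply: mP; rewrite mem_cat nm.
by [].
Qed.

(** ** The extremal products *)

(* v is killed by p- on its right and u by p+ on its left, so that x |-> v x u
   kills p- Cl(p) + Cl(p) p+ *)

Local Notation v := (gs fs).
Local Notation u := (gs (rev es)).

Lemma isotropic_kill (s : seq L) U x : <<s>>%VS = U -> (U <= p)%VS ->
  (forall y z, y \in U -> z \in U -> B y z = 0) -> x \in U ->
  gs s * g x = 0 /\ g x * gs s = 0.
Proof.
move=> <- sp iso; have sU y : y \in s -> y \in <<s>>%VS by exact: memv_span.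
have gs_map : gs s = \prod_(y <- map g s) y by rewrite big_map.
have anti y z : y \in map g s -> z \in map g s -> y * z = - (z * y).
  move=> /mapP [y' /sU ys ->] /mapP [z' /sU zs ->].
  by apply: g_anti0; rewrite ?iso // (subvP sp).
have sq y : y \in map g s -> y * y = 0.
  by move=> /mapP [y' /sU ys ->]; apply: g_sq0; rewrite ?iso // (subvP sp).
move=> /span_lspan; elim=> [|c y z ys _ [IHr IHl]]; first by rewrite (lin0 glin) mulr0 mul0r.
rewrite glin mulrDr mulrDl -scalerAl -scalerAr IHl IHr gs_map.
by rewrite prod_killr ?prod_killl ?map_f // scaler0 addr0.
Qed.

Lemma v_kill x : x \in pm -> v * g x = 0.
Proof. by move=> /(isotropic_kill fs_span pm_p pm_pm) []. Qed.

Lemma u_kill x : x \in pp -> g x * u = 0.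
Proof.
have revs : <<rev es>>%VS = pp by rewrite (eq_span (mem_rev es)).
by move=> /(isotropic_kill revs pp_p pp_pp) [].
Qed.

Lemma uvu : u * v * u = u.
Proof.
have es_i i : (i < m)%N -> es`_i \in es by move=> im; rewrite mem_nth ?ses.
have fs_i i : (i < m)%N -> fs`_i \in fs by move=> im; rewrite mem_nth ?sfs.
have gs_map s : gs s = \prod_(x <- map g s) x by rewrite big_map.
rewrite !gs_map map_rev; apply: dual_products; first by rewrite !size_map ses sfs.
  move=> i; rewrite size_map ses => im; rewrite !(nth_map 0) ?ses ?sfs //.
  have ei := es_i i im; have fi := fs_i i im.
  split; first by apply: g_sq0; [exact: es_p | apply: pp_pp; exact: es_pp].
  by rewrite (g_anti (es_p ei) (fs_p fi)) dual // eqxx scale1r.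
move=> i j; rewrite size_map ses => im jm ij; rewrite !(nth_map 0) ?ses ?sfs //.
have ei := es_i i im; have fi := fs_i i im; have ej := es_i j jm; have fj := fs_i j jm.
split; apply: g_anti0; try by [apply: es_p | apply: fs_p].
- exact: pp_pp (es_pp ei) (es_pp ej).
- exact: pm_pm (fs_pm fi) (fs_pm fj).
- by have /eqP := dual im jm; rewrite (negbTE ij) mulf_eq0 (negbTE two0) => /eqP.
Qed.

Lemma u_killa x (z : Aa) : x \in pp -> g x * (iota z * u) = 0.
Proof.
move=> xpp.
elim: (monomials_a z) => [|c y z' [mk _ ->] _ IH].
  by rewrite (lin0 ilin) mul0r mulr0.
rewrite ilin mulrDl mulrDr IH addr0 -scalerAl -scalerAr; apply/eqP.
rewrite scaler_eq0; apply/orP; right; apply/eqP.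
have : {subset mask mk (vbasis a) <= (vbasis a : seq L)} by move=> w /mem_mask.
elim: (mask _ _) => [|w s IHs] sub; first by rewrite big_nil imon.1 mul1r u_kill.
have wa : w \in a by apply/vbasis_mem/sub/mem_head.
rewrite big_cons imon.2 igen //; apply: anticommute_past.
  apply: g_anti0; [exact: (subvP pp_p) | exact: a_inp |].
  by rewrite B_sym a_pp.
by apply: IHs => w' ws; apply: sub; rewrite inE ws orbT.
Qed.

(** ** The projection *)

Definition hk : A -> Prop := lspan (fun z =>
  (exists2 f, f \in pm & exists b, z = g f * b) \/
  (exists2 e, e \in pp & exists b, z = b * g e)).

Lemma hk_fs f b : f \in fs -> hk (g f * b).
Proof. by move=> /fs_pm fp; apply: lspan_in; left; exists f => //; exists b. Qed.

Lemma hk_es e b : e \in es -> hk (b * g e).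
Proof. by move=> /es_pp ep; apply: lspan_in; right; exists e => //; exists b. Qed.

Lemma hk_vu x : hk x -> v * x * u = 0.
Proof.
elim=> [|c _ y [[f fp [b ->]]|[e ep [b ->]]] _ IH]; first by rewrite mulr0 mul0r.
  by rewrite mulrDr mulrDl IH addr0 -scalerAr mulrA v_kill // mul0r scaler0 mul0r.
by rewrite mulrDr mulrDl IH addr0 -scalerAr -scalerAl -!mulrA u_kill // !mulr0 scaler0.
Qed.

Lemma hc_exists (x : A) : exists y, hk (x - iota y).
Proof.
elim: (normal_span x) => [|c s z [s1 [s2 [s3 [h1 h2 h3 ->]]]] _ [y0 yP]].
  by exists 0; rewrite (lin0 ilin) subrr; exact: lspan0.
suff [y' y'P] : exists y, hk (gs s1 * gs s2 * gs s3 - iota y).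
  exists (c *: y' + y0); rewrite ilin opprD addrACA -scalerBr.
  by apply: lspanD => //; apply: lspanZ.
case: s1 {yP} h1 => [|f s1] h1; last first.
  exists 0; rewrite (lin0 ilin) subr0 big_cons -!mulrA; apply: hk_fs; exact/h1/mem_head.
case/lastP: s3 h3 => [|s3 e] h3; last first.
  exists 0; rewrite (lin0 ilin) subr0 -cats1 big_cat big_seq1 /= mulrA; apply: hk_es.
  by apply: h3; rewrite mem_rcons mem_head.
exists (\prod_(x <- s2) ga x).
by rewrite !big_nil mul1r mulr1 gs_iota // subrr; exact: lspan0.
Qed.

(** The products v z u, with z a monomial in the basis of a, are monomials in a
    basis of p, hence independent: Cl(a) survives in the corner v Cl(p) u. *)
Lemma corner_injective (y : Aa) : v * iota y * u = 0 -> y = 0.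
Proof.
move=> y0.
pose s0 := fs ++ vbasis a ++ rev es.
have ps : perm_eq s0 (fs ++ vbasis a ++ es) by rewrite !perm_cat2l perm_rev.
have [c yE] := lspan_bits (monomials_a y).
set l := size (vbasis a) in yE.
pose pad mk := nseq (size fs) true ++ mk ++ nseq (size es) true.
have padE mk : size mk = l -> v * iota (\prod_(w <- mask mk (vbasis a)) ga w) * u = gs (mask (pad mk) s0).
  move=> smk; rewrite /pad /s0 mask_cat ?size_nseq // mask_cat //.
  rewrite !mask_true ?size_rev // !big_cat /= mulrA; congr (_ * _ * _).
  by rewrite gs_iota // => z /mem_mask.
pose F mk := phi (gs (mask mk s0)).
pose unpad (mk : bitseq) := take l (drop (size fs) mk).
have padK mk : size mk = l -> unpad (pad mk) = mk.
  by move=> smk; rewrite /unpad /pad drop_size_cat ?size_nseq // take_size_cat.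
have sum0 : \sum_(mk <- map pad (bits l)) c (unpad mk) *: F mk = 0.
  have : phi (v * iota y * u) = 0 by rewrite y0 (lin0 plin).
  rewrite yE (lin_sum ilin) mulr_sumr mulr_suml (lin_sum plin) big_map => E0.
  rewrite -[RHS]E0 big_seq [RHS]big_seq; apply: eq_bigr => mk; rewrite mem_bits => /eqP smk.
  by rewrite padK // (linZ ilin) -scalerAr -scalerAl (linZ plin) padE.
rewrite yE big_seq big1 // => mk mkb; have smk : size mk = l by apply/eqP; rewrite -mem_bits.
suff -> : c mk = 0 by rewrite scale0r.
rewrite -(padK mk smk).
apply: (free_subfamily (bits_uniq (size s0)) _ _ (pfree ps) sum0 (i := pad mk)); last exact: map_f.
  rewrite map_inj_in_uniq ?bits_uniq // => x z; rewrite !mem_bits => /eqP sx /eqP sz xz.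
  by rewrite -(padK x sx) -(padK z sz) xz.
move=> _ /mapP [x + ->]; rewrite !mem_bits => /eqP sx.
by rewrite /pad !size_cat !size_nseq sx size_rev.
Qed.

Lemma hc_unique x y z : hk (x - iota y) -> hk (x - iota z) -> y = z.
Proof.
move=> xy xz.
apply/eqP; rewrite -subr_eq0; apply/eqP/corner_injective.
have := hk_vu xy; have := hk_vu xz.
rewrite !mulrBr !mulrBl => /eqP; rewrite subr_eq0 => /eqP -> /eqP.
rewrite subr_eq0 (linB ilin) mulrBr mulrBl => /eqP <-; exact: subrr.
Qed.

Variable hc : A -> Aa.
Hypothesis hcE0 : forall x, (exists y, hk (x - iota y)) -> hk (x - iota (hc x)).

Lemma hcE x y : hk (x - iota y) -> hc x = y.
Proof.
move=> xy; have h : hk (x - iota (hc x)) by apply: hcE0; exists y.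
exact: hc_unique h xy.
Qed.

Lemma hcP x : hk (x - iota (hc x)).
Proof. by have [y yP] := hc_exists x; rewrite (hcE yP). Qed.

Lemma hc_linear c x y : hc (c *: x + y) = c *: hc x + hc y.
Proof.
apply: hcE; rewrite ilin opprD addrACA -scalerBr.
by apply: lspanD; [apply: lspanZ|]; exact: hcP.
Qed.

Lemma hc1 : hc 1 = 1.
Proof.
by apply: hcE; rewrite imon.1 subrr; exact: lspan0.
Qed.

(** As no nonempty sum of positive weights vanishes, a normally ordered monomial of
    weight 0 has factors from both p- and p+ or from neither. *)
Lemma weight0_split x : (forall H, H \in t -> Cl_ad H x = 0) -> exists y,
  lspan (fun z => exists f e b, [/\ f \in fs, e \in es & z = g f * b * g e]) (x - iota y).
Proof.
move=> x0.
have : lspan (wnormal 0) x.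
  by apply: weight_part => H; rewrite x0 ?subvsP // zero_lfunE scale0r.
elim=> [|c s z s0 _ [y yP]]; first by exists 0; rewrite (lin0 ilin) subrr; exact: lspan0.
have [[w ->]|[f [e [b fe]]]] := wnormal0 s0.
  by exists (c *: w + y); rewrite ilin opprD addrACA subrr add0r.
exists y; rewrite -addrA; apply: lspanS yP; by exists f, e, b.
Qed.

(** x y - x_0 y_0 = (x - x_0) y + x_0 (y - y_0), where the first summand lies in
    p- Cl(p) and the second in Cl(p) p+. *)
Lemma hcM x y : (forall X, X \in k -> Cl_ad X x = 0) -> (forall X, X \in k -> Cl_ad X y = 0) -> hc (x * y) = hc x * hc y.
Proof.
move=> xk yk.
have [x0 xP] := weight0_split (fun H Ht => xk H (t_k Ht)).
have [y0 yP] := weight0_split (fun H Ht => yk H (t_k Ht)).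
have hkx z : lspan (fun z => exists f e b, [/\ f \in fs, e \in es & z = g f * b * g e]) z -> hk z.
  by apply: lspan_trans => _ [f [e [b [ff ee ->]]]]; exact: hk_es.
rewrite (hcE (hkx _ xP)) (hcE (hkx _ yP)); apply: hcE.
have -> : x * y - iota (x0 * y0) = (x - iota x0) * y + iota x0 * (y - iota y0).
  by rewrite imon.2 mulrBl mulrBr addrA subrK.
apply: lspanD.
  apply: (@lspan_trans _ _ (fun z => exists f b, f \in fs /\ z = g f * b)).
    by move=> _ [f [b [ff ->]]]; exact: hk_fs.
  apply: (lspan_map (f := fun z => z * y) (mulr_lin y)) xP => _ [f [e [b [ff ee ->]]]].
  by apply: lspan_in; exists f, (b * g e * y); split=> //; rewrite !mulrA.
apply: (@lspan_trans _ _ (fun z => exists e b, e \in es /\ z = b * g e)).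
  by move=> _ [f [b [ff ->]]]; exact: hk_es.
apply: (lspan_map (f := fun z => iota x0 * z) (mull_lin (iota x0))) yP => _ [f [e [b [ff ee ->]]]].
by apply: lspan_in; exists e, (iota x0 * g f * b); split=> //; rewrite !mulrA.
Qed.

(** ** Surjectivity *)

Lemma spin_weight X (mu : tdual t) : X \in k -> X \in weight_space mu ->
  forall H : subvs_of t, Cl_ad (vsval H) (spin X) = (mu H : C) *: spin X.
Proof.
move=> Xk /weight_spaceP Xmu H; have Hk := t_k (subvsP H).
by rewrite Cl_ad_spin // spin_lie // Xmu (linZ spin_linear).
Qed.

(** spin X has the weight of X, so that its normal form has a factor from p- on the
    left. *)
Lemma v_spin X mu : X \in k -> pos mu -> X \in weight_space (- mu) -> v * spin X = 0.
Proof.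
move=> Xk pmu Xmu; apply: (lspan_ker (mull_lin v) _ (weight_part (spin_weight Xk Xmu))).
move=> s /(wnormal_neg pmu) [f [b [ff ->]]].
by rewrite mulrA v_kill ?mul0r // fs_pm.
Qed.

Lemma spin_u X mu z : X \in k -> pos mu -> X \in weight_space mu -> spin X * (iota z * u) = 0.
Proof.
move=> Xk pmu Xmu.
apply: (lspan_ker (f := fun y => y * (iota z * u)) (mulr_lin _) _ (weight_part (spin_weight Xk Xmu))).
move=> s /(wnormal_pos pmu) [f [b [ff ->]]].
by rewrite -mulrA u_killa ?mulr0 // es_pp.
Qed.

Lemma spin_t_extremal H : H \in t -> exists c : C,
  v * spin H = c *: v /\ forall z, spin H * (iota z * u) = c *: (iota z * u).
Proof.
move=> /spin_t [c [e ->]]; exists c; split=> [|z].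
  rewrite mulrDr -scalerAr mulr1 mulr_sumr [X in _ + X]big1 ?addr0 // => j _.
  by rewrite -scalerAr mulrA v_kill ?mul0r ?scaler0 // fs_pm // mem_nth ?sfs.
rewrite mulrDl -scalerAl mul1r mulr_suml [X in _ + X]big1 ?addr0 // => j _.
by rewrite -scalerAl -mulrA u_killa ?mulr0 ?scaler0 // es_pp // mem_nth ?ses.
Qed.

(** For z in Cl(a) the average of z u v over the enveloping algebra of k is
    k-invariant, and its compression to the corner is v z u v u = v z u. *)
Lemma hc_surjective (z : Aa) : exists2 x, (forall X, X \in k -> Cl_ad X x = 0) & hc x = z.
Proof.
pose Nm (w : 'M[C]_d.+1) := exists X mu, [/\ X \in k, pos mu, X \in @weight_space _ _ t (- mu) &
  w = phi (spin X)].
pose Hm (w : 'M[C]_d.+1) := exists2 H, H \in t & w = phi (spin H).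
pose Np (w : 'M[C]_d.+1) := exists X mu, [/\ X \in k, pos mu, X \in @weight_space _ _ t mu &
  w = phi (spin X)].
pose gk := lspan (fun w => [\/ Nm w, Hm w | Np w]).
have pslin : linear (fun X => phi (spin X)) by move=> c X Y; rewrite spin_linear plin.
have gkP w : gk w <-> exists2 X, X \in k & w = phi (spin X).
  split=> [|[X Xk ->]].
    elim=> [|c s y sN _ [Y Yk ->]]; first by exists 0; rewrite ?mem0v // (lin0 pslin).
    have [X Xk ->] : exists2 X, X \in k & s = phi (spin X).
      case: sN => [[X [mu [Xk _ _ ->]]]|[X Xt ->]|[X [mu [Xk _ _ ->]]]]; exists X => //.
      exact: t_k.
    by exists (c *: X + Y); rewrite ?memvD ?memvZ // pslin.
  apply: (lspan_map pslin _ (k_span Xk)) => Y [Yk YP]; apply: lspan_in.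
  case: YP => [[mu pmu Ymu]|Yt|[mu pmu Ymu]]; [constructor 1|constructor 2|constructor 3].
  - by exists Y, mu.
  - by exists Y.
  - by exists Y, mu.
pose word (y : 'M[C]_d.+1) := exists2 s : seq 'M[C]_d.+1, (forall w, w \in s -> gk w) & y = \prod_(w <- s) w.
have [G GP] := lspan_vspace word.
have G1 : 1 \in G by apply/GP/lspan_in; exists [::]; rewrite ?big_nil.
have GM x y : x \in G -> y \in G -> x * y \in G.
  move=> /GP xG /GP yG; apply/GP.
  elim: xG => [|c _ x' [s sP ->] _ IH]; first by rewrite mul0r; exact: lspan0.
  rewrite mulrDl -scalerAl; apply: lspanD => //; apply: lspanZ.
  apply: (lspan_map (f := fun y => (\prod_(w <- s) w) * y) _ _ yG).
    by move=> c' z1 z2; rewrite mulrDr scalerAr.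
  move=> _ [s' s'P ->]; apply: lspan_in; exists (s ++ s'); last by rewrite big_cat.
  by move=> w; rewrite mem_cat => /orP [/sP|/s'P].
have gkG w : gk w -> w \in G.
  by move=> wk; apply/GP/lspan_in; exists [:: w]; rewrite ?big_seq1 // => y; rewrite inE => /eqP ->.
have Gadj x : x \in G -> adj x \in G.
  move=> /GP; elim=> [|c _ y [s sP ->] _ yG]; first by rewrite adj0 mem0v.
  rewrite adjD adjZ memvD // memvZ //.
  elim: s sP => [|w s IH] sP; first by rewrite big_nil adj1.
  rewrite big_cons adjM GM //; first by apply: IH => w' ws; apply: sP; rewrite inE ws orbT.
  have /gkP [X Xk ->] := sP w (mem_head w s); have [Y Yk ->] := spin_adj Xk.
  by apply: gkG; apply/gkP; exists Y.
have gk_lie x y : gk x -> gk y -> gk (x * y - y * x).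
  move=> /gkP [X Xk ->] /gkP [Y Yk ->]; apply/gkP; exists (lie X Y); first exact: k_lie.
  by rewrite -spin_lie // (linB plin) !pmon.2.
have /choice [sigma sigmaP] : forall w, exists c : C, Hm w -> phi v * w = c *: phi v /\
    forall z', w * phi (iota z' * u) = c *: phi (iota z' * u).
  move=> w; case: (pselect (Hm w)) => [[H Ht ->]|nw]; last by exists 0.
  have [c [cv cu]] := spin_t_extremal Ht; exists c => _; split=> [|z'].
    by rewrite -pmon.2 cv (linZ plin).
  by rewrite -pmon.2 cu (linZ plin).
have lv : lowest Nm Hm sigma (phi v).
  split=> [w [X [mu [Xk pmu Xmu ->]]]|w /sigmaP [] //].
  by rewrite -pmon.2 (v_spin Xk pmu Xmu) (lin0 plin).
have hu z' : highest Hm Np sigma (phi (iota z' * u)).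
  split=> [w [X [mu [Xk pmu Xmu ->]]]|w /sigmaP [] //].
  by rewrite -pmon.2 (spin_u z' Xk pmu Xmu) (lin0 plin).
have hu1 : highest Hm Np sigma (phi u) by have := hu 1; rewrite imon.1 mul1r.
have vu0 : phi v * phi u != 0.
  rewrite -pmon.2 -(lin0 plin) (inj_eq pinj); apply/eqP => vu0.
  have /eqP : (1 : Aa) = 0 by apply: corner_injective; rewrite imon.1 mulr1.
  by rewrite (negbTE (oner_neq0 _)).
have [T [Tcom Tvu Tsum]] := extremal_average G1 GM Gadj gk_lie GP lv hu1 vu0.
have Gphi y : y \in G -> exists x, y = phi x.
  move=> /GP; elim=> [|c _ y' [s sP ->] _ [x' ->]]; first by exists 0; rewrite (lin0 plin).
  have [x ->] : exists x, \prod_(w <- s) w = phi x.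
    elim: s sP => [|w s IH] sP; first by exists 1; rewrite big_nil pmon.1.
    have [x ->] : exists x, w = phi x.
      by have /gkP [X _ ->] := sP w (mem_head w s); exists (spin X).
    have [x1 E1] : exists x, \prod_(w <- s) w = phi x.
      by apply: IH => w' ws; apply: sP; rewrite inE ws orbT.
    by exists (x * x1); rewrite big_cons E1 pmon.2.
  by exists (c *: x + x'); rewrite plin.
have [x xT] : exists x, T (phi (iota z * u) * phi v) = phi x.
  have [I [xs [ys [xyG ->]]]] := Tsum (phi (iota z * u) * phi v).
  have /choice [xs' xsE] : forall i, exists x', xs i = phi x' by move=> i; apply/Gphi; have [] := xyG i.
  have /choice [ys' ysE] : forall i, exists x', ys i = phi x' by move=> i; apply/Gphi; have [] := xyG i.
  exists (\sum_i xs' i * (iota z * u * v) * ys' i).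
  rewrite (lin_sum plin); apply: eq_bigr => i _.
  by rewrite xsE ysE !pmon.2.
exists x.
  move=> X Xk; apply: pinj; rewrite Cl_ad_spin // (linB plin) !pmon.2 -xT Tcom ?subrr ?(lin0 plin) //.
  by apply: gkG; apply/gkP; exists X.
apply/eqP; rewrite -subr_eq0; apply/eqP/corner_injective; rewrite (linB ilin) mulrBr mulrBl.
have := hk_vu (hcP x); rewrite mulrBr mulrBl => /eqP; rewrite subr_eq0 => /eqP <-.
apply/eqP; rewrite subr_eq0; apply/eqP/pinj.
rewrite !pmon.2 -xT Tvu; last exact: hu.
by rewrite -!pmon.2 -!mulrA [u * (v * u)]mulrA uvu.
Qed.

Definition k_invariant (x : A) := forall X, X \in k -> Cl_ad X x = 0.

Theorem hc_hom : [/\ forall c x y, k_invariant x -> k_invariant y ->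
    hc (c *: x + y) = c *: hc x + hc y, hc 1 = 1,
  forall x y, k_invariant x -> k_invariant y -> hc (x * y) = hc x * hc y &
  forall z, exists2 x, k_invariant x & hc x = z].
Proof. by split=> [c x y _ _|||]; [exact: hc_linear|exact: hc1|exact: hcM|exact: hc_surjective]. Qed.

End Algebra.

Local Notation Hc := (@hc_proj C L B a p pm pp).

(** The matrix model also shows that 1 != 0 in Cl(p), hence in Cl(a), so that the
    results on algebras apply to them. *)
Theorem hc_hom_Cl :
  [/\ forall (c : C) x y, Cl_invariant k x -> Cl_invariant k y ->
        Hc (c *: x + y) = c *: Hc x + Hc y,
      Hc 1 = 1,
      forall x y, Cl_invariant k x -> Cl_invariant k y ->
        Hc (x * y) = Hc x * Hc y &
      forall z, exists2 x, Cl_invariant k x & Hc x = z].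
Proof.
pose bp := @form_on C L B p; pose ba := @form_on C L B a.
have oS : <<o>>%VS = p := span_basis o_basis.
have op (i : 'I_n) : o`_i \in p by rewrite -oS memv_span // mem_nth ?size_tuple.
pose eh : n.-tuple (subvs_of p) := [tuple vsproj p o`_i | i < n].
have ehE (i : 'I_n) : eh`_i = vsproj p o`_i by rewrite -tnth_nth tnth_mktuple.
have eh_map : eh = map (vsproj p) o :> seq _.
  apply: (@eq_from_nth _ 0) => [|i]; first by rewrite size_map !size_tuple.
  rewrite size_tuple => li; rewrite (nth_map 0) ?size_tuple //; exact: (ehE (Ordinal li)).
have eh_basis : basis_of fullv eh.
  rewrite basisEdim size_tuple eh_map (span_vsproj oS) subvv.
  by rewrite dimvf eq_leq //; exact: esym (size_basis o_basis).
have eh_orth (i j : 'I_n) : bp eh`_i eh`_j = (i == j)%:R.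
  by rewrite !ehE /bp /form_on !vsprojK.
have blin u : scalar (bp u) by move=> c x y; rewrite /bp /form_on linearP B_linear.
have [d [phi [plin pmon pinj phadj pfree0]]] :=
  clifford_model (b := bp) (fun u v => B_sym _ _) blin eh_basis eh_orth.
have padj (i : 'I_n) : adj (phi (cl_gen B p o`_i)) = phi (cl_gen B p o`_i).
  by rewrite /cl_gen -ehE; exact: phadj.
have pfree : forall s : seq L, perm_eq s (fs ++ vbasis a ++ es) ->
    free [seq phi (\prod_(x <- mask mk s) cl_gen B p x) | mk <- bits (size s)].
  move=> s ps; have ss : size s = n.
    by rewrite (perm_size ps) -(size_basis (X := in_tuple _) p_basis) (size_basis o_basis).
  have -> : [seq phi (\prod_(x <- mask mk s) cl_gen B p x) | mk <- bits (size s)] =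
            [seq phi (\prod_(v <- mask mk (map (vsproj p) s)) clifford_gen bp v) | mk <- bits n].
    by rewrite ss; apply: eq_map => mk; rewrite -map_mask big_map.
  apply: pfree0; last by rewrite size_map.
  by apply: span_vsproj; rewrite (eq_span (perm_mem ps)) (span_basis p_basis).
have nep : (1 : clifford bp) != 0.
  by apply/eqP => E; have := pmon.1; rewrite E (lin0 plin) => /eqP; rewrite eq_sym oner_eq0.
have [ilin imon igen] := Cl_inclP B a_p.
have nea : (1 : clifford ba) != 0.
  by apply: contra nep => /eqP E; rewrite -[X in X == _]imon.1 E (lin0 ilin).
pose A' : algType C := nzclifford nep; pose Aa' : algType C := nzclifford nea.
have kP := hc_kernelP (B := B) pp_p pm_p.
have hcE0 (x : Cl B p) : (exists y, lspan (fun z : Cl B p =>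
     (exists2 f, f \in pm & exists b, z = cl_gen B p f * b) \/
     (exists2 e, e \in pp & exists b, z = b * cl_gen B p e)) (x - Cl_incl a p y)) ->
   lspan (fun z : Cl B p =>
     (exists2 f, f \in pm & exists b, z = cl_gen B p f * b) \/
     (exists2 e, e \in pp & exists b, z = b * cl_gen B p e)) (x - Cl_incl a p (Hc x)).
  move=> [y /kP xy]; apply/kP; rewrite /hc_proj.
  exact (@xgetPex _ (0 : Cl B a) [set y | hc_kernel pm pp (x - Cl_incl a p y)]%classic
    (ex_intro _ y xy)).
have DP X (Xk : X \in k) := Cl_adP B_ginv (fun y => @k_p X y Xk).
have monp := @monomials_vsproj C L B p _ (span_basis p_basis).
have mona := @monomials_vsproj C L B a _ (span_basis (vbasisP a)).
exact (@hc_hom A' Aa' (cl_gen B p) (cl_gen B a) (Cl_incl a p) (@Cl_ad C L B p)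
  (@cl_gen_linear C L B p) (@cl_gen_anti C L B p) ilin imon igen monp mona DP
  d phi plin pmon pinj padj pfree Hc hcE0).
Qed.

End HarishChandra.

(** * The compact real form *)

Lemma eigenvector_exists (C : closedFieldType) (V : vectType C) (f : 'End(V)) (x : V) :
  x != 0 -> exists c y, y != 0 /\ f y = c *: y.
Proof.
move=> x0; have [_ [N [_ sp _ _]]] := jordan_semisimple f.
have [y [y0 [c yc]]] : exists y, y != 0 /\ exists c, iter N (fun y => f y - c *: y) y = 0.
  apply: contrapT => ny; case/eqP: x0; elim: (sp x) => // c s z [d sd] _ ->; rewrite addr0.
  have [->|s0] := eqVneq s 0; first by rewrite scaler0.
  by case: ny; exists s; split => //; exists d.
elim: N yc {sp} => [|N IH] /=; first by move=> y00; rewrite y00 eqxx in y0.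
have [/IH //|z0] := eqVneq (iter N (fun y => f y - c *: y) y) 0.
by move=> /eqP; rewrite subr_eq0 => /eqP E; exists c, (iter N (fun y => f y - c *: y) y).
Qed.

(** Gram-Schmidt. *)
Lemma orthonormal_basis (R : rcfType) (V : vectType R) (q : V -> V -> R) (U : {vspace V}) :
  (forall x, scalar (q x)) -> (forall x y, q x y = q y x) ->
  (forall x, x != 0 -> 0 < q x x) ->
  exists X : seq V, basis_of U X /\
    forall i j, (i < size X)%N -> (j < size X)%N -> q X`_i X`_j = (i == j)%:R.
Proof.
move=> qlin qsym qpos; have [n] := ubnP (\dim U).
elim: n U => // n IH U; rewrite ltnS => dU.
have [->|U0] := eqVneq U 0%VS.
  by exists [::]; split => //; rewrite /basis_of span_nil eqxx nil_free.
have [u uU u0] : exists2 u, u \in U & u != 0.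
  by exists (vpick U); rewrite ?memv_pick ?vpick0.
pose e := (Num.sqrt (q u u))^-1 *: u.
have qll y : scalar (q^~ y) by move=> c a b; rewrite /= ![q _ y]qsym qlin.
have s0 : Num.sqrt (q u u) != 0 by rewrite gt_eqF // sqrtr_gt0 qpos.
have eU : e \in U by rewrite memvZ.
have qee : q e e = 1.
  rewrite /e (sclZ (qlin _)) (sclZ (qll u)) -{3}[q u u]sqr_sqrtr ?ltW ?qpos // expr2.
  by rewrite mulKf // mulVf.
pose f := linfun (q e : V -> R^o).
have fE x : f x = q e x by apply: linfun_linE; exact: qlin.
pose U' := (U :&: lker f)%VS.
have U'P x : x \in U' = (x \in U) && (q e x == 0) by rewrite memv_cap memv_ker fE.
have eU' : e \notin U' by rewrite U'P qee oner_eq0 andbF.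
have dU' : (\dim U' < \dim U)%N.
  rewrite (ltn_leqif (dimv_leqif_sup (capvSl _ _))).
  by apply: contra eU' => /subvP; apply.
have [X [bX qX]] := IH U' (leq_trans dU' dU).
have XU' x : x \in X -> x \in U' by move=> xX; rewrite -(span_basis bX) memv_span.
exists (e :: X); split.
  rewrite /basis_of free_cons (span_basis bX) eU' (basis_free bX) andbT.
  rewrite eqEsubv span_cons (span_basis bX) subv_add capvSl andbT -memvE eU /=.
  apply/subvP => x xU; apply/memv_addP; exists (q e x *: e); first by rewrite memvZ ?memv_line.
  exists (x - q e x *: e); last by rewrite addrC subrK.
  rewrite U'P memvB ?memvZ //= (sclD (qlin e)) (sclN (qlin e)) (sclZ (qlin e)) qee mulr1 subrr.
  by rewrite eqxx.
have qe j : (j < size X)%N -> q e X`_j = 0.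
  by move=> jX; have := XU' _ (mem_nth 0 jX); rewrite U'P => /andP [_ /eqP].
move=> [|i] [|j] //= iX jX; rewrite ?qe //; last exact: qX.
by rewrite qsym qe.
Qed.

Section Compact.
Local Open Scope complex_scope.
Variables (R : rcfType) (g0 : lieAlgType R).
Hypothesis g0_simple : lie_simple g0.
Hypothesis g0_compact : forall x : g0, x != 0 -> killing x x < 0.
Local Notation C := (R[i]).
Local Notation L := (cplx g0).
Local Notation K := (@killing R g0).

Definition emb (x : g0) : L := (x, 0).

Lemma emb_split (z : L) : z = emb z.1 + 'i *: emb z.2.
Proof.
case: z => x y; rewrite /emb cplx_scaleE cplx_addE /= !scale0r !scaler0 !scale1r.
by rewrite oppr0 !addr0 !add0r.
Qed.

Lemma embZ (c : R) x : emb (c *: x) = c%:C *: emb x.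
Proof. by rewrite /emb cplx_scaleE /= !scaler0 !scale0r subr0 addr0. Qed.

Lemma embD x y : emb (x + y) = emb x + emb y.
Proof. by rewrite /emb cplx_addE /= addr0. Qed.

Lemma emb_sum (I : Type) (r : seq I) (P : pred I) (F : I -> g0) :
  emb (\sum_(i <- r | P i) F i) = \sum_(i <- r | P i) emb (F i).
Proof. by apply: (big_morph emb); [exact: embD | by []]. Qed.

Lemma emb_lie x y : lie (emb x) (emb y) = emb (lie x y).
Proof. by rewrite /lie /= /cplx_lie /emb /= !lie0l !lie0r subr0 addr0. Qed.

Lemma Kdef x : K x x = 0 -> x = 0.
Proof.
by move=> Kx; apply: contrapT => /eqP /g0_compact; rewrite Kx ltxx.
Qed.

Lemma K_le0 x : K x x <= 0.
Proof.
have [->|/g0_compact /ltW //] := eqVneq x 0.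
by rewrite (scl0 (killing_linear 0)).
Qed.

Lemma K_nondeg x : (forall y, K x y = 0) -> x = 0.
Proof. by move=> x0; apply: Kdef. Qed.

(** A basis of g0 over R is a basis of its complexification over C. *)
Lemma killing_emb x y : killing (emb x) (emb y) = (K x y)%:C.
Proof.
pose X := vbasis {:g0}; have bX : basis_of fullv X := vbasisP _.
have cX w : w = \sum_(i < \dim {:g0}) coord X i w *: X`_i.
  by apply: coord_basis bX _; rewrite memvf.
set N := \dim {:g0} in X bX cX *.
pose X' : N.-tuple L := [tuple emb X`_i | i < N].
have X'E (i : 'I_N) : X'`_i = emb X`_i by rewrite -tnth_nth tnth_mktuple.
have zE (z : L) : z = \sum_(i < N) (coord X i z.1 +i* coord X i z.2) *: X'`_i.
  rewrite [z in LHS]emb_split {1}[z.1]cX {1}[z.2]cX !emb_sum scaler_sumr -big_split.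
  apply: eq_bigr => i _ /=; rewrite X'E !embZ scalerA -scalerDl; congr (_ *: _).
  by rewrite /GRing.mul /GRing.add /= ?(mul0r, mul1r, mulr0, subr0, addr0, add0r).
have freeX' : free X'.
  apply/freeP => c c0 i.
  pose xr := \sum_(i < N) complex.Re (c i) *: X`_i; pose yr := \sum_(i < N) complex.Im (c i) *: X`_i.
  have E0 : emb xr + 'i *: emb yr = 0.
    rewrite -[RHS]c0 /xr /yr !emb_sum scaler_sumr -big_split; apply: eq_bigr => j _ /=.
    rewrite X'E !embZ scalerA -scalerDl; congr (_ *: _); case: (c j) => a b.
    by rewrite /GRing.mul /GRing.add /= ?(mul0r, mul1r, mulr0, subr0, addr0, add0r).
  have /freeP fX := basis_free bX.
  have [xr0 yr0] : xr = 0 /\ yr = 0.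
    have := emb_split (xr, yr); rewrite E0 => -[-> ->]; by [].
  have := fX _ xr0 i; have := fX _ yr0 i; case: (c i) => a b /= -> ->.
  by [].
have bX' : basis_of fullv X'.
  rewrite /basis_of freeX' andbT eqEsubv subvf; apply/subvP => z _; rewrite [z]zE.
  by apply: memv_suml => i _; rewrite memvZ // memv_span // mem_nth ?size_tuple.
rewrite /killing (lfun_trace_basis _ bX') (lfun_trace_basis _ bX).
have -> : (\sum_(i < N) coord X i ((ad x \o ad y)%VF X`_i))%:C =
   \sum_(i < N) (coord X i ((ad x \o ad y)%VF X`_i))%:C.
  by apply: (big_morph (fun r : R => r%:C)) => // a b; rewrite rmorphD.
apply: eq_bigr => i _; rewrite X'E !comp_lfunE !adE !emb_lie.
rewrite {1}[emb _]zE coord_sum_free //= linear0.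
by [].
Qed.

Lemma killingl (L' : lieAlgType C) (y : L') : scalar (fun x : L' => killing x y).
Proof. by move=> c u w; rewrite ![killing _ y]killingC killing_linear. Qed.

(** Pairing x + iy with its conjugate gives K(x, x) + K(y, y). *)
Lemma killing_cplx_nondeg (z : L) : (forall y, killing z y = 0) -> z = 0.
Proof.
move=> z0; have := z0 (emb z.1 - 'i *: emb z.2); rewrite {1}[z]emb_split.
have kl := killing_linear; have kr := killingl.
rewrite (sclD (kl _ _ _)) (sclN (kl _ _ _)) (sclZ (kl _ _ _)) !(sclD (kr _ _)) !(sclZ (kr _ _)).
rewrite !killing_emb [K z.2 z.1]killingC => E.
have {E} : K z.1 z.1 + K z.2 z.2 = 0.
  have ii : 'i * 'i = -1 :> C by rewrite -expr2 sqr_i.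
  apply: (@complexI R); rewrite rmorphD /= -[RHS]E; ring: ii.
move=> E.
have z1 : K z.1 z.1 = 0.
  apply/eqP; rewrite eq_le K_le0 /=.
  by have := K_le0 z.2; rewrite -(addr0 (K z.2 z.2)) -E addrA -subr_ge0 => h; have := K_le0 z.2; lra.
have z2 : K z.2 z.2 = 0 by move: E; rewrite z1 add0r.
by rewrite [z]emb_split (Kdef z1) (Kdef z2) scaler0 addr0.
Qed.

(** The operator relating b to the Killing form is symmetric for the latter, hence
    has a real eigenvalue, and its eigenspaces are ideals. *)
Lemma invariant_form (b : g0 -> g0 -> R) :
  (forall x, scalar (b x)) -> (forall x y, b x y = b y x) ->
  (forall x y z, b (lie x y) z + b y (lie x z) = 0) ->
  exists c, forall x y, b x y = c * K x y.
Proof.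
move=> blin bsym binv; have Kl := killing_linear (L := g0).
have Kll y : scalar (fun x : g0 => K x y) by move=> c u w; rewrite ![killing _ y]killingC Kl.
have /choice [T0 T0P] : forall x, exists u, forall y, K u y = b x y.
  by move=> x; apply: (nondeg_repr (b := K)) => //; exact: K_nondeg.
have Tlin : linear T0.
  move=> c x y; apply/eqP; rewrite -subr_eq0; apply/eqP/K_nondeg => z.
  rewrite (sclD (Kll z)) (sclN (Kll z)) (Kll z) !T0P bsym blin ![b z _]bsym.
  exact: subrr.
pose T : 'End(g0) := linfun T0.
have TP x y : K (T x) y = b x y by rewrite /T linfun_linE.
have Tad z x : T (lie z x) = lie z (T x).
  apply/eqP; rewrite -subr_eq0; apply/eqP/K_nondeg => y.
  rewrite (sclD (Kll y)) (sclN (Kll y)) TP; apply/eqP; rewrite subr_eq0; apply/eqP.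
  have /eqP := killing_inv z (T x) y; rewrite addr_eq0 => /eqP ->; rewrite TP.
  by apply/eqP; rewrite -addr_eq0 binv.
have Tsym x y : K (T x) y = K x (T y) by rewrite [RHS]killingC !TP bsym.
have [[x0 [y0 xy0]] ideals] := g0_simple.
have xn : emb x0 != 0.
  apply: contra xy0 => /eqP [->]; by rewrite lie0l.
have [[a c] [z [z0 Tz]]] := eigenvector_exists (cplx_lfun T) xn.
have [Tz1 Tz2] : T z.1 = a *: z.1 - c *: z.2 /\ T z.2 = a *: z.2 + c *: z.1.
  by move: Tz; rewrite cplx_lfunE cplx_scaleE => -[].
have c0 : c = 0.
  have := Tsym z.1 z.2; rewrite Tz1 Tz2 (sclD (Kll _)) (sclN (Kll _)) !(sclZ (Kll _)).
  rewrite (sclD (Kl _)) !(sclZ (Kl _)) => /addrI /eqP; rewrite eq_sym -addr_eq0 -mulrDr.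
  rewrite mulf_eq0 => /orP [/eqP //|/eqP E].
  have z1 : K z.1 z.1 = 0 by have := K_le0 z.1; have := K_le0 z.2; lra.
  have z2 : K z.2 z.2 = 0 by have := K_le0 z.1; have := K_le0 z.2; lra.
  by case/eqP: z0; rewrite [z]emb_split (Kdef z1) (Kdef z2) scaler0 addr0.
rewrite c0 !scale0r subr0 addr0 in Tz1 Tz2.
pose U := lker (T - a *: \1%VF).
have UP x : (x \in U) = (T x == a *: x).
  by rewrite memv_ker add_lfunE opp_lfunE scale_lfunE id_lfunE subr_eq0.
have Uid : lie_ideal U.
  by move=> x u; rewrite !UP Tad => /eqP ->; rewrite lieZr.
have TE x : T x = a *: x.
  case: (ideals U Uid) => UE; last by apply/eqP; rewrite -UP UE memvf.
  case/eqP: z0; rewrite [z]emb_split.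
  have z1 : z.1 = 0 by apply/eqP; rewrite -memv0 -UE UP Tz1.
  have z2 : z.2 = 0 by apply/eqP; rewrite -memv0 -UE UP Tz2.
  by rewrite z1 z2 scaler0 addr0.
by exists a => x y; rewrite -TP TE (sclZ (Kll y)).
Qed.

Variable B : L -> L -> C.
Hypotheses (B_linear : forall x, scalar (B x)) (B_sym : forall x y, B x y = B y x).
Hypothesis B_nondeg : forall x, (forall y, B x y = 0) -> x = 0.
Hypothesis B_ginv : forall x y z, B (lie x y) z + B y (lie x z) = 0.

Lemma complexE (z : C) : z = complex.Re z +i* complex.Im z.
Proof. by case: z. Qed.

(** The real and imaginary parts of B on g0 are invariant forms. *)
Lemma B_killing : exists2 l : C, l != 0 & forall x y, B (emb x) (emb y) = l * (K x y)%:C.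
Proof.
have ReD (u w : C) : complex.Re (u + w) = complex.Re u + complex.Re w by case: u w => ? ? [].
have ImD (u w : C) : complex.Im (u + w) = complex.Im u + complex.Im w by case: u w => ? ? [].
have ReZ (r : R) (w : C) : complex.Re (r%:C * w) = r * complex.Re w.
  by case: w => a b; rewrite /GRing.mul /= mul0r subr0.
have ImZ (r : R) (w : C) : complex.Im (r%:C * w) = r * complex.Im w.
  by case: w => a b; rewrite /GRing.mul /= mul0r addr0.
have lin x c y z : B (emb x) (emb (c *: y + z)) = c%:C * B (emb x) (emb y) + B (emb x) (emb z).
  by rewrite embD embZ B_linear.
have [c1 c1P] : exists c, forall x y, complex.Re (B (emb x) (emb y)) = c * K x y.
  apply: invariant_form.
  - by move=> x c y z; rewrite lin ReD ReZ.
  - by move=> x y; rewrite B_sym.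
  - by move=> x y z; rewrite -ReD -!emb_lie B_ginv.
have [c2 c2P] : exists c, forall x y, complex.Im (B (emb x) (emb y)) = c * K x y.
  apply: invariant_form.
  - by move=> x c y z; rewrite lin ImD ImZ.
  - by move=> x y; rewrite B_sym.
  - by move=> x y z; rewrite -ImD -!emb_lie B_ginv.
have BE x y : B (emb x) (emb y) = (c1 +i* c2) * (K x y)%:C.
  rewrite [LHS]complexE c1P c2P; move: (K x y) => r.
  by apply/eqP; rewrite eq_complex /= !mulr0 subr0 add0r !eqxx.
exists (c1 +i* c2) => //; apply/eqP => l0.
have [[x0 [y0 /eqP nz]] _] := g0_simple; apply: nz.
have : emb x0 = 0.
  apply: B_nondeg => y; rewrite [y]emb_split B_sym B_sym (sclD (B_linear _)) (sclZ (B_linear _)).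
  by rewrite !BE l0 !mul0r mulr0 addr0.
by move=> [->]; rewrite lie0l.
Qed.

Variable theta0 : 'End(g0).
Hypotheses (theta0_lie : lie_morphism theta0) (theta0_inv : (theta0 \o theta0)%VF = \1%VF).
Local Notation theta := (cplx_lfun theta0).
Local Notation p := (sym_p theta0).
Local Notation k := (sym_k theta0).

Lemma theta_lie : lie_morphism theta.
Proof.
move=> x y; rewrite !cplx_lfunE /lie /= /cplx_lie /= !linearD linearN /= !theta0_lie.
by [].
Qed.

Lemma theta_inv : (theta \o theta)%VF = \1%VF.
Proof.
apply/lfunP => x; rewrite comp_lfunE !cplx_lfunE /= -!comp_lfunE theta0_inv !id_lfunE.
by case: x.
Qed.

(** B is a multiple of the Killing form, which is negative definite on g0: a basis
    of the real form of p that is orthonormal for the opposite of the Killing form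
    becomes orthonormal for B after multiplication by a common scalar.  The real
    form of k acts on it by real matrices, so that conjugating an element of k
    conjugates its matrix. *)
Lemma real_orthonormal : exists n (o : n.-tuple L), [/\ basis_of p o,
  forall i j : 'I_n, B o`_i o`_j = (i == j)%:R &
  forall X, X \in k -> exists2 Y, Y \in k &
    forall i j : 'I_n, B o`_j (lie Y o`_i) = Num.conj (B o`_j (lie X o`_i))].
Proof.
have [l l0 BE] := B_killing.
pose p0 := lker (theta0 + \1%VF).
have p0E x : (x \in p0) = (theta0 x == - x).
  by rewrite memv_ker add_lfunE id_lfunE addr_eq0.
have pE z : (z \in p) = (z.1 \in p0) && (z.2 \in p0).
  rewrite memv_ker add_lfunE id_lfunE addr_eq0 cplx_lfunE !p0E.
  by case: z => x y /=.
have [X [bX qX]] : exists X : seq g0, basis_of p0 X /\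
  forall i j, (i < size X)%N -> (j < size X)%N -> - K X`_i X`_j = (i == j)%:R.
  apply: (orthonormal_basis p0 (q := fun x y => - K x y)).
  - by move=> x c y z; rewrite killing_linear opprD mulrN.
  - by move=> x y; rewrite killingC.
  - by move=> x /g0_compact; rewrite oppr_gt0.
set n := size X in qX.
(* the factor turning -K into B *)
pose kap : C := sqrtC (- l^-1).
have kap2 : kap * kap * l = -1 by rewrite -expr2 sqrtCK mulNr mulVf.
have kap0 : kap != 0.
  by apply/eqP => k0; move: kap2; rewrite k0 !mul0r => /eqP; rewrite eq_sym oppr_eq0 oner_eq0.
pose o : n.-tuple L := [tuple kap *: emb X`_i | i < n].
have oE (i : 'I_n) : o`_i = kap *: emb X`_i by rewrite -tnth_nth tnth_mktuple.
have op (i : 'I_n) : o`_i \in p.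
  by rewrite oE memvZ // pE /= mem0v andbT -(span_basis bX) memv_span // mem_nth.
have Bl y : scalar (B^~ y) by move=> c u w; rewrite /= ![B _ y]B_sym B_linear.
have BKE (i : 'I_n) (z : L) : B o`_i (kap *: z) = - ((K X`_i z.1)%:C + 'i * (K X`_i z.2)%:C).
  rewrite oE (sclZ (Bl _)) (sclZ (B_linear _)) [z in LHS]emb_split (sclD (B_linear _)) (sclZ (B_linear _)) !BE.
  by rewrite -[RHS]mulN1r -kap2; ring.
have orth (i j : 'I_n) : B o`_i o`_j = (i == j)%:R.
  rewrite [o`_j]oE BKE /= (scl0 (killing_linear _)) mulr0 addr0.
  by rewrite -rmorphN /= qX // -val_eqE; case: eqP.
exists n, o; split => //.
  rewrite basisEfree; apply/and3P; split.
  - exact: (dual_free (f := fun i => B o`_i) (size_tuple o)).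
  - by apply/span_subvP => _ /mapP [i _ ->]; rewrite -oE op.
  have emb_in x : x \in p0 -> emb x \in <<o>>%VS.
    rewrite -(span_basis bX) => /(coord_span (X := in_tuple X)) ->.
    rewrite emb_sum memv_suml // => i _; rewrite embZ memvZ //.
    by rewrite -[emb _](scalerK kap0) memvZ // -(oE i) memv_span // mem_nth ?size_tuple.
  rewrite (leq_trans _ (dim_span o)) //; apply/dimvS/subvP => z; rewrite pE => /andP [z1 z2].
  by rewrite [z]emb_split memvD ?memvZ ?emb_in.
move=> Z Zk; exists (Z.1, - Z.2) => [|i j].
  move: Zk => /fixedSpaceP; rewrite cplx_lfunE => ZE; apply/fixedSpaceP.
  by rewrite cplx_lfunE /= linearN /=; move: ZE; case: (Z) => x y /= [-> ->].
have lieE (W : L) : lie W o`_i = kap *: ((lie W.1 X`_i, lie W.2 X`_i) : L).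
  by rewrite oE lieZr; congr (_ *: _); rewrite /lie /= /cplx_lie /emb /= !lie0r subr0 add0r.
rewrite !lieE !BKE /= lieNl (sclN (killing_linear _)).
move: (K _ _) (K _ _) => u v; apply/eqP; rewrite -[X in _ == X]/(conjc _) eq_complex /=.
by apply/andP; split; apply/eqP; ring.
Qed.

End Compact.

(** * Positive systems moved by the Weyl group *)

Lemma graded_sum (C : numClosedFieldType) (L : lieAlgType C) (t : {vspace L})
    (P : {fset tdual t}) (f : tdual t -> tdual t) (Q : tdual t -> Prop) :
  (forall mu, Q mu <-> exists2 alpha, alpha \in P & mu = f alpha) ->
  graded Q (\sum_(alpha <- P) weight_space (f alpha))%VS.
Proof.
move=> QP x; split=> [|xS].
  rewrite big_tnth => /memv_sumP [v vP ->].
  apply: lspan_sum => i _; apply: lspan_in; exists (f (tnth (in_tuple P) i)); last exact: vP.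
  by apply/QP; exists (tnth (in_tuple P) i); rewrite // mem_tnth.
elim: xS => [|c y z [mu /QP [al alP ->] yw] _ IH]; first exact: mem0v.
rewrite memvD // memvZ //; apply: (subvP _ _ yw).
by rewrite (big_rem al) //= addvSl.
Qed.

Theorem proposition6p7 (R : realType)
  (* the Lie algebra of a compact connected simple Lie group, and its
     involution *)
  (g0 : lieAlgType R)
  (g0_simple : lie_simple g0)
  (g0_compact : forall x : g0, x != 0 -> killing x x < 0)
  (theta0 : 'End(g0))
  (theta0_lie : lie_morphism theta0)
  (theta0_inv : (theta0 \o theta0)%VF = \1%VF)
  (* the invariant form on the complexification g = cplx g0 *)
  (B : cplx g0 -> cplx g0 -> R[i])
  (B_linear : forall x, scalar (B x))
  (B_sym : forall x y, B x y = B y x)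
  (B_nondeg : forall x, (forall y, B x y = 0) -> x = 0)
  (B_ginv : forall x y z, B (lie x y) z + B y (lie x z) = 0)
  (B_thetainv : forall x y, B (cplx_lfun theta0 x) (cplx_lfun theta0 y) = B x y)
  (* Cartan subalgebras t of k and h = t + a of g *)
  (t a : {vspace cplx g0})
  (t_cartan : cartan_subalg (sym_k theta0) t)
  (a_sub : (a <= sym_p theta0)%VS)
  (h_cartan : cartan_subalg fullv (t + a)%VS)
  (* positive systems of (k, t) and (g, t) *)
  (Pk Pg : {fset tdual t})
  (Pk_pos : positive_system (is_root (sym_k theta0)) Pk)
  (Pg_pos : positive_system (is_root fullv) Pg)
  (Pk_sub : (Pk `<=` Pg)%fset)
  (w : 'End(tdual t))
  (w_W1 : W1 B Pk Pg w) :
  let k := sym_k theta0 in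
  let p := sym_p theta0 in
  let hc : Cl B p -> Cl B a :=
    hc_proj a p (p :&: n_minus Pg w) (p :&: n_plus Pg w) in
  [/\ forall (c : R[i]) x y, Cl_invariant k x -> Cl_invariant k y ->
        hc (c *: x + y) = c *: hc x + hc y,
      hc 1 = 1,
      forall x y, Cl_invariant k x -> Cl_invariant k y ->
        hc (x * y) = hc x * hc y &
      forall z, exists2 x, Cl_invariant k x & hc x = z].
Proof.
move=> k p hc; pose theta := cplx_lfun theta0.
have th_lie : lie_morphism theta := theta_lie theta0_lie.
have th_inv : (theta \o theta)%VF = \1%VF := theta_inv theta0_inv.
have knd : forall x : cplx g0, (forall y, killing x y = 0) -> x = 0.
  exact: killing_cplx_nondeg g0_compact.
have center0 : forall x : cplx g0, (forall y, lie x y = 0) -> x = 0 by exact: centerless.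
have t_sk : forall x, x \in t -> x \in k.
  by case: t_cartan => /subvP.
have t_k : forall x, x \in t -> theta x = x by move=> x /t_sk /fixedSpaceP.
have tt : forall x y, x \in t -> y \in t -> lie x y = 0.
  exact: (t_abelian knd th_lie th_inv t_cartan).
have t_dg := t_diag knd th_lie th_inv t_cartan.
have ta := ta_commute knd th_lie th_inv t_cartan h_cartan.
have t_ck : forall y, theta y = y -> (forall x, x \in t -> lie x y = 0) -> y \in t.
  move=> y yk; apply: (centralizer_k t_cartan); exact/fixedSpaceP.
have t_c := centralizer_t knd th_lie th_inv t_cartan a_sub h_cartan.
(* w is injective and permutes the roots, so the weights w alpha for alpha in Pg
   inherit from Pg what the triangular decomposition asks for: each nonzero weight
   or its opposite is among them, and no nonempty sum of them vanishes *)
have [w_root w_surj w_inj] := weyl_roots center0 th_lie th_inv B_linear B_sym B_nondeg B_ginv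
  B_thetainv t_k tt t_dg t_ck w_W1.1.
pose pos mu := exists2 alpha, alpha \in Pg & mu = w alpha.
have pos_sum : forall s : seq (tdual t), (forall mu, mu \in s -> pos mu) ->
    s != [::] -> \sum_(mu <- s) mu != 0.
  move=> s sP s0.
  have [s' [s'P sE]] : exists s', (forall al, al \in s' -> al \in Pg) /\ s = map w s'.
    elim: s sP {s0} => [|mu s IH] sP; first by exists [::].
    have [|s' [s'P ->]] := IH; first by move=> nu ns; apply: sP; rewrite inE ns orbT.
    have [al alP muE] := sP mu (mem_head _ _); exists (al :: s'); split=> [be|]; last by rewrite /= muE.
    by rewrite inE => /orP [/eqP -> //|]; exact: s'P.
  rewrite sE big_map -linear_sum /=; apply/eqP => w0.
  have s'0 : s' != [::] by case: (s') sE s0 => // ->.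
  have := positive_sum center0 th_lie th_inv B_linear B_sym B_nondeg B_ginv B_thetainv t_k tt t_dg
    t_ck Pg_pos s'P s'0.
  by rewrite -(inj_eq w_inj) w0 linear0 eqxx.
have rootN mu x : mu != 0 -> x \in weight_space mu -> x != 0 -> pos mu \/ pos (- mu).
  move=> mu0 xmu x0; have muR := weight_root mu0 xmu x0.
  have [al alR <-] := w_surj _ muR; case: Pg_pos => _ xorP _.
  have := xorP _ alR; case: (boolP (al \in Pg)) => [alP _|_ /= alN].
    by left; exists al.
  by right; exists (- al) => //; rewrite linearN.
have npP : graded pos (n_plus Pg w) by apply: graded_sum.
have nmP : graded (fun mu => pos (- mu)) (n_minus Pg w).
  apply: (graded_sum (f := fun al => - w al)) => mu; split=> [[al alP /eqP]|[al alP ->]].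
    by rewrite eqr_oppLR => /eqP ->; exists al.
  by exists al => //; rewrite opprK.
have a_p : (a <= lker (theta + \1%VF)%R)%VS := a_sub.
have [m [es [fs [bs [[ses sfs] weights dual [es_span fs_span] p_basis]]]]] :=
  triangular_basis th_lie th_inv B_linear B_sym B_nondeg B_ginv B_thetainv t_k tt t_dg a_p ta t_c
    pos_sum rootN npP nmP.
have k_span : forall X, X \in k -> lspan (fun X => X \in k /\
  [\/ exists2 mu, pos mu & X \in weight_space (- mu), X \in t |
      exists2 mu, pos mu & X \in @weight_space _ _ t mu]) X.
  move=> X Xk; have kst h y : h \in t -> y \in k -> lie h y \in k.
    by move=> /t_sk /fixedSpaceP hk /fixedSpaceP yk; apply/fixedSpaceP; rewrite th_lie hk yk.
  have XS := weight_span tt t_dg kst Xk.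
  refine (lspan_mono _ XS) => Y [Yk [mu Ymu]]; split; first exact: Yk.
  have [->|Y0] := eqVneq Y 0; first by constructor 2; exact: mem0v.
  have [mu0|mu0] := eqVneq mu 0.
    have thY : theta Y = Y by move: Yk => /fixedSpaceP.
    constructor 2; apply: (t_ck _ thY) => h ht.
    have := weight_spaceP _ _ Ymu (vsproj t h).
    by rewrite mu0 vsprojK // zero_lfunE scale0r.
  have [pm|pm] := rootN _ _ mu0 Ymu Y0; first by constructor 3; exists mu.
  by constructor 1; exists (- mu); [exact: pm | rewrite opprK].
have [n [o [o_basis o_orth k_conj]]] :=
  real_orthonormal g0_simple g0_compact B_linear B_sym B_nondeg B_ginv theta0.
have pm_p : (p :&: n_minus Pg w <= p)%VS := capvSl _ _.
have pp_p : (p :&: n_plus Pg w <= p)%VS := capvSl _ _.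
have k_lie X Y : X \in k -> Y \in k -> lie X Y \in k.
  by move=> /fixedSpaceP Xk /fixedSpaceP Yk; apply/fixedSpaceP; rewrite th_lie Xk Yk.
have k_p X y : X \in k -> y \in p -> lie X y \in p.
  by move=> /fixedSpaceP Xk; exact: (p_stable th_lie Xk).
exact (@hc_hom_Cl (R[i]) (cplx g0) B B_linear B_sym B_ginv k p t a
  (p :&: n_plus Pg w)%VS (p :&: n_minus Pg w)%VS t_sk a_p pp_p pm_p ta pos pos_sum
  (@pp_pp (R[i]) (cplx g0) theta B B_linear B_sym B_ginv t pos pos_sum _ npP)
  (@pm_pm (R[i]) (cplx g0) theta B B_linear B_sym B_ginv t pos pos_sum _ nmP)
  (@a_pp (R[i]) (cplx g0) theta B B_linear B_sym B_ginv t a ta pos pos_sum _ npP)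
  (@a_pm (R[i]) (cplx g0) theta B B_linear B_sym B_ginv t a ta pos pos_sum _ nmP)
  m es fs bs ses sfs weights dual es_span fs_span p_basis k_lie k_p k_span n o o_basis o_orth k_conj).
Qed.
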